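(* Let $k:(0,+\infty)\to[0,+\infty)$ be a nonincreasing lower semicontinuous function, let $1\le q<p<+\infty$, and let $\mu$ and $\sigma$ be locally finite positive Borel measures on $\mathbf R^n$. Assume that $\sigma$ satisfies a doubling condition and that the pair $(k,\sigma)$ has the logarithmic bounded oscillation property (LBO): there is a constant $A$, not depending on $x\in\mathbf R^n$ and $r>0$, such that $$\sup_{y\in B(x,r)}\overline k(r)(y)\le A\inf_{y\in B(x,r)}\overline k(r)(y)\qquad\text{for all }x\in\mathbf R^n,\ r>0.$$ Then the following conditions are equivalent: (i) There exists a constant $C>0$ such that the trace inequality $$\int_{\mathbf R^n}\big|T_k[f\,d\sigma](x)\big|^q\,d\mu(x)\le C\,\|f\|^q_{L^p(d\sigma)},\qquad f\in L^p(d\sigma),$$ holds. (ii) $\mathcal W_{k,\sigma}[\mu]\in L^{\frac{q(p-1)}{p-q}}(d\mu)$.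
   Context: $B(x,r)$ is the ball of radius $r$ centered at $x$, and $p'=p/(p-1)$. The measure $\sigma$ satisfies a doubling condition if $\sigma\neq0$ and there is a constant $C$ with $\sigma(B(x,2r))\le C\,\sigma(B(x,r))$ for all $x\in\mathbf R^n$, $r>0$. The operator is $$T_k[f\,d\sigma](x)=\int_{\mathbf R^n}k(|x-y|)\,f(y)\,d\sigma(y)$$ (the value $k(0)$ is taken to be $\lim_{r\to0^+}k(r)$; a doubling measure has no atoms, so it plays no role). The trace inequality is understood to include absolute convergence of the integral $\mu$-a.e., so that it is equivalent to the same inequality for all nonnegative $f\in L^p(d\sigma)$. Further, $$\overline k(r)(x)=\frac1{\sigma(B(x,r))}\int_0^rk(s)\,\sigma(B(x,s))\,\frac{ds}{s},$$ $$\mathcal W_{k,\sigma}[\mu](x)=\int_0^{+\infty}k(r)\,\sigma(B(x,r))\Big(\int_{B(x,r)}\overline k(r)(y)\,d\mu(y)\Big)^{p'-1}\frac{dr}{r}.$$ Nonnegative quantities take values in $[0,+\infty]$, with the convention $0\cdot\infty=0$. *)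

(* Defs.v *)
From mathcomp Require Import all_boot all_order all_algebra.
From mathcomp Require Import all_classical all_reals all_analysis.
From mathcomp Require Import measurable_realfun.
Set Implicit Arguments.
Unset Strict Implicit.
Unset Printing Implicit Defensive.
Import Order.TTheory GRing.Theory Num.Theory.
Import numFieldNormedType.Exports.
Local Open Scope classical_set_scope.
Local Open Scope ring_scope.
Local Open Scope ereal_scope.

(* R^n with its Borel sigma-algebra; the topology of 'rV[R]_n comes from the
   sup norm and is therefore the Euclidean one. *)
Notation borelRn R n := (g_sigma_algebraType (@open 'rV[R%type]_n)).

Section Defs.
Context {R : realType} {n : nat}.
Implicit Types (k : R -> R) (mu sigma : {measure set (borelRn R n) -> \bar R}).

(* The library norm on 'rV[R]_n is the sup norm. *)
Definition euclid_dist (x y : 'rV[R]_n) : R :=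
  Num.sqrt (\sum_(i < n) ((x - y) ord0 i) ^+ 2)%R.

Definition eball (x : 'rV[R]_n) (r : R) : set 'rV[R]_n :=
  [set y | (euclid_dist x y < r)%R].

Definition locally_finite mu : Prop :=
  forall x : 'rV[R]_n, exists2 U, open_nbhs x U & mu U < +oo.

Definition doubling sigma : Prop :=
  (exists2 S : set (borelRn R n), measurable S & sigma S != 0) /\
  exists C : R, forall (x : 'rV[R]_n) (r : R), (0 < r)%R ->
    sigma (eball x (2 * r)%R) <= C%:E * sigma (eball x r).

(* A function on (0, +oo) is given as k : R -> R; its values on (-oo, 0] are
   never used. At 0 the kernel takes the value k(0+), possibly +oo. *)
Definition kernel0 k (r : R) : \bar R :=
  if (0 < r)%R then (k r)%:E else lim ((k s)%:E @[s --> 0%R^'+]).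

Definition Tk k sigma (f : borelRn R n -> R) (x : borelRn R n) : \bar R :=
  \int[sigma]_y (kernel0 k (euclid_dist x y) * (f y)%:E).

Definition kbar k sigma (r : R) (x : borelRn R n) : \bar R :=
  (sigma (eball x r))^-1 *
  \int[lebesgue_measure]_(s in `]0%R, r[)
     ((k s)%:E * sigma (eball x s) * (s^-1)%:E).

Definition LBO k sigma : Prop :=
  exists A : R, forall (x : 'rV[R]_n) (r : R), (0 < r)%R ->
    ereal_sup [set kbar k sigma r y | y in eball x r] <=
    A%:E * ereal_inf [set kbar k sigma r y | y in eball x r].

(* The conjugate exponent p'. *)
Definition conjexp (p : R) : R := (p / (p - 1))%R.

Definition wolff k sigma mu (p : R) (x : borelRn R n) : \bar R :=
  \int[lebesgue_measure]_(r in `]0%R, +oo[)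
     ((k r)%:E * sigma (eball x r) *
      (\int[mu]_(y in eball x r) kbar k sigma r y) `^ (conjexp p - 1) *
      (r^-1)%:E).

(* Lfun only covers real-valued functions. *)
Definition memLp mu (s : R) (g : borelRn R n -> \bar R) : Prop :=
  measurable_fun [set: borelRn R n] g /\ 'N[mu]_(s%:E)[g] < +oo.

(* The integral defining Tk is required to converge absolutely mu-a.e. *)
Definition trace_inequality k sigma mu (p q C : R) : Prop :=
  forall f : borelRn R n -> R, f \in Lfun sigma p%:E ->
    {ae mu, forall x, sigma.-integrable [set: borelRn R n]
        (fun y => kernel0 k (euclid_dist x y) * (f y)%:E)} /\
    \int[mu]_x (`| Tk k sigma f x | `^ q) <=
      C%:E * 'N[sigma]_(p%:E)[EFin \o f] `^ q.

End Defs.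

(* Main.v *)
(* Both conditions are compared with dyadic analogues. Fix half-open dyadic
   cubes Q_i(x) of side D / 2^i, unions N_i(x) of nearby cubes of the same size,
   and radii r_i comparable with the side. Put t = p' and
     kap_i(x) = sigma(Q_i x)^-1 sum_(l >= i) k(r_l) sigma(Q_l x),
   which is comparable with kbar(r_i)(x). By LBO kap_i is almost constant on
   N_i x, and the Wolff potential, truncated at the radius r_0, is comparable with
     V(x) = sum_i k(r_i) kap_i(x)^(t-1) sigma(Q_i x) mu(N_i x)^(t-1)
   (the lower bound has Q_i x in place of N_i x inside mu). The trace inequality
   is dual to an L^q'(mu) -> L^t(sigma) bound for g |-> sum_i k(r_i) int_(N_i x) g dmu,
   and the t-th power of the L^t(sigma) norm of this function is comparable with
   the energy
     sum_i int k(r_i) kap_i(x)^(t-1) (int_(N_i x) g dmu)^t dsigma(x).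
   Testing the energy bound with g = (M h)^(1/t), where M is a maximal operator
   bounded on the spaces L^u(mu), gives int h V dmu <= C |h|_v for v conjugate to
   s = q(p-1)/(p-q), that is V in L^s(mu). Conversely the energy of g is at most
   C int V max(g, M g)^t dmu, which Hoelder's inequality with exponents s and v and
   the maximal theorem bound by a power of |g|_q'. No constant depends on D, so
   D -> oo gives the theorem by monotone convergence. *)

(* Three obstacles shape the argument. First, [mu] is not doubling, so averages over neighbourhoods
   cannot be compared with averages over cubes. The maximal function therefore divides an integral
   over [Q i x] by the mass of [N i x]: a stopping cube then pays for its whole neighbourhood, and
   the bounds depend only on the doubling constant of [sigma]. Second, monotonicity of k gives no
   decay: the sum of k(r_i) over all cubes containing x and y can be much larger than k(|x-y|). The
   trace inequality directly controls only the kernel cut down to the annuli between consecutive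
   cubes; full cubes are recovered by replacing the test function by its maximal function, which is
   bounded on L^p(sigma). Third, the t-th power of the sum over generations is expanded by the mean
   value theorem, and averaging a tail of the sum over a cube produces kap. This is direct for t <=
   2; for t > 2 part of the left-hand side is absorbed, which needs finiteness on each cube of the
   largest generation. *)
Require Import Defs.
From HB Require Import structures.
From mathcomp Require Import all_boot all_order all_algebra.
From mathcomp Require Import all_classical all_reals all_analysis.
From mathcomp Require Import measurable_realfun.
From mathcomp Require Import ssrAC ring lra zify.
Set Implicit Arguments.
Unset Strict Implicit.
Unset Printing Implicit Defensive.
Import Order.TTheory GRing.Theory Num.Theory.
Import numFieldNormedType.Exports.
Local Open Scope classical_set_scope.
Local Open Scope ring_scope.
Local Open Scope ereal_scope.

(** * Powers and integrals of extended reals *)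

Section ereal_power.
Context {R : realType}.
Implicit Types (x y a b : \bar R) (r s p q : R).

Lemma le_poweR x y r : (0 <= r)%R -> 0 <= x -> x <= y -> x `^ r <= y `^ r.
Proof.
move=> r0 x0 xy; apply: gt0_ler_poweR => //; rewrite in_itv/= ?leey ?andbT//.
exact: le_trans xy.
Qed.

Lemma poweRD_gt0 x r s : (0 < r)%R -> (0 <= s)%R ->
  x `^ (r + s) = x `^ r * x `^ s.
Proof.
move=> r0 s0; rewrite poweRD// poweRD_defE; apply/implyP => /eqP h.
by exfalso; lra.
Qed.

Lemma mule_poweRB1 x r : 0 <= x -> (1 <= r)%R -> x * x `^ (r - 1) = x `^ r.
Proof.
move=> x0 r1; rewrite -{1}(poweRe1 x0) -poweRD_gt0 ?subr_ge0//.
by congr (_ `^ _); lra.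
Qed.

Lemma poweRK x r : (r != 0)%R -> 0 <= x -> (x `^ r^-1) `^ r = x.
Proof. by move=> r0 x0; rewrite -poweRrM mulVf// poweRe1. Qed.

Lemma young_ereal a b p q : 0 <= a -> 0 <= b -> (0 < p)%R -> (0 < q)%R ->
  (p^-1 + q^-1 = 1)%R ->
  a * b <= (p^-1)%:E * a `^ p + (q^-1)%:E * b `^ q.
Proof.
move=> a0 b0 p0 q0 pq.
have pge : 0 <= (p^-1)%:E * a `^ p.
  by rewrite mule_ge0 ?poweR_ge0// lee_fin invr_ge0 ltW.
have qge : 0 <= (q^-1)%:E * b `^ q.
  by rewrite mule_ge0 ?poweR_ge0// lee_fin invr_ge0 ltW.
have ip : (0 < p^-1)%R by rewrite invr_gt0.
have iq : (0 < q^-1)%R by rewrite invr_gt0.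
case: a a0 pge => [a| |//] a0 pge; last first.
  rewrite poweRyr ?gt_eqF// gt0_muley ?lte_fin// addye ?leey//.
  by rewrite gt_eqF// (lt_le_trans _ qge).
case: b b0 qge => [b| |//] b0 qge; last first.
  rewrite [X in _ <= _ + X](_ : _ = +oo); last first.
    by rewrite poweRyr ?gt_eqF// gt0_muley ?lte_fin.
  by rewrite addey ?leey// gt_eqF// (lt_le_trans _ pge).
rewrite !poweR_EFin -!EFinM -EFinD lee_fin mulrC [X in (_ <= X + _)%R]mulrC.
by rewrite [X in (_ <= _ + X)%R]mulrC [X in (X <= _)%R]mulrC conjugate_powR.
Qed.

(** Cancelling the factor x^(1/p) leaves x^(1/q) <= B. Only a finite x can be divided out, which is
    why the uses below first truncate. *)
Lemma poweR_absorb x (B : R) p q : 0 <= x -> x < +oo -> (0 <= B)%R ->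
  (0 < p)%R -> (0 < q)%R -> (p^-1 + q^-1 = 1)%R ->
  x <= B%:E * x `^ p^-1 -> x <= (B `^ q)%:E.
Proof.
move=> x0 xoo B0 p0 q0 pq.
have ip : (0 < p^-1)%R by rewrite invr_gt0.
have iq : (0 < q^-1)%R by rewrite invr_gt0.
case: x x0 xoo => [x| |//] x0 xoo; last by [].
rewrite poweR_EFin -EFinM !lee_fin => h.
have [->|xn0] := eqVneq x 0%R; first exact: powR_ge0.
have xgt0 : (0 < x)%R by rewrite lt_neqAle eq_sym xn0 -lee_fin.
have xE : (x = x `^ q^-1 * x `^ p^-1)%R.
  by rewrite -powRD ?xn0 ?implybT// addrC pq powRr1 ?ltW.
move: h; rewrite {1}xE ler_pM2r ?powR_gt0// => h.
have -> : (x = (x `^ q^-1) `^ q)%R by rewrite -powRrM mulVf ?gt_eqF// powRr1 ?ltW.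
by apply: ge0_ler_powR; rewrite ?nnegrE ?powR_ge0//; exact: ltW.
Qed.

End ereal_power.

(** * Discrete mean value inequalities for powers of sums *)

Section power_sums.
Context {R : realType}.
Implicit Types (x y a b : \bar R) (r s p q : R).

(* The mean value theorem for the power, read off Young's inequality for [y * (y + a)^(s-1)]. *)
Lemma poweRD_le y a s : 0 <= y -> 0 <= a -> (1 <= s)%R ->
  (y + a) `^ s <= y `^ s + s%:E * (a * (y + a) `^ (s - 1)).
Proof.
move=> y0 a0 s1; have s0 : (0 < s)%R by lra.
have [->|/eqP sneq] := eqVneq s 1%R.
  by rewrite subrr poweRe0 mule1 mul1e !poweRe1// adde_ge0.
have s1' : (1 < s)%R by lra.
case: y y0 => [y| |//] y0; last first.
  rewrite [(+oo `^ s)%E]poweRyr ?gt_eqF//.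
  rewrite [leRHS]addye ?leey// gt_eqF// (@lt_le_trans _ _ 0)//.
  by rewrite !mule_ge0 ?poweR_ge0// lee_fin ltW.
case: a a0 => [a| |//] a0; last first.
  rewrite addey// [X in _ <= _ + _ * (_ * X)]poweRyr; last by apply/eqP; lra.
  rewrite mulyy gt0_muley ?lte_fin// addey ?leey//.
move: y0 a0; rewrite !lee_fin => y0 a0.
set z := (y + a)%R; have z0 : (0 <= z)%R by rewrite addr_ge0.
have zs : (z `^ s = z * z `^ (s - 1))%R by rewrite mulr_powRB1.
have iq : ((s / (s - 1))^-1 = (s - 1) / s)%R by rewrite invf_div.
have := @conjugate_powR R y (z `^ (s - 1))%R s (s / (s - 1))%R y0 (powR_ge0 _ _) s0.
rewrite divr_gt0//; last lra.
have -> : (s^-1 + (s / (s - 1))^-1 = 1)%R.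
  by rewrite iq; field; lra.
move=> /(_ isT erefl).
rewrite -powRrM mulrCA divff ?mulr1; last by rewrite subr_eq0; apply/eqP.
rewrite iq zs => h.
have ys : (0 <= y `^ s)%R by exact: powR_ge0.
have h2 : (s * (y * z `^ (s - 1)) <= y `^ s + (s - 1) * (z * z `^ (s - 1)))%R.
  have := ler_wpM2l (ltW s0) h.
  have -> : (s * (y `^ s / s + z * z `^ (s - 1) * ((s - 1) / s)) =
    y `^ s + (s - 1) * (z * z `^ (s - 1)))%R by field; lra.
  by [].
have yE : y = (z - a)%R by rewrite /z addrK.
move: h2; rewrite {1}yE.
move: (z `^ (s - 1))%R (y `^ s)%R => u v; lra.
Qed.

(** The increments of the s-th powers of the partial sums telescope, and each one is bounded by
    [poweRD_le]. *)
Lemma sum_poweR_le_prefix (a : nat -> \bar R) s M : (forall i, 0 <= a i) ->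
  (1 <= s)%R ->
  (\sum_(i < M) a i) `^ s <=
  s%:E * \sum_(i < M) (a i * (\sum_(l < i.+1) a l) `^ (s - 1)).
Proof.
move=> a0 s1; have s0 : (0 < s)%R by lra.
elim: M => [|M IH]; first by rewrite !big_ord0 poweR0r ?gt_eqF// mule0.
rewrite big_ord_recr/= [X in _ <= _ * X]big_ord_recr/=.
rewrite ge0_muleDr; first last.
- by rewrite mule_ge0 ?poweR_ge0.
- by apply: sume_ge0 => i _; rewrite mule_ge0 ?poweR_ge0.
apply: (le_trans (poweRD_le _ _ s1)) => //; first exact: sume_ge0.
by rewrite leeD// big_ord_recr.
Qed.

(** The same telescoping, read from the other end. Tails are what can be averaged over a cube of
    generation [i], since the earlier terms are constant there. *)
Lemma sum_poweR_le_suffix (a : nat -> \bar R) s M : (forall i, 0 <= a i) ->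
  (1 <= s)%R ->
  (\sum_(i < M) a i) `^ s <=
  s%:E * \sum_(i < M) (a i * (\sum_(i <= l < M) a l) `^ (s - 1)).
Proof.
move=> a0 s1.
rewrite -(big_mkord xpredT a).
rewrite -(big_mkord xpredT (fun i => a i * (\sum_(i <= l < M) a l) `^ (s - 1))).
(* Induction on the number [m] of last terms, so that each step adds a term in front. *)
have gen m : (\sum_(M - m <= i < M) a i) `^ s <=
  s%:E * \sum_(M - m <= i < M) (a i * (\sum_(i <= l < M) a l) `^ (s - 1)).
  elim: m => [|m IH].
    by rewrite subn0 !big_geq// poweR0r ?mule0// gt_eqF//; lra.
  have [mM|mM] := leqP M m.
    have -> : (M - m.+1 = M - m)%N by lia.
    exact: IH.
  have e : ((M - m.+1).+1 = M - m)%N by lia.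
  have lt : (M - m.+1 < M)%N by lia.
  rewrite [X in X `^ s]big_ltn// [X in _ <= _ * X]big_ltn// e.
  rewrite ge0_muleDr; first last.
  - by apply: sume_ge0 => i _; rewrite mule_ge0 ?poweR_ge0.
  - by rewrite mule_ge0 ?poweR_ge0.
  rewrite addeC [leRHS]addeC; apply: (le_trans (poweRD_le _ _ s1)) => //.
    exact: sume_ge0.
  rewrite leeD// [X in _ <= _ * (_ * X `^ _)]big_ltn// e.
  by rewrite addeC.
by have := gen M; rewrite subnn.
Qed.

End power_sums.

(** * Hoelder's inequality, its converse, and passage to suprema *)

Section integration.
Context d (X : measurableType d) (R : realType).
Variable nu : {measure set X -> \bar R}.
Implicit Types (f g : X -> \bar R).

(** Read off from the integral as a supremum over simple functions below the integrand, so that no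
    use carries a measurability obligation. *)
Lemma ge0_le_int (A B : set X) f g : A `<=` B ->
  (forall x, 0 <= f x) -> (forall x, 0 <= g x) ->
  (forall x, A x -> f x <= g x) ->
  \int[nu]_(x in A) f x <= \int[nu]_(x in B) g x.
Proof.
move=> AB f0 g0 fg; rewrite !ge0_integralE//.
apply: ge_ereal_sup => _ [h hf <-]; apply: ereal_sup_ubound; exists h => //= x.
apply: (le_trans (hf x)); rewrite /patch; case: ifPn => [xA|_].
  by rewrite mem_set; [apply/fg/set_mem|apply/AB/set_mem].
by case: ifPn.
Qed.

Lemma le_int f g : (forall x, 0 <= f x) -> (forall x, f x <= g x) ->
  \int[nu]_x f x <= \int[nu]_x g x.
Proof. by move=> f0 fg; apply: ge0_le_int => // x; exact: le_trans (fg x). Qed.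

Lemma int_set_le (A B : set X) f : A `<=` B -> (forall x, 0 <= f x) ->
  \int[nu]_(x in A) f x <= \int[nu]_(x in B) f x.
Proof. by move=> AB f0; exact: ge0_le_int. Qed.

Lemma integral_eq0_mul f g : measurable_fun setT f -> (forall x, 0 <= f x) ->
  measurable_fun setT g -> (forall x, 0 <= g x) ->
  \int[nu]_x f x = 0 -> \int[nu]_x (f x * g x) = 0.
Proof.
move=> mf f0 mg g0 If.
have mfg : measurable_fun setT (fun x => f x * g x) by exact: emeasurable_funM.
have ae0 : ae_eq nu setT f (cst 0).
  apply/(ae_eq_integral_abs _ measurableT mf).
  by under eq_integral do rewrite gee0_abs//.
have : ae_eq nu setT (fun x => f x * g x) (cst 0).
  by apply: filterS ae0 => x /= /(_ I) ->; rewrite mul0e.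
move/(ae_eq_integral_abs _ measurableT mfg) => <-.
by apply: eq_integral => x _; rewrite gee0_abs// mule_ge0.
Qed.

(** Young's inequality is applied pointwise to [f] and [g] divided by their norms [a] and [b]. A
    zero norm makes the product vanish almost everywhere ([rootK]), and an infinite norm next to a
    nonzero one makes the bound trivial. *)
Lemma hoelder_ereal f g p q : measurable_fun setT f -> measurable_fun setT g ->
  (forall x, 0 <= f x) -> (forall x, 0 <= g x) ->
  (0 < p)%R -> (0 < q)%R -> (p^-1 + q^-1 = 1)%R ->
  \int[nu]_x (f x * g x) <=
  (\int[nu]_x f x `^ p) `^ p^-1 * (\int[nu]_x g x `^ q) `^ q^-1.
Proof.
move=> mf mg f0 g0 p0 q0 pq.
have ip : (0 < p^-1)%R by rewrite invr_gt0.
have iq : (0 < q^-1)%R by rewrite invr_gt0.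
have mfp : measurable_fun setT (fun x => f x `^ p).
  exact: (measurableT_comp (measurable_poweR _)).
have mgq : measurable_fun setT (fun x => g x `^ q).
  exact: (measurableT_comp (measurable_poweR _)).
have rootK h r : (0 < r)%R -> (forall x, 0 <= h x) ->
    measurable_fun setT h -> \int[nu]_x h x `^ r = 0 ->
    forall k, measurable_fun setT k -> (forall x, 0 <= k x) ->
    \int[nu]_x (h x * k x) = 0.
  move=> r0 h0 mh Ih k mk k0.
  have mhr : measurable_fun setT (fun x => h x `^ r).
    exact: (measurableT_comp (measurable_poweR _)).
  have hr0 x : 0 <= h x `^ r by exact: poweR_ge0.
  have mhk : measurable_fun setT (fun x => h x * k x) by exact: emeasurable_funM.
  have ae0 : ae_eq nu setT (fun x => h x `^ r) (cst 0).
    apply/(ae_eq_integral_abs _ measurableT mhr).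
    by under eq_integral do rewrite gee0_abs//.
  have : ae_eq nu setT (fun x => h x * k x) (cst 0).
    apply: filterS ae0 => x /= /(_ I) /poweR_eq0_eq0 => /(_ (h0 x)) ->.
    by rewrite mul0e.
  move/(ae_eq_integral_abs _ measurableT mhk) => <-.
  by apply: eq_integral => x _; rewrite gee0_abs// mule_ge0.
set U := \int[nu]_x f x `^ p; set V := \int[nu]_x g x `^ q.
have U0 : 0 <= U by apply: integral_ge0 => x _; exact: poweR_ge0.
have V0 : 0 <= V by apply: integral_ge0 => x _; exact: poweR_ge0.
have [Uz|Un] := eqVneq U 0; first by rewrite (rootK f p) ?mule_ge0 ?poweR_ge0.
have [Vz|Vn] := eqVneq V 0.
  under eq_integral do rewrite muleC.
  by rewrite (rootK g q) ?mule_ge0 ?poweR_ge0.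
have Ugt : 0 < U by rewrite lt_neqAle eq_sym Un.
have Vgt : 0 < V by rewrite lt_neqAle eq_sym Vn.
have [Uy|Uy] := eqVneq U +oo.
  by rewrite Uy poweRyr ?gt_eqF// gt0_mulye ?leey// poweR_gt0.
have [Vy|Vy] := eqVneq V +oo.
  by rewrite Vy poweRyr ?gt_eqF// gt0_muley ?leey// poweR_gt0.
have Ufin : U \is a fin_num by rewrite ge0_fin_numE// lt_neqAle Uy leey.
have Vfin : V \is a fin_num by rewrite ge0_fin_numE// lt_neqAle Vy leey.
have [u uE] : exists u, U = u%:E by exists (fine U); rewrite fineK.
have [v vE] : exists v, V = v%:E by exists (fine V); rewrite fineK.
move: Ugt Vgt; rewrite uE vE !lte_fin => u0 v0.
have [a a0 aE] : exists2 a : R, (0 < a)%R & (a `^ p = u)%R.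
  exists (u `^ p^-1)%R; first by rewrite powR_gt0.
  by rewrite -powRrM mulVf ?gt_eqF// powRr1// ltW.
have [b b0 bE] : exists2 b : R, (0 < b)%R & (b `^ q = v)%R.
  exists (v `^ q^-1)%R; first by rewrite powR_gt0.
  by rewrite -powRrM mulVf ?gt_eqF// powRr1// ltW.
have -> : u%:E `^ p^-1 = a%:E.
  by rewrite -aE poweR_EFin -powRrM mulfV ?gt_eqF// powRr1// ltW.
have -> : v%:E `^ q^-1 = b%:E.
  by rewrite -bE poweR_EFin -powRrM mulfV ?gt_eqF// powRr1// ltW.
have key x : f x * g x <= (a * b)%:E *
   ((p^-1 * u^-1)%:E * f x `^ p + (q^-1 * v^-1)%:E * g x `^ q).
  have e : f x * g x = (a * b)%:E * ((a^-1)%:E * f x * ((b^-1)%:E * g x)).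
    rewrite EFinM muleACA !muleA -!EFinM mulfV ?gt_eqF// mul1e -!muleA.
    by rewrite (muleA b%:E) -EFinM mulfV ?gt_eqF// mul1e.
  rewrite e; apply: lee_wpmul2l; first by rewrite lee_fin ltW// mulr_gt0.
  have ai : 0 <= (a^-1)%:E by rewrite lee_fin invr_ge0 ltW.
  have bi : 0 <= (b^-1)%:E by rewrite lee_fin invr_ge0 ltW.
  apply: (le_trans (young_ereal _ _ p0 q0 pq)); rewrite ?mule_ge0//.
  rewrite !poweRM// !poweR_EFin !muleA -!EFinM.
  rewrite -aE -bE.
  have -> : (a^-1 `^ p = (a `^ p)^-1)%R.
    by rewrite -[a^-1%R]powR_inv1 ?ltW// powRAC powR_inv1 ?powR_ge0.
  have -> : (b^-1 `^ q = (b `^ q)^-1)%R.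
    by rewrite -[b^-1%R]powR_inv1 ?ltW// powRAC powR_inv1 ?powR_ge0.
  by [].
apply: (le_trans (le_int _ key)); first by move=> x; rewrite mule_ge0.
have ab0 : 0 <= (a * b)%:E by rewrite lee_fin ltW// mulr_gt0.
have pu0 : 0 <= (p^-1 * u^-1)%:E by rewrite lee_fin ltW// mulr_gt0// invr_gt0.
have qv0 : 0 <= (q^-1 * v^-1)%:E by rewrite lee_fin ltW// mulr_gt0// invr_gt0.
rewrite ge0_integralZl//=; last first.
- by move=> x _; rewrite adde_ge0// mule_ge0// poweR_ge0.
- by apply: emeasurable_funD; apply: emeasurable_funM.
rewrite ge0_integralD//=; last first.
- exact: emeasurable_funM.
- by move=> x _; rewrite mule_ge0// poweR_ge0.
- exact: emeasurable_funM.
- by move=> x _; rewrite mule_ge0// poweR_ge0.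
rewrite !ge0_integralZl//=; last first.
- by move=> x _; rewrite poweR_ge0.
- by move=> x _; rewrite poweR_ge0.
rewrite -/U -/V uE vE -!EFinM lee_fin.
by rewrite -!mulrA !mulVf ?gt_eqF// !mulr1 pq mulr1.
Qed.

Lemma le_sup_approx (u : nat -> \bar R) (y : \bar R) : (forall m, 0 <= u m) ->
  (forall r : R, r%:E < y -> exists m, r%:E <= u m) ->
  y <= ereal_sup (range u).
Proof.
move=> u0 h; rewrite leNgt; apply/negP => lt.
have ub m : u m <= ereal_sup (range u) by apply: ereal_sup_ubound; exists m.
have s0 : 0 <= ereal_sup (range u) by exact: le_trans (ub 0%N).
move: lt s0 ub; case: (ereal_sup _) => [s| |//] lt s0 ub; last first.
  by rewrite ltNge leey in lt.
have [r sr ry] : exists2 r : R, (s < r)%R & r%:E < y.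
  case: y h lt => [y| |//] h lt; last by exists (s + 1)%R; [rewrite ltrDl|rewrite ltry].
  rewrite lte_fin in lt; exists ((s + y) / 2)%R; first by lra.
  by rewrite lte_fin; lra.
have [m] := h r ry; rewrite leNgt => /negP; apply.
by apply: le_lt_trans (ub m) _; rewrite lte_fin.
Qed.

(** Continuity of the power along a supremum: the hypothesis on [c] says that [v] is at most the
    supremum of the [u J]. This is how truncations are removed inside a power. *)
Lemma poweR_le_sup (u : nat -> \bar R) (v : \bar R) (r : R) : (0 < r)%R ->
  (forall J, 0 <= u J) -> 0 <= v ->
  (forall c : \bar R, (forall J, u J <= c) -> v <= c) ->
  v `^ r <= ereal_sup (range (fun J => u J `^ r)).
Proof.
move=> r0 u0 v0 H; apply: le_sup_approx => [J|c hc]; first exact: poweR_ge0.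
apply: contrapT => nex.
have c0 : (0 <= c)%R.
  rewrite leNgt; apply/negP => clt; apply: nex; exists 0%N.
  by apply: (@le_trans _ _ 0); rewrite ?poweR_ge0// lee_fin ltW.
have cr : (c%:E : \bar R) = (c `^ r^-1)%:E `^ r.
  by rewrite -poweR_EFin poweRK ?gt_eqF.
have le_c J : u J <= (c `^ r^-1)%:E.
  rewrite leNgt; apply/negP => lt; apply: nex; exists J; rewrite cr.
  by apply: le_poweR; rewrite ?lee_fin ?powR_ge0 ?(ltW r0)// ltW.
move: hc; rewrite ltNge => /negP; apply; rewrite cr.
by apply: le_poweR; [exact: ltW|exact: v0|exact: H].
Qed.

Lemma integral_le_sup (g_ : nat -> X -> \bar R) f (C : \bar R) :
  (forall m, measurable_fun setT (g_ m)) ->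
  (forall m x, 0 <= g_ m x) -> (forall x, 0 <= f x) ->
  (forall x m n, (m <= n)%N -> g_ m x <= g_ n x) ->
  (forall x, f x <= ereal_sup (range (g_ ^~ x))) ->
  (forall m, \int[nu]_x g_ m x <= C) ->
  \int[nu]_x f x <= C.
Proof.
move=> mg g0 f0 ndg apx bnd.
have lE x : limn (g_ ^~ x) = ereal_sup (range (g_ ^~ x)).
  by apply/cvg_lim => //; apply: ereal_nondecreasing_cvgn => m n; exact: ndg.
apply: (@le_trans _ _ (\int[nu]_x limn (g_ ^~ x))).
  by apply: le_int => // x; rewrite lE.
rewrite monotone_convergence//; last by move=> x _ m n; exact: ndg.
have nd : nondecreasing_seq (fun m => \int[nu]_x g_ m x).
  by move=> m n mn; apply: le_int => // x; exact: ndg.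
rewrite (cvg_lim _ (ereal_nondecreasing_cvgn nd))//.
by apply: ge_ereal_sup => _ [m _ <-].
Qed.

(* The test functions are bounded powers of [L], truncated to sets of finite measure. *)
Lemma Lp_converse_hoelder (L : X -> \bar R) (B p t : R) :
  sigma_finite setT nu ->
  (0 < p)%R -> (1 < t)%R -> (p^-1 + t^-1 = 1)%R -> (0 <= B)%R ->
  measurable_fun setT L -> (forall x, 0 <= L x) ->
  (forall f : X -> R, measurable_fun setT f -> (forall x, (0 <= f x)%R) ->
    (exists M, forall x, (f x <= M)%R) ->
    \int[nu]_x ((f x)%:E `^ p) < +oo ->
    \int[nu]_x ((f x)%:E * L x) <=
      B%:E * (\int[nu]_x ((f x)%:E `^ p)) `^ p^-1) ->
  \int[nu]_x L x `^ t <= (B `^ t)%:E.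
Proof.
move=> /sigma_finiteP[F [FT ndF mF]] p0 t1 pt B0 mL L0 H.
have t0 : (0 < t)%R by lra.
have tp : ((t - 1) * p = t)%R.
  have pE : (p^-1 = (t - 1) / t)%R.
    by rewrite mulrBl divff ?gt_eqF// mul1r; lra.
  have t1n : (t - 1 != 0)%R by rewrite subr_eq0 gt_eqF.
  by rewrite -(invrK p) pE invf_div mulrCA divff// mulr1.
have min0 m x : 0 <= mine (L x) m%:R%:E by rewrite le_min L0 lee_fin ler0n.
(* Cut off in height and in space, so that its t-th power has finite integral. *)
pose phi m x := (fine (mine (L x) m%:R%:E) * \1_(F m) x)%R.
have minE m x : (fine (mine (L x) m%:R%:E))%:E = mine (L x) m%:R%:E.
  rewrite fineK// ge0_fin_numE; last exact: min0.
  by rewrite gt_min ltry orbT.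
have phiE m x : (phi m x)%:E = mine (L x) m%:R%:E * (\1_(F m) x)%:E.
  by rewrite /phi EFinM minE.
have phi0 m x : (0 <= phi m x)%R.
  by rewrite mulr_ge0// -lee_fin minE min0.
have phile m x : (phi m x <= m%:R)%R.
  rewrite -lee_fin phiE; apply: (@le_trans _ _ (mine (L x) m%:R%:E * 1)).
    apply: lee_wpmul2l; first exact: min0.
    by rewrite lee_fin indicE; case: (_ \in _).
  by rewrite mule1 ge_min lexx orbT.
have phiL m x : (phi m x)%:E <= L x.
  rewrite phiE; apply: (@le_trans _ _ (mine (L x) m%:R%:E * 1)).
    apply: lee_wpmul2l; first exact: min0.
    by rewrite lee_fin indicE; case: (_ \in _).
  by rewrite mule1 ge_min lexx.
have mphiE m : measurable_fun setT (fun x => (phi m x)%:E).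
  apply: (eq_measurable_fun (fun x => mine (L x) m%:R%:E * (\1_(F m) x)%:E)).
    by move=> x _; rewrite phiE.
  apply: emeasurable_funM; first exact: measurable_mine.
  apply/measurable_EFinP; exact: measurable_indic (mF m).1.
have mphi m : measurable_fun setT (phi m).
  by apply/measurable_EFinP; exact: mphiE.
have mphit m : measurable_fun setT (fun x => (phi m x)%:E `^ t).
  exact: (measurableT_comp (measurable_poweR _)).
have bndE m : \int[nu]_x (phi m x)%:E `^ t <= (B `^ t)%:E.
  set E := \int[nu]_x _.
  have E0 : 0 <= E by apply: integral_ge0 => x _; exact: poweR_ge0.
  have Efin : E < +oo.
    have /= [mFm fFm] := mF m.
    apply: (@le_lt_trans _ _ (\int[nu]_x ((m%:R `^ t)%:E * (\1_(F m) x)%:E))).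
      apply: le_int => [x|x]; first exact: poweR_ge0.
      have [xF|xF] := boolP (x \in F m).
        rewrite indicE xF mule1 poweR_EFin lee_fin.
        by apply: ge0_ler_powR; rewrite ?nnegrE ?ler0n//; lra.
      by rewrite /phi indicE (negbTE xF) mulr0 mule0 poweR0r// gt_eqF.
    rewrite ge0_integralZl//=; last first.
      by apply/measurable_EFinP; exact: measurable_indic.
    by rewrite integral_indic// setIT lte_mul_pinfty// lee_fin powR_ge0.
  (* The extremal of Hoelder's inequality: since (t - 1) p = t, the hypothesis becomes E <= B
     E^(1/p), and E is finite. *)
  pose f x := (phi m x `^ (t - 1))%R.
  have fpE x : (f x)%:E `^ p = (phi m x)%:E `^ t.
    by rewrite /f !poweR_EFin -powRrM tp.
  apply: (poweR_absorb E0 Efin B0 p0 t0 pt).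
  apply: (@le_trans _ _ (\int[nu]_x ((f x)%:E * L x))).
    apply: le_int => x; first exact: poweR_ge0.
    rewrite -mule_poweRB1 ?lee_fin//; last exact: ltW.
    by rewrite muleC /f poweR_EFin lee_wpmul2l// lee_fin powR_ge0.
  have -> : E = \int[nu]_x ((f x)%:E `^ p).
    by apply: eq_integral => x _; rewrite fpE.
  apply: H.
  - exact: (measurableT_comp (measurable_powR _)).
  - by move=> x; exact: powR_ge0.
  - exists (m%:R `^ (t - 1))%R => x.
    by apply: ge0_ler_powR; rewrite ?nnegrE ?ler0n//; lra.
  - by under eq_integral do rewrite fpE.
apply: (@integral_le_sup (fun m x => (phi m x)%:E `^ t)) => //.
- by move=> m x; exact: poweR_ge0.
- by move=> x; exact: poweR_ge0.
- move=> x m n mn; apply: le_poweR; rewrite ?lee_fin//; first exact: ltW.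
  rewrite -lee_fin !phiE; apply: lee_pmul.
  + exact: min0.
  + by rewrite lee_fin.
  + by rewrite le_min !ge_min lexx/= lee_fin ler_nat mn orbT.
  + rewrite lee_fin !indicE; case: (boolP (x \in F m)) => // xF.
    have /subsetPset /(_ x (set_mem xF)) xFn := ndF _ _ mn.
    by rewrite mem_set.
- move=> x; apply: le_sup_approx => [m|r rL]; first exact: poweR_ge0.
  have [n0 xn0] : exists n, F n x.
    by have : setT x by []; rewrite FT => -[n _ Fn]; exists n.
  have inF n : (n0 <= n)%N -> x \in F n.
    by move=> nn; apply: mem_set; have /subsetPset := ndF _ _ nn; apply.
  case LE : (L x) (L0 x) => [l| |//] l0.
    have [n1 n1l] : exists n, (l <= n%:R)%R.
      by exists (Num.truncn l).+1; apply/ltW; exact: truncnS_gt.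
    exists (maxn n0 n1); rewrite /phi indicE inF ?leq_maxl// mulr1 LE.
    rewrite min_l ?lee_fin; first by rewrite LE in rL; exact: ltW.
    by apply: (le_trans n1l); rewrite ler_nat leq_maxr.
  have [n1 n1r] : exists n, (`|r| `^ t^-1 <= n%:R)%R.
    by exists (Num.truncn (`|r| `^ t^-1)%R).+1; apply/ltW; exact: truncnS_gt.
  exists (maxn n0 n1); rewrite /phi indicE inF ?leq_maxl// mulr1 LE.
  rewrite min_r ?leey//= lee_fin.
  apply: (le_trans (ler_norm r)).
  have -> : (`|r| = (`|r| `^ t^-1) `^ t)%R by rewrite -powRrM mulVf ?gt_eqF// powRr1.
  apply: ge0_ler_powR; rewrite ?nnegrE ?powR_ge0 ?ler0n//; first exact: ltW.
  by apply: (le_trans n1r); rewrite ler_nat leq_maxr.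
Qed.

End integration.

(** * Interpolation and exchange of integrals *)

Section marcinkiewicz.
Context d (X : measurableType d) (R : realType).
Variable nu : {measure set X -> \bar R}.

Lemma measurable_gt (f : X -> \bar R) (a : \bar R) : measurable_fun setT f ->
  measurable [set x | a < f x].
Proof. by move=> mf; rewrite -[X in measurable X]setTI; exact: emeasurable_fun_o_infty. Qed.

Lemma measurable_EFin_indic (A : set X) : measurable A ->
  measurable_fun setT (fun x => (\1_A x)%:E : \bar R).
Proof. by move=> mA; apply/measurable_EFinP; exact: measurable_indic. Qed.

Lemma indicE_set (P : X -> Prop) (x : X) : P x -> (\1_[set y | P y] x)%:E = 1 :> \bar R.
Proof. by move=> Px; rewrite indicE mem_set. Qed.

Lemma indicE_setN (P : X -> Prop) (x : X) : ~ P x ->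
  (\1_[set y | P y] x)%:E = 0 :> \bar R.
Proof. by move=> Px; rewrite indicE memNset. Qed.

Lemma powR2_gt1 (r : R) : (0 < r)%R -> (1 < 2 `^ r)%R.
Proof.
move=> r0; rewrite -[ltLHS](_ : 1 `^ r = 1)%R; last by rewrite powR1.
by apply: gt0_ltr_powR; rewrite ?nnegrE//; lra.
Qed.

(** The factor (2c)^u comes from replacing a value by the next dyadic level, and the quotient is the
    sum of the geometric series of ratio 2^(1-u). *)
Definition strong_cst (c u : R) : R :=
  ((2 * c) `^ u * (2 `^ (u - 1) / (2 `^ (u - 1) - 1)))%R.

Lemma strong_cst_ge0 c u : (1 < u)%R -> (0 <= strong_cst c u)%R.
Proof.
move=> u1; have r1 : (1 < 2 `^ (u - 1) :> R)%R by rewrite powR2_gt1// subr_gt0.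
by rewrite mulr_ge0 ?powR_ge0// divr_ge0 ?powR_ge0//; lra.
Qed.

(** The levels below [y] form a geometric progression, hence their sum is controlled by the last
    one. *)
Lemma geometric_below (l : nat -> R) (u : R) (y : \bar R) n : (1 < u)%R ->
  (forall i, (0 < l i)%R) -> (forall i, l i.+1 = 2 * l i)%R ->
  \sum_(i < n) ((l i `^ (u - 1))%:E * (if (l i)%:E < y then 1 else 0)) <=
  (2 `^ (u - 1) / (2 `^ (u - 1) - 1))%:E * y `^ (u - 1).
Proof.
move=> u1 l0 lS; set r := (2 `^ (u - 1))%R.
have r1 : (1 < r)%R by rewrite powR2_gt1// subr_gt0.
have c0 : (0 <= r / (r - 1))%R by rewrite divr_ge0//; lra.
have lpS i : (l i.+1 `^ (u - 1) = r * l i `^ (u - 1))%R.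
  by rewrite lS powRM// ltW.
have tot m : (\sum_(i < m) l i `^ (u - 1) <= l m `^ (u - 1) / (r - 1))%R.
  elim: m => [|m IH]; first by rewrite big_ord0 divr_ge0 ?powR_ge0//; lra.
  rewrite big_ord_recr/= lpS; apply: (le_trans (lerD IH (lexx _))).
  rewrite le_eqVlt; apply/orP; left; apply/eqP; field; lra.
elim: n => [|n IH]; first by rewrite big_ord0 mule_ge0 ?lee_fin ?poweR_ge0.
have [ly|ly] := boolP ((l n)%:E < y); last first.
  by rewrite big_ord_recr/= (negbTE ly) mule0 adde0.
apply: (@le_trans _ _ (\sum_(i < n.+1) (l i `^ (u - 1))%:E)).
  apply: lee_sum => i _; rewrite -[leRHS]mule1 lee_wpmul2l ?lee_fin ?powR_ge0//.
  by case: ifP.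
rewrite sumEFin; apply: (@le_trans _ _ (l n.+1 `^ (u - 1) / (r - 1))%:E).
  by rewrite lee_fin tot.
rewrite lpS mulrAC EFinM; apply: lee_wpmul2l; first by rewrite lee_fin.
by rewrite -poweR_EFin le_poweR ?lee_fin ?(ltW (l0 _)) ?(ltW ly)//; lra.
Qed.

(** A discrete layer-cake formula. A real number between two consecutive levels is already paid for
    by the term of the lower level; for infinite [y] this holds for arbitrarily large reals. *)
Lemma dyadic_layers (l : nat -> R) (u c : R) (y : \bar R) : (1 < u)%R -> (0 < c)%R ->
  (forall i, (0 < l i)%R) -> (forall i, l i.+1 = 2 * l i)%R ->
  (c * l 0%N)%:E < y ->
  y `^ u <= \sum_(i <oo) ((c * l i.+1) `^ u)%:E * (if (c * l i)%:E < y then 1 else 0).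
Proof.
move=> u1 c0 l0 lS hy.
set S := \sum_(i <oo) _.
have term0 i : 0 <= ((c * l i.+1) `^ u)%:E * (if (c * l i)%:E < y then 1 else 0 : \bar R).
  by rewrite mule_ge0 ?lee_fin ?powR_ge0//; case: ifP.
have lE i : l i = (l 0%N * 2 ^+ i)%R.
  elim: i => [|i IH]; first by rewrite expr0 mulr1.
  by rewrite lS IH exprS; ring.
have key (r : R) : (c * l 0%N < r)%R -> r%:E <= y -> (r `^ u)%:E <= S.
  move=> hr ry.
  have ex : exists m, (r <= c * l m)%R.
    exists (Num.truncn (r / (c * l 0%N))%R).+1.
    have cl0 : (0 < c * l 0%N)%R by rewrite mulr_gt0.
    rewrite lE mulrA -ler_pdivrMl// mulrC.
    apply: (le_trans (ltW (truncnS_gt _))).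
    by rewrite -natrX ler_nat ltnW// ltn_expl.
  case: (ex_minnP ex) => [] [|m] hm mmin; first by exfalso; lra.
  have hm' : (c * l m < r)%R.
    by rewrite ltNge; apply/negP => /mmin; rewrite ltnn.
  apply: (@le_trans _ _ (((c * l m.+1) `^ u)%:E * (if (c * l m)%:E < y then 1 else 0))).
    rewrite (lt_le_trans _ ry) ?lte_fin// mule1 lee_fin ge0_ler_powR ?nnegrE//; last first.
    - by rewrite mulr_ge0// ltW.
    - by apply: ltW; apply: lt_trans hr; rewrite mulr_gt0.
    - lra.
  have := @nneseries_lim_ge _ _ xpredT 0%N m.+1 (fun n _ _ => term0 n).
  apply: le_trans; rewrite big_mkord big_ord_recr/=.
  by rewrite leeDr// sume_ge0.
case: y hy @S term0 key => [y| |//] hy S term0 key.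
  by rewrite poweR_EFin key// -lte_fin.
suff -> : S = +oo by exact: leey.
apply/eqP; rewrite -leye_eq; rewrite leNgt; apply/negP => Slt.
have S0 : 0 <= S by apply: nneseries_ge0 => n _ _; exact: term0.
have Sfin : S \is a fin_num by rewrite ge0_fin_numE.
(* Chosen above the first level and with r^u at least S + 1, which contradicts r^u <= S. *)
pose r := (1 + c * l 0%N + (fine S + 1) `^ u^-1)%R.
have f0 : (0 <= fine S)%R by rewrite fine_ge0.
have := key r; rewrite leey => /(_ _ isT) h.
have {h} : (r `^ u)%:E <= S.
  by apply: h; rewrite /r; have := powR_ge0 (fine S + 1) u^-1; lra.
rewrite -(fineK Sfin) lee_fin leNgt => /negP; apply.
apply: (@lt_le_trans _ _ (fine S + 1)%R); first by rewrite ltrDl.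
have -> : (fine S + 1 = ((fine S + 1) `^ u^-1) `^ u)%R.
  by rewrite -powRrM mulVf ?powRr1//; [rewrite addr_ge0|rewrite gt_eqF//; lra].
have cl0 : (0 < c * l 0%N)%R by rewrite mulr_gt0.
have p0 := powR_ge0 (fine S + 1) u^-1.
apply: ge0_ler_powR; rewrite ?nnegrE//; rewrite ?/r; lra.
Qed.

(** Marcinkiewicz interpolation with the endpoint at infinity built into the hypothesis, whose
    right-hand side only sees the part of [h] above the level. The levels run over 2^-m, 2^(1-m),
    ..., and m tends to infinity at the end. *)
Lemma strong_of_weak (S h : X -> \bar R) (c u : R) : (1 < u)%R -> (0 < c)%R ->
  measurable_fun setT S -> (forall x, 0 <= S x) ->
  measurable_fun setT h -> (forall x, 0 <= h x) ->
  (forall l : R, (0 < l)%R ->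
    l%:E * nu [set x | (c * l)%:E < S x] <=
    \int[nu]_x (h x * (\1_[set x | (l%:E < h x)%E] x)%:E)) ->
  \int[nu]_x S x `^ u <= (strong_cst c u)%:E * \int[nu]_x h x `^ u.
Proof.
move=> u1 c0 mS S0 mh h0 weak.
have u0 : (0 < u)%R by lra.
have mSu : measurable_fun setT (fun x => S x `^ u).
  exact: (measurableT_comp (measurable_poweR _)).
have ind0 (A : set X) x : 0 <= (\1_A x)%:E :> \bar R by rewrite lee_fin.
pose l0 m : R := (2 ^- m)%R.
have l0_gt0 m : (0 < l0 m)%R by rewrite invr_gt0 exprn_gt0.
apply: (@integral_le_sup _ _ _ nu (fun m x =>
   S x `^ u * (\1_[set x | ((c * l0 m)%:E < S x)%E] x)%:E)).
- move=> m; apply: emeasurable_funM => //.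
  exact/measurable_EFin_indic/measurable_gt.
- by move=> m x; rewrite mule_ge0 ?poweR_ge0.
- by move=> x; exact: poweR_ge0.
- move=> x m n mn; rewrite lee_wpmul2l ?poweR_ge0// lee_fin !indicE.
  have [xm|//] := boolP (x \in [set x | (c * l0 m)%:E < S x]).
  rewrite mem_set//=; move/set_mem: xm => /=; apply: le_lt_trans.
  rewrite lee_fin ler_wpM2l ?(ltW c0)// lef_pV2 ?posrE ?exprn_gt0//.
  by rewrite ler_weXn2l// ler1n.
- move=> x; apply: le_sup_approx => [m|r rS].
    by rewrite mule_ge0 ?poweR_ge0.
  have [Sx0|Sxn0] := eqVneq (S x) 0.
    exists 0%N; move: rS; rewrite Sx0 poweR0r ?gt_eqF// mul0e; exact: ltW.
  have [m hm] : exists m, (c * l0 m)%:E < S x.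
    have Sgt : 0 < S x by rewrite lt_neqAle eq_sym Sxn0 S0.
    case: (S x) Sgt => [s| |//] s0; last by exists 0%N; rewrite ltry.
    rewrite lte_fin in s0.
    exists (Num.truncn (c / s)%R).+1; rewrite lte_fin /l0 -ltr_pdivlMl//.
    rewrite -[ltRHS]invrK ltf_pV2 ?posrE ?exprn_gt0//; last first.
      by rewrite invr_gt0 mulr_gt0// invr_gt0.
    rewrite invfM invrK; apply: (lt_trans (truncnS_gt _)).
    by rewrite -natrX ltr_nat ltn_expl.
  by exists m; rewrite indicE_set// mule1; exact: ltW.
move=> m.
pose l i : R := (l0 m * 2 ^+ i)%R.
have lgt0 i : (0 < l i)%R by rewrite mulr_gt0// exprn_gt0.
have lS i : l i.+1 = (2 * l i)%R by rewrite /l exprS; ring.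
have l0E : l 0%N = l0 m by rewrite /l expr0 mulr1.
have mA i : measurable [set x | (c * l i)%:E < S x] by exact: measurable_gt.
have mB i : measurable [set x | (l i)%:E < h x] by exact: measurable_gt.
have if_indic (A : X -> bool) x :
    (if A x then 1 else 0 : \bar R) = (\1_[set y | A y] x)%:E.
  by case: ifPn => Ax; [rewrite indicE_set|rewrite indicE_setN//; exact/negP].
apply: (@le_trans _ _ (\int[nu]_x \sum_(i <oo)
    ((c * l i.+1) `^ u)%:E * (\1_[set x | ((c * l i)%:E < S x)%E] x)%:E)).
  apply: le_int => x; first by rewrite mule_ge0 ?poweR_ge0.
  have [xS|xS] := boolP ((c * l0 m)%:E < S x); last first.
    rewrite indicE_setN; last exact/negP.
    rewrite mule0; apply: nneseries_ge0 => i _ _.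
    by rewrite mule_ge0// lee_fin powR_ge0.
  rewrite indicE_set// mule1.
  have := @dyadic_layers l u c (S x) u1 c0 lgt0 lS; rewrite l0E => /(_ xS) h1.
  apply: (le_trans h1); apply: lee_nneseries => [i _ _|i _].
    by rewrite mule_ge0 ?lee_fin ?powR_ge0//; case: ifP.
  by rewrite (if_indic (fun y => (c * l i)%:E < S y)).
rewrite integral_nneseries//; first last.
- by move=> i x _; rewrite mule_ge0// lee_fin powR_ge0.
- move=> i; apply: emeasurable_funM => //; exact: measurable_EFin_indic.
apply: (@le_trans _ _ (\sum_(i <oo) \int[nu]_x
   (((2 * c) `^ u * l i `^ (u - 1))%:E * (h x * (\1_[set x | ((l i)%:E < h x)%E] x)%:E)))).
  apply: lee_nneseries => [i _ _|i _].
    by apply: integral_ge0 => x _; rewrite mule_ge0// lee_fin powR_ge0.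
  rewrite ge0_integralZl//=; last 2 first.
  - exact: measurable_EFin_indic.
  - by rewrite lee_fin powR_ge0.
  rewrite integral_indic// setIT.
  rewrite ge0_integralZl//=; last 3 first.
  - by apply: emeasurable_funM => //; exact: measurable_EFin_indic.
  - by move=> x _; rewrite mule_ge0.
  - by rewrite lee_fin mulr_ge0 ?powR_ge0.
  (* One factor [l i] is set aside for the weak-type inequality; the remaining power u - 1 is summed
     by [geometric_below]. *)
  have -> : ((c * l i.+1) `^ u = (2 * c) `^ u * l i `^ (u - 1) * l i)%R.
    have li0 := ltW (lgt0 i).
    have c20 : (0 <= 2 * c)%R by rewrite mulr_ge0// ltW.
    rewrite lS mulrA (mulrC c) (powRM _ c20 li0).
    by rewrite -mulrA (mulrC (l i `^ _)%R) mulr_powRB1.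
  rewrite EFinM -muleA; apply: lee_wpmul2l; last exact: weak.
  by rewrite lee_fin mulr_ge0 ?powR_ge0.
rewrite -integral_nneseries//; first last.
- by move=> i x _; rewrite !mule_ge0// lee_fin mulr_ge0 ?powR_ge0.
- move=> i; apply: emeasurable_funM => //; apply: emeasurable_funM => //.
  exact: measurable_EFin_indic.
have mhu : measurable_fun setT (fun x => h x `^ u).
  exact: (measurableT_comp (measurable_poweR _)).
rewrite -ge0_integralZl//=; last 2 first.
- by move=> x _; exact: poweR_ge0.
- by rewrite lee_fin strong_cst_ge0.
apply: le_int => x.
  apply: nneseries_ge0 => i _ _.
  by rewrite !mule_ge0// lee_fin mulr_ge0 ?powR_ge0.
apply: lime_le.
  by apply: is_cvg_nneseries => i _ _; rewrite !mule_ge0// lee_fin mulr_ge0 ?powR_ge0.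
apply: nearW => n; rewrite big_mkord.
rewrite (eq_bigr (fun i : 'I_n => ((2 * c) `^ u)%:E * h x *
  ((l i `^ (u - 1))%:E * (if (l i)%:E < h x then 1 else 0)))); last first.
  move=> i _; rewrite (if_indic (fun y => (l i)%:E < h y)).
  by rewrite EFinM [in RHS]muleACA !muleA.
rewrite -ge0_sume_distrr; last first.
  by move=> i _; rewrite mule_ge0 ?lee_fin ?powR_ge0//; case: ifP.
apply: (le_trans (lee_wpmul2l _ (geometric_below _ _ u1 lgt0 lS))).
  by rewrite mule_ge0// lee_fin powR_ge0.
rewrite /strong_cst (EFinM ((2 * c) `^ u)%R) -!muleA lee_wpmul2l ?lee_fin ?powR_ge0//.
by rewrite muleCA mule_poweRB1//; exact: ltW.
Qed.

End marcinkiewicz.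

(** * Tonelli's theorem over the sections of a symmetric relation *)

Section symmetric_relation.
Context d (X : measurableType d) (R : realType).
Implicit Types (P : X -> set X) (F G : X -> \bar R).

Lemma integral_in_indic (m : {measure set X -> \bar R}) (A : set X) G :
  \int[m]_(y in A) G y = \int[m]_y (G y * (\1_A y)%:E).
Proof.
rewrite integral_mkcond; apply: eq_integral => y _; rewrite /patch indicE.
by case: (y \in A); rewrite ?mule1 ?mule0.
Qed.

Lemma measurable_section P x : measurable [set z : X * X | P z.1 z.2] ->
  measurable (P x).
Proof.
move=> mP; rewrite (_ : P x = xsection [set z : X * X | P z.1 z.2] x).
  exact: measurable_xsection.
by apply/seteqP; split=> y; rewrite /xsection/= inE.
Qed.

Lemma measurable_indic_rel P G : measurable [set z : X * X | P z.1 z.2] ->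
  measurable_fun setT G ->
  measurable_fun setT (fun z : X * X => G z.2 * (\1_(P z.1) z.2)%:E).
Proof.
move=> mP mG; apply: emeasurable_funM; first exact: (measurableT_comp mG).
apply: (eq_measurable_fun (fun z => (\1_[set z : X * X | P z.1 z.2] z)%:E)).
  by move=> z _; rewrite !indicE; congr ((_ : bool)%:R%:E); apply/idP/idP => /set_mem h;
     apply/mem_set.
exact: measurable_EFin_indic.
Qed.

Lemma measurable_int_rel (m : {sigma_finite_measure set X -> \bar R}) P G :
  measurable [set z : X * X | P z.1 z.2] ->
  measurable_fun setT G -> (forall y, 0 <= G y) ->
  measurable_fun setT (fun x => \int[m]_(y in P x) G y).
Proof.
move=> mP mG G0; apply: (eq_measurable_fun
  (fun x => \int[m]_y (fun z : X * X => G z.2 * (\1_(P z.1) z.2)%:E) (x, y))).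
  by move=> x _; rewrite /= (integral_in_indic _ (P x)).
apply: (@measurable_fun_fubini_tonelli_F _ _ _ _ _ m
  (fun z : X * X => G z.2 * (\1_(P z.1) z.2)%:E)).
  exact: measurable_indic_rel.
by move=> z; rewrite mule_ge0// lee_fin.
Qed.

Lemma int_swap (m1 m2 : {sigma_finite_measure set X -> \bar R}) P F G :
  (forall x y, P x y -> P y x) -> measurable [set z : X * X | P z.1 z.2] ->
  measurable_fun setT F -> (forall y, 0 <= F y) ->
  measurable_fun setT G -> (forall y, 0 <= G y) ->
  \int[m1]_x (F x * \int[m2]_(y in P x) G y) =
  \int[m2]_y (G y * \int[m1]_(x in P y) F x).
Proof.
move=> symP mP mF F0 mG G0.
have mPx x : measurable (P x) by exact: measurable_section.
have ind0 x y : 0 <= (\1_(P x) y)%:E :> \bar R by rewrite lee_fin.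
have indC x y : \1_(P x) y = \1_(P y) x :> R.
  by rewrite !indicE; congr ((_ : bool)%:R); apply/idP/idP => /set_mem h;
     apply/mem_set/symP.
transitivity (\int[m1]_x \int[m2]_y (F x * (G y * (\1_(P x) y)%:E))).
  apply: eq_integral => x _; rewrite (integral_in_indic _ (P x)) ge0_integralZl//.
  - by apply: emeasurable_funM => //; exact: measurable_EFin_indic.
  - by move=> y _; rewrite mule_ge0.
rewrite (@fubini_tonelli _ _ _ _ _ m1 m2
  (fun z : X * X => F z.1 * (G z.2 * (\1_(P z.1) z.2)%:E))); last 2 first.
- apply: emeasurable_funM; first exact: (measurableT_comp mF).
  exact: measurable_indic_rel.
- by move=> z; rewrite !mule_ge0.
apply: eq_integral => y _; rewrite (integral_in_indic _ (P y)) -ge0_integralZl//; last 2 first.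
- by apply: emeasurable_funM => //; exact: measurable_EFin_indic.
- by move=> x _; rewrite mule_ge0.
by apply: eq_integral => x _; rewrite muleCA indC.
Qed.

End symmetric_relation.

(** * Abstract dyadic cubes *)

Section measurability_complements.
Context d (X : measurableType d) (R : realType).
Implicit Types f : X -> \bar R.

Lemma measurable_inve f : measurable_fun setT f -> (forall x, 0 <= f x) ->
  measurable_fun setT (fun x => (f x)^-1).
Proof.
move=> mf f0 mD; apply: (measurability _ (ErealGenOInfty.measurableE R)) => //.
move=> _ [_ [r ->] <-]; rewrite setTI.
have [r0|r0] := ltP r 0%R.
  rewrite (_ : _ @^-1` _ = setT); first exact: measurableT.
  apply/seteqP; split=> // x _; rewrite /= in_itv/= andbT.
  by apply: (@lt_le_trans _ _ 0); rewrite ?lte_fin ?inve_ge0.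
rewrite (_ : _ @^-1` _ = [set x | f x < r%:E^-1]).
  rewrite -[X in measurable X]setTI; exact: emeasurable_fun_infty_o.
have e x : (r%:E < (f x)^-1) = (f x < r%:E^-1) by rewrite inve_pgt ?inE.
by apply/seteqP; split=> x; rewrite /= in_itv/= andbT e.
Qed.

Lemma measurable_ereal_sup_range (u : nat -> X -> \bar R) :
  (forall n, measurable_fun setT (u n)) ->
  measurable_fun setT (fun x => ereal_sup (range (u ^~ x))).
Proof.
move=> mu; apply: (eq_measurable_fun (fun x => esups (u ^~ x) 0%N)).
  move=> x _; rewrite /esups/= /sdrop; congr ereal_sup.
  by apply/seteqP; split=> _ [k _ <-]; exists k.
exact: measurable_fun_esups.
Qed.

End measurability_complements.

(* [Q i x] plays the dyadic cube of generation [i] containing [x] (the generations shrink as [i] grows), and [N i x] the union of the cubes of that generation near [Q i x]. *)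
Record cube_system d (X : measurableType d) (R : realType)
    (sigma : {measure set X -> \bar R}) (Q N : nat -> X -> set X) (Th : R) : Prop := CubeSystem {
  cube_refl : forall i x, Q i x x ;
  cube_sym : forall i x y, Q i x y -> Q i y x ;
  cube_trans : forall i x y z, Q i x y -> Q i y z -> Q i x z ;
  cube_nest : forall i x y, Q i.+1 x y -> Q i x y ;
  nbhd_sym : forall i x y, N i x y -> N i y x ;
  nbhd_sub : forall i x y, Q i x y -> N i x y ;
  nbhd_nest : forall i x y, N i.+1 x y -> N i x y ;
  nbhd_cube : forall i x y z, Q i x y -> N i y z -> N i x z ;
  cube_measurable : forall i, measurable [set z : X * X | Q i z.1 z.2] ;
  nbhd_measurable : forall i, measurable [set z : X * X | N i z.1 z.2] ;
  cube_gt0 : forall i x, 0 < sigma (Q i x) ;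
  nbhd_lty : forall i x, sigma (N i x) < +oo ;
  nbhd_doubling : forall i x, sigma (N i x) <= Th%:E * sigma (Q i x) ;
  doubling_ge1 : (1 <= Th)%R }.

(** * Elementary properties of a cube system *)

Section cubes.
Context d (X : measurableType d) (R : realType).
Variables (sigma : {sigma_finite_measure set X -> \bar R}).
Variables (Q N : nat -> X -> set X) (Th : R).
Hypothesis CS : cube_system sigma Q N Th.
Implicit Types (i l : nat) (x y z : X) (F G h : X -> \bar R).

(** Taking each cube as its own neighbourhood makes the maximal theorem below cover the ordinary
    dyadic maximal function as well. *)
Lemma cube_system_self : cube_system sigma Q Q Th.
Proof.
case: CS => r s t n ns nb nn nc mQ mN g0 fN dN T1; split=> //.
- move=> i x; apply: le_lt_trans (fN i x); apply: le_measure.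
  + by rewrite inE; exact: measurable_section.
  + by rewrite inE; exact: measurable_section.
  + by move=> y; exact: nb.
- move=> i x; rewrite -[leLHS]mul1e lee_wpmul2r// ?lee_fin//.
Qed.

Lemma cube_nestn l i x y : (l <= i)%N -> Q i x y -> Q l x y.
Proof.
move=> /subnK <-; elim: (i - l)%N => [//|m IH]; rewrite addSn => h.
by apply: IH; exact: (cube_nest CS).
Qed.

Lemma nbhd_nestn l i x y : (l <= i)%N -> N i x y -> N l x y.
Proof.
move=> /subnK <-; elim: (i - l)%N => [//|m IH]; rewrite addSn => h.
by apply: IH; exact: (nbhd_nest CS).
Qed.

Lemma cube_eq i x y : Q i x y -> Q i x = Q i y.
Proof.
move=> xy; apply/seteqP; split=> z.
  by apply: (cube_trans CS); exact: (cube_sym CS).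
exact: (cube_trans CS).
Qed.

Lemma nbhd_eq i x y : Q i x y -> N i x = N i y.
Proof.
move=> xy; apply/seteqP; split=> z; last exact: (nbhd_cube CS).
by apply: (nbhd_cube CS); exact: (cube_sym CS).
Qed.

Lemma cube_sub_nbhd i x y z : N i y x -> Q i x z -> N i y z.
Proof.
move=> yx xz; apply: (nbhd_sym CS); apply: (nbhd_cube CS) (nbhd_sym CS yx).
exact: (cube_sym CS).
Qed.

Lemma measurable_cube i x : measurable (Q i x).
Proof. by apply: measurable_section; exact: (cube_measurable CS). Qed.

Lemma measurable_nbhd i x : measurable (N i x).
Proof. by apply: measurable_section; exact: (nbhd_measurable CS). Qed.

Lemma cube_le_nbhd (nu : {measure set X -> \bar R}) i x : nu (Q i x) <= nu (N i x).
Proof.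
apply: le_measure; rewrite ?inE.
- exact: measurable_cube.
- exact: measurable_nbhd.
- by move=> y; exact: (nbhd_sub CS).
Qed.

Lemma cube_lty i x : sigma (Q i x) < +oo.
Proof. by apply: le_lt_trans (nbhd_lty CS i x); exact: cube_le_nbhd. Qed.

Lemma cube_fin i x : sigma (Q i x) \is a fin_num.
Proof. by rewrite ge0_fin_numE// cube_lty. Qed.

(** Against this density every cube of generation [i] has mass 1, so a sum over cubes becomes an
    integral over points, without enumerating cubes. *)
Definition wt i x := (sigma (Q i x))^-1.

Lemma wt_ge0 i x : 0 <= wt i x.
Proof. by rewrite inve_ge0. Qed.

Lemma wtK i x : sigma (Q i x) * wt i x = 1.
Proof. by rewrite divee ?cube_fin// gt_eqF// (cube_gt0 CS). Qed.

Lemma wt_eq i x y : Q i x y -> wt i x = wt i y.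
Proof. by move=> xy; rewrite /wt (cube_eq xy). Qed.

Lemma measurable_mcube (nu : {sigma_finite_measure set X -> \bar R}) i :
  measurable_fun setT (fun x => nu (Q i x)).
Proof.
apply: (eq_measurable_fun (fun x => \int[nu]_(y in Q i x) cst 1 y)).
  by move=> x _; rewrite integral_cst ?mul1e//; exact: measurable_cube.
by apply: measurable_int_rel => //; exact: (cube_measurable CS).
Qed.

Lemma measurable_mnbhd (nu : {sigma_finite_measure set X -> \bar R}) i :
  measurable_fun setT (fun x => nu (N i x)).
Proof.
apply: (eq_measurable_fun (fun x => \int[nu]_(y in N i x) cst 1 y)).
  by move=> x _; rewrite integral_cst ?mul1e//; exact: measurable_nbhd.
by apply: measurable_int_rel => //; exact: (nbhd_measurable CS).
Qed.

Lemma measurable_wt i : measurable_fun setT (wt i).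
Proof. by apply: measurable_inve => //; exact: measurable_mcube. Qed.

Lemma int_cube_const (nu : {measure set X -> \bar R}) i x (F : X -> \bar R) (c : \bar R) :
  (forall y, Q i x y -> F y = c) ->
  \int[nu]_(y in Q i x) F y = c * nu (Q i x).
Proof.
move=> Fc; rewrite -integral_cst; last exact: measurable_cube.
by apply: eq_integral => y /set_mem /Fc.
Qed.

Lemma int_cube_wt i x : \int[sigma]_(y in Q i x) wt i y = 1.
Proof.
rewrite (@int_cube_const _ _ _ _ (wt i x)); first by rewrite muleC wtK.
by move=> y /wt_eq.
Qed.

Lemma int_cube_swap (m1 m2 : {sigma_finite_measure set X -> \bar R}) i F G :
  measurable_fun setT F -> (forall y, 0 <= F y) ->
  measurable_fun setT G -> (forall y, 0 <= G y) ->
  \int[m1]_x (F x * \int[m2]_(y in Q i x) G y) =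
  \int[m2]_y (G y * \int[m1]_(x in Q i y) F x).
Proof. by apply: int_swap; [exact: (cube_sym CS)|exact: (cube_measurable CS)]. Qed.

Lemma int_nbhd_swap (m1 m2 : {sigma_finite_measure set X -> \bar R}) i F G :
  measurable_fun setT F -> (forall y, 0 <= F y) ->
  measurable_fun setT G -> (forall y, 0 <= G y) ->
  \int[m1]_x (F x * \int[m2]_(y in N i x) G y) =
  \int[m2]_y (G y * \int[m1]_(x in N i y) F x).
Proof. by apply: int_swap; [exact: (nbhd_sym CS)|exact: (nbhd_measurable CS)]. Qed.

Lemma int_average i F : measurable_fun setT F -> (forall y, 0 <= F y) ->
  \int[sigma]_x F x = \int[sigma]_x (wt i x * \int[sigma]_(y in Q i x) F y).
Proof.
move=> mF F0; rewrite int_cube_swap//; last 2 first.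
- exact: measurable_wt.
- exact: wt_ge0.
by apply: eq_integral => x _; rewrite int_cube_wt mule1.
Qed.

(** By symmetry [Q i x] lies in [N i y], whose mass is at most [Th] times that of [Q i y]. *)
Lemma wt_nbhd_le i x y : N i x y -> wt i y <= Th%:E * wt i x.
Proof.
move=> xy.
have le1 : sigma (Q i x) <= Th%:E * sigma (Q i y).
  apply: le_trans (nbhd_doubling CS i y); apply: le_measure; rewrite ?inE.
  - exact: measurable_cube.
  - exact: measurable_nbhd.
  - by move=> z xz; apply: (cube_sub_nbhd (nbhd_sym CS xy)).
rewrite -[leLHS]mul1e -(wtK i x) -muleA [X in _ * X]muleC muleA.
rewrite lee_wpmul2r ?wt_ge0//.
apply: (le_trans (lee_wpmul2r (wt_ge0 i y) le1)).
by rewrite -muleA wtK mule1.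
Qed.

(** The integral counts the cubes in a neighbourhood. One factor [Th] compares the weights, the
    other compares the masses of [N i x] and [Q i x]. *)
Lemma int_nbhd_wt i x : \int[sigma]_(y in N i x) wt i y <= (Th ^+ 2)%:E.
Proof.
apply: (@le_trans _ _ (\int[sigma]_(y in N i x) (Th%:E * wt i x))).
  apply: ge0_le_integral.
  - exact: measurable_nbhd.
  - by move=> y _; exact: wt_ge0.
  - by apply: measurable_funTS; exact: measurable_wt.
  - exact: measurable_cst.
  - by move=> y; exact: wt_nbhd_le.
have T0 : 0 <= Th%:E by rewrite lee_fin; exact: le_trans (doubling_ge1 CS).
rewrite integral_cst; last exact: measurable_nbhd.
rewrite expr2 EFinM -muleA lee_wpmul2l//.
apply: (le_trans (lee_wpmul2l (wt_ge0 i x) (nbhd_doubling CS i x))).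
by rewrite muleCA [wt i x * _]muleC wtK mule1.
Qed.

End cubes.

(** * The maximal theorem for an arbitrary measure *)

Section maximal_function.
Context d (X : measurableType d) (R : realType).
Variables (sigma nu : {sigma_finite_measure set X -> \bar R}).
Variables (Q N : nat -> X -> set X) (Th : R).
Hypothesis CS : cube_system sigma Q N Th.
Implicit Types (i l : nat) (x y z : X) (F G h : X -> \bar R).

(** Integral over the cube, normalisation by the neighbourhood: [nu] need not be doubling, and this
    is what lets a cube control its neighbourhood in the weak-type estimate. *)
Definition nbhd_avg h i x := (nu (N i x))^-1 * \int[nu]_(y in Q i x) h y.

Definition smooth_avg h i y := \int[sigma]_(x in N i y) (wt sigma Q i x * nbhd_avg h i x).

(* Averaging over the cubes of [N i y] instead of taking their supremum costs a factor [Th ^+ 2] and makes measurability immediate. *)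
Definition maxfun h y := ereal_sup (range (fun i => smooth_avg h i y)).

Lemma nbhd_avg_ge0 h i x : (forall x, 0 <= h x) -> 0 <= nbhd_avg h i x.
Proof. by move=> h0; rewrite mule_ge0 ?inve_ge0// integral_ge0. Qed.

Lemma nbhd_avg_eq h i x y : Q i x y -> nbhd_avg h i x = nbhd_avg h i y.
Proof. by move=> xy; rewrite /nbhd_avg (cube_eq CS xy) (nbhd_eq CS xy). Qed.

Lemma measurable_nbhd_avg h i : measurable_fun setT h -> (forall x, 0 <= h x) ->
  measurable_fun setT (nbhd_avg h i).
Proof.
move=> mh h0; apply: emeasurable_funM.
  by apply: measurable_inve => //; exact: (measurable_mnbhd CS).
by apply: measurable_int_rel => //; exact: (cube_measurable CS).
Qed.

Lemma measurable_smooth_avg h i : measurable_fun setT h -> (forall x, 0 <= h x) ->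
  measurable_fun setT (smooth_avg h i).
Proof.
move=> mh h0; apply: measurable_int_rel.
- exact: (nbhd_measurable CS).
- apply: emeasurable_funM; first exact: (measurable_wt CS).
  exact: measurable_nbhd_avg.
- by move=> y; rewrite mule_ge0 ?wt_ge0 ?nbhd_avg_ge0.
Qed.

Lemma smooth_avg_ge0 h i x : (forall x, 0 <= h x) -> 0 <= smooth_avg h i x.
Proof.
by move=> h0; apply: integral_ge0 => y _; rewrite mule_ge0 ?wt_ge0 ?nbhd_avg_ge0.
Qed.

Lemma measurable_maxfun h : measurable_fun setT h -> (forall x, 0 <= h x) ->
  measurable_fun setT (maxfun h).
Proof.
by move=> mh h0; apply: measurable_ereal_sup_range => i; exact: measurable_smooth_avg.
Qed.

Lemma maxfun_ge0 h x : (forall x, 0 <= h x) -> 0 <= maxfun h x.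
Proof.
move=> h0; apply: (le_trans (smooth_avg_ge0 0%N x h0)).
by apply: ereal_sup_ubound; exists 0%N.
Qed.

(** The cube of [x] lies in [N i y], has mass 1 for the weight, and [nbhd_avg] is constant on it. *)
Lemma nbhd_avg_le_maxfun h i x y : (forall x, 0 <= h x) -> N i x y ->
  nbhd_avg h i x <= maxfun h y.
Proof.
move=> h0 xy.
apply: (@le_trans _ _ (smooth_avg h i y)); last by apply: ereal_sup_ubound; exists i.
apply: (@le_trans _ _ (\int[sigma]_(z in Q i x) (wt sigma Q i z * nbhd_avg h i z))).
  rewrite (@int_cube_const _ _ _ _ _ _ _ CS _ _ _ _ (wt sigma Q i x * nbhd_avg h i x)).
    by rewrite muleAC [wt _ _ _ _ * _]muleC (wtK CS) mul1e.
  by move=> z xz; rewrite (wt_eq CS xz) (nbhd_avg_eq _ xz).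
apply: int_set_le; last by move=> z; rewrite mule_ge0 ?wt_ge0 ?nbhd_avg_ge0.
by move=> z; exact: (cube_sub_nbhd CS (nbhd_sym CS xy)).
Qed.

Lemma smooth_avg_le h i y (t : R) : (0 <= t)%R -> measurable_fun setT h ->
  (forall x, 0 <= h x) -> (forall x, N i y x -> nbhd_avg h i x <= t%:E) ->
  smooth_avg h i y <= (Th ^+ 2 * t)%:E.
Proof.
move=> t0 mh h0 le_t.
apply: (@le_trans _ _ (\int[sigma]_(x in N i y) (wt sigma Q i x * t%:E))).
  apply: ge0_le_int => //.
  - by move=> x; rewrite mule_ge0 ?wt_ge0 ?nbhd_avg_ge0.
  - by move=> x; rewrite mule_ge0 ?wt_ge0 ?lee_fin.
  - by move=> x yx; rewrite lee_wpmul2l ?wt_ge0 ?le_t.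
rewrite ge0_integralZr//; last 3 first.
- exact: (measurable_nbhd CS).
- by apply: measurable_funTS; exact: (measurable_wt CS).
- by move=> x _; exact: wt_ge0.
- by rewrite EFinM lee_wpmul2r ?lee_fin// (int_nbhd_wt CS).
Qed.

(** Union of the stopping cubes of generation [i]. Since generation 0 is the coarsest, the first
    index is the largest cube, and it exists as soon as any average exceeds [t]. *)
Definition first_exceed h (t : R) i : set X :=
  [set x | t%:E < nbhd_avg h i x /\ forall l, (l < i)%N -> nbhd_avg h l x <= t%:E].

Lemma first_exceed_cube h t i x y : Q i x y ->
  first_exceed h t i x -> first_exceed h t i y.
Proof.
move=> xy [tx le_t]; split; first by rewrite -(nbhd_avg_eq h xy).
move=> l li; rewrite -(@nbhd_avg_eq h l x y) ?le_t//.
exact: (cube_nestn CS (ltnW li)).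
Qed.

Lemma measurable_first_exceed h t i : measurable_fun setT h ->
  (forall x, 0 <= h x) -> measurable (first_exceed h t i).
Proof.
move=> mh h0.
rewrite (_ : first_exceed h t i = [set x | t%:E < nbhd_avg h i x] `&`
    \bigcap_(l in `I_i) [set x | nbhd_avg h l x <= t%:E]).
  apply: measurableI; first by apply: measurable_gt; exact: measurable_nbhd_avg.
  apply: bigcap_measurableType => l _.
  rewrite -[X in measurable X]setTI; apply: emeasurable_fun_infty_c => //.
  exact: measurable_nbhd_avg.
by apply/seteqP; split=> x [? ?]; split.
Qed.

Lemma trivIset_first_exceed h t : trivIset setT (first_exceed h t).
Proof.
apply/trivIsetP => i j _ _; wlog ij : i j / (i < j)%N => [wl|_].
  rewrite neq_ltn => /orP[ij|ji]; first by apply: wl => //; rewrite lt_eqF.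
  by rewrite setIC; apply: wl => //; rewrite lt_eqF.
apply/seteqP; split=> // x [[xi _] [_ /(_ i ij)]].
by rewrite leNgt xi.
Qed.

(* Calderon-Zygmund stopping: the maximal cubes where the average exceeds [t] are disjoint, and the neighbourhoods of smaller ones lie in theirs. *)
Lemma maxfun_weak h (t : R) : (0 < t)%R -> measurable_fun setT h ->
  (forall x, 0 <= h x) ->
  t%:E * nu [set y | (Th ^+ 2 * t)%:E < maxfun h y] <= \int[nu]_x h x.
Proof.
move=> t0 mh h0.
set E := first_exceed h t.
have mE i : measurable (E i) by exact: measurable_first_exceed.
pose eE i x := (\1_(E i) x)%:E * wt sigma Q i x.
have eE0 i x : 0 <= eE i x by rewrite mule_ge0 ?wt_ge0 ?lee_fin.
have meE i : measurable_fun setT (eE i).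
  by apply: emeasurable_funM; [exact: measurable_EFin_indic|exact: (measurable_wt CS)].
pose phi i y := \int[sigma]_(x in N i y) eE i x.
have phi0 i y : 0 <= phi i y by exact: integral_ge0.
have mphi i : measurable_fun setT (phi i).
  by apply: measurable_int_rel => //; exact: (nbhd_measurable CS).
(* [phi i y] counts the stopping cubes of generation [i] near [y]. If all averages near [y] were at
   most [t], [smooth_avg_le] would bound the smoothed ones by Th^2 t; so some cube near [y] exceeds
   [t], and the stopping cube above it is still near [y]. *)
have cover y : (Th ^+ 2 * t)%:E < maxfun h y -> 1 <= \sum_(i <oo) phi i y.
  move=> /ereal_sup_gt[_ [i _ <-]] lt_sm.
  have [x yx tx] : exists2 x, N i y x & t%:E < nbhd_avg h i x.
    apply: contrapT => nex; move: lt_sm; rewrite ltNge => /negP; apply.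
    apply: smooth_avg_le => //; first exact: ltW.
    move=> x yx; rewrite leNgt; apply/negP => lt; apply: nex.
    by exists x.
  case: (ex_minnP (ex_intro (fun l => t%:E < nbhd_avg h l x) i tx)) => l tl lmin.
  have li : (l <= i)%N by exact: lmin.
  have xE : E l x.
    split=> // j jl; rewrite leNgt; apply/negP => /lmin.
    by rewrite leqNgt jl.
  apply: (@le_trans _ _ (phi l y)).
    rewrite -(int_cube_wt CS l x); apply: ge0_le_int => //.
    - by move=> z; exact: (cube_sub_nbhd CS (nbhd_nestn CS li yx)).
    - by move=> z; exact: wt_ge0.
    - move=> z xz; rewrite /eE indicE mem_set ?mul1e//.
      exact: (first_exceed_cube xz).
  have := @nneseries_lim_ge _ (fun i => phi i y) xpredT 0%N l.+1 (fun n _ _ => phi0 n y).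
  apply: le_trans; rewrite big_mkord big_ord_recr/= leeDr// sume_ge0//.
have mmax := measurable_maxfun mh h0.
apply: (@le_trans _ _ (t%:E * \int[nu]_y \sum_(i <oo) phi i y)).
  rewrite lee_wpmul2l ?lee_fin ?(ltW t0)//.
  rewrite -[X in nu X]setIT -integral_indic//; last exact: measurable_gt.
  apply: le_int => y; first by rewrite lee_fin.
  have [lty|nlty] := boolP ((Th ^+ 2 * t)%:E < maxfun h y).
    by rewrite indicE_set// cover.
  rewrite indicE_setN; last exact/negP.
  exact: nneseries_ge0.
rewrite integral_nneseries// -nneseriesZl; last by move=> i _; exact: integral_ge0.
have mcapE : measurable (\bigcup_i E i) by exact: bigcup_measurable.
apply: (@le_trans _ _ (\int[nu]_(x in \bigcup_i E i) h x)); last exact: int_set_le.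
rewrite ge0_integral_bigcup//; last 2 first.
- exact: measurable_funTS.
- exact: trivIset_first_exceed.
apply: lee_nneseries => [i _ _|i _].
  by rewrite mule_ge0 ?lee_fin ?(ltW t0)// integral_ge0.
(* Exchanging the integrals produces [nu (N i x)] for [x] in a stopping cube, and t times this mass
   is at most the integral of [h] over that cube. *)
have -> : \int[nu]_x phi i x = \int[nu]_x (cst 1 x * \int[sigma]_(y in N i x) eE i y).
  by apply: eq_integral => x _; rewrite mul1e.
rewrite (int_nbhd_swap CS)//.
rewrite -ge0_integralZl//=; last 3 first.
- apply: emeasurable_funM => //; apply: measurable_int_rel => //.
  exact: (nbhd_measurable CS).
- by move=> x _; rewrite mule_ge0// integral_ge0.
- by rewrite lee_fin ltW.
apply: (@le_trans _ _ (\int[sigma]_x (eE i x * \int[nu]_(y in Q i x) h y))).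
  apply: le_int => x.
    by apply: mule_ge0; [rewrite lee_fin ltW | apply: mule_ge0 => //; exact: integral_ge0].
  rewrite muleCA /eE; have [xE|xE] := boolP (x \in E i); last first.
    by rewrite indicE (negbTE xE) !mul0e.
  rewrite lee_wpmul2l ?mule_ge0 ?wt_ge0 ?lee_fin//.
  rewrite integral_cst ?mul1e; last exact: (measurable_nbhd CS).
  have [/ltW tx _] := set_mem xE.
  have I0 : 0 <= \int[nu]_(y in Q i x) h y by exact: integral_ge0.
  change (t%:E * nu (N i x) <= \int[nu]_(y in Q i x) h y).
  have [->|nu_n0] := eqVneq (nu (N i x)) 0; first by rewrite mule0.
  (* With infinite mass the average is 0, since the inverse of +oo is 0, so the cube cannot have
     been selected. *)
  have [nuy|nu_fin] := eqVneq (nu (N i x)) +oo.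
    by move: tx; rewrite /nbhd_avg nuy invey mul0e lee_fin leNgt t0.
  apply: (@le_trans _ _ (nbhd_avg h i x * nu (N i x))).
    by rewrite lee_wpmul2r.
  have nf : nu (N i x) \is a fin_num by rewrite ge0_fin_numE// lt_neqAle nu_fin leey.
  by rewrite /nbhd_avg muleAC [_^-1 * _]muleC divee// mul1e.
rewrite (int_cube_swap CS)// [leRHS]integral_in_indic.
apply: le_int => x; first by rewrite mule_ge0// integral_ge0.
rewrite lee_wpmul2l//.
have [xE|xE] := boolP (x \in E i).
  rewrite indicE xE -(int_cube_wt CS i x); apply: ge0_le_int => //.
    by move=> y; exact: wt_ge0.
  move=> y _; rewrite /eE -[leRHS]mul1e lee_wpmul2r ?wt_ge0// lee_fin indicE.
  by case: (y \in _).
rewrite indicE (negbTE xE) (@int_cube_const _ _ _ _ _ _ _ CS _ _ _ _ 0) ?mul0e//.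
move=> y xy; rewrite /eE indicE memNset ?mul0e// => /(first_exceed_cube (cube_sym CS xy)).
by move/mem_set; apply/negP.
Qed.

(** The part of [h] below [t] has averages at most [t], because a cube has no more mass than its
    neighbourhood. Hence the level 2 Th^2 t in [maxfun_strong] is left to the part above [t]. *)
Lemma smooth_avg_split h (t : R) i y : (0 < t)%R -> measurable_fun setT h ->
  (forall x, 0 <= h x) ->
  smooth_avg h i y <= (Th ^+ 2 * t)%:E +
    smooth_avg (fun x => h x * (\1_[set x | (t%:E < h x)%E] x)%:E) i y.
Proof.
move=> t0 mh h0; set g := fun x => h x * _.
have g0 x : 0 <= g x by rewrite mule_ge0// lee_fin.
have mg : measurable_fun setT g.
  by apply: emeasurable_funM => //; apply/measurable_EFin_indic/measurable_gt.
have key x : nbhd_avg h i x <= t%:E + nbhd_avg g i x.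
  have mQ := measurable_cube CS i x.
  apply: (@le_trans _ _ ((nu (N i x))^-1 * (t%:E * nu (Q i x) + \int[nu]_(y in Q i x) g y))).
    rewrite lee_wpmul2l ?inve_ge0// -integral_cst// -ge0_integralD//; last 2 first.
    - by move=> z _; rewrite lee_fin ltW.
    - exact: measurable_funTS.
    apply: ge0_le_int => //.
      by move=> z; rewrite adde_ge0// lee_fin ltW.
    move=> z _; rewrite /g; have [tz|tz] := boolP (t%:E < h z).
      by rewrite indicE_set// mule1 leeDr// lee_fin ltW.
    by rewrite indicE_setN ?mule0 ?adde0 ?leNgt//; exact/negP.
  rewrite ge0_muleDr; last 2 first.
  - by rewrite mule_ge0 ?lee_fin ?(ltW t0).
  - exact: integral_ge0.
  rewrite leeD2r// muleCA -[leRHS]mule1 lee_wpmul2l ?lee_fin ?(ltW t0)//.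
  have le_QN : nu (Q i x) <= nu (N i x) by exact: (cube_le_nbhd CS).
  have [nz|nnz] := eqVneq (nu (N i x)) 0.
    have -> : nu (Q i x) = 0 by apply/eqP; rewrite eq_le measure_ge0 -nz le_QN.
    by rewrite mule0.
  have [->|nu_fin] := eqVneq (nu (N i x)) +oo; first by rewrite invey mul0e.
  have nf : nu (N i x) \is a fin_num by rewrite ge0_fin_numE// lt_neqAle nu_fin leey.
  by rewrite -(divee nf nnz) muleC lee_wpmul2r ?inve_ge0.
have mN := measurable_nbhd CS i y.
have mw := measurable_wt CS.
apply: (@le_trans _ _ (\int[sigma]_(x in N i y)
    (wt sigma Q i x * t%:E + wt sigma Q i x * nbhd_avg g i x))).
  apply: ge0_le_int => //.
  - by move=> x; rewrite mule_ge0 ?wt_ge0 ?nbhd_avg_ge0.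
  - by move=> x; rewrite adde_ge0// mule_ge0 ?wt_ge0 ?nbhd_avg_ge0// lee_fin ltW.
  move=> x _; rewrite -ge0_muleDr ?nbhd_avg_ge0 ?lee_fin ?(ltW t0)//.
  by rewrite lee_wpmul2l ?wt_ge0.
rewrite ge0_integralD//; last 4 first.
- by move=> x _; rewrite mule_ge0 ?wt_ge0 ?lee_fin ?(ltW t0).
- by apply: measurable_funTS; apply: emeasurable_funM.
- by move=> x _; rewrite mule_ge0 ?wt_ge0 ?nbhd_avg_ge0.
- apply: measurable_funTS; apply: emeasurable_funM => //.
  exact: measurable_nbhd_avg.
rewrite leeD2r// ge0_integralZr//; last 3 first.
- exact: measurable_funTS.
- by move=> x _; exact: wt_ge0.
- by rewrite lee_fin ltW.
by rewrite EFinM lee_wpmul2r ?lee_fin ?(ltW t0)// (int_nbhd_wt CS).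
Qed.

Lemma maxfun_strong h (u : R) : (1 < u)%R -> measurable_fun setT h ->
  (forall x, 0 <= h x) ->
  \int[nu]_x maxfun h x `^ u <=
  (strong_cst (2 * Th ^+ 2) u)%:E * \int[nu]_x h x `^ u.
Proof.
move=> u1 mh h0; have T2 : (0 < Th ^+ 2)%R.
  by rewrite exprn_gt0//; exact: lt_le_trans (doubling_ge1 CS).
apply: strong_of_weak => //.
- by rewrite mulr_gt0.
- exact: measurable_maxfun.
- by move=> x; exact: maxfun_ge0.
move=> t t0; set g := fun x => h x * _.
have g0 x : 0 <= g x by rewrite mule_ge0// lee_fin.
have mg : measurable_fun setT g.
  by apply: emeasurable_funM => //; apply/measurable_EFin_indic/measurable_gt.
apply: le_trans (maxfun_weak t0 mg g0).
apply: lee_wpmul2l; first by rewrite lee_fin ltW.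
apply: le_measure; rewrite ?inE.
- by apply: measurable_gt; exact: measurable_maxfun.
- by apply: measurable_gt; exact: measurable_maxfun.
move=> y /= lt_y; rewrite ltNge; apply/negP => le_y.
move: lt_y; rewrite ltNge => /negP; apply; apply: ge_ereal_sup => _ [i _ <-].
apply: (le_trans (smooth_avg_split i y t0 mh h0)).
have -> : (2 * Th ^+ 2 * t = Th ^+ 2 * t + Th ^+ 2 * t)%R by ring.
rewrite EFinD leeD2l//; apply: le_trans le_y.
by apply: ereal_sup_ubound; exists i.
Qed.

End maximal_function.

(** * Energies and Wolff potentials *)

Section series.
Context {R : realType}.

Lemma ge0_nneseriesZr (c : \bar R) (f : nat -> \bar R) : (forall i, 0 <= f i) ->
  0 <= c -> \sum_(i <oo) (f i * c) = (\sum_(i <oo) f i) * c.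
Proof.
move=> f0 c0; rewrite -!ge0_integral_count//; last by move=> i; exact: mule_ge0.
by rewrite ge0_integralZr.
Qed.

Lemma ge0_nneseriesZl (c : \bar R) (f : nat -> \bar R) : (forall i, 0 <= f i) ->
  0 <= c -> \sum_(i <oo) (c * f i) = c * \sum_(i <oo) f i.
Proof.
move=> f0 c0; rewrite muleC -ge0_nneseriesZr//.
by apply: eq_eseriesr => i _; rewrite muleC.
Qed.

End series.

(** * Jensen's inequality for powers *)

Section jensen.
Context d (X : measurableType d) (R : realType).
Variable nu : {measure set X -> \bar R}.

(** Hoelder's inequality after splitting W as W^(1/s) W^(1/t) with s = t/(t-1). The total mass of W
    is kept in the bound, since the weights used below have mass up to Th^2. *)
Lemma jensen_power (W F : X -> \bar R) (t : R) : (1 <= t)%R ->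
  measurable_fun setT W -> (forall x, 0 <= W x) ->
  measurable_fun setT F -> (forall x, 0 <= F x) ->
  (\int[nu]_x (W x * F x)) `^ t <=
  (\int[nu]_x W x) `^ (t - 1) * \int[nu]_x (W x * F x `^ t).
Proof.
move=> t1 mW W0 mF F0.
have [->|/eqP tn] := eqVneq t 1%R.
  rewrite subrr poweRe0 mul1e poweRe1; last by apply: integral_ge0 => x _; exact: mule_ge0.
  by apply: le_int => x; [exact: mule_ge0|rewrite poweRe1].
have t1' : (1 < t)%R by lra.
have t0 : (0 < t)%R by lra.
have tm0 : (0 < t - 1)%R by lra.
pose s := (t / (t - 1))%R.
have s0 : (0 < s)%R by rewrite divr_gt0.
have sV : (s^-1 = (t - 1) / t)%R by rewrite invf_div.
have st : (s^-1 + t^-1 = 1)%R by rewrite sV; field; rewrite gt_eqF.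
have mp (f : X -> \bar R) r : measurable_fun setT f -> measurable_fun setT (fun x => f x `^ r).
  by move=> mf; exact: (measurableT_comp (measurable_poweR _)).
have iV r : (0 < r)%R -> (0 < r^-1)%R by rewrite invr_gt0.
have intE : \int[nu]_x (W x * F x) = \int[nu]_x (W x `^ s^-1 * (W x `^ t^-1 * F x)).
  apply: eq_integral => x _; rewrite muleA -poweRD_gt0 ?iV//; last exact/ltW/iV.
  by rewrite st poweRe1.
rewrite intE; have := @hoelder_ereal _ _ _ nu (fun x => W x `^ s^-1)
  (fun x => W x `^ t^-1 * F x) s t.
move=> /(_ (mp _ _ mW) (emeasurable_funM (mp _ _ mW) mF)).
move=> /(_ (fun x => poweR_ge0 _ _)).
move=> /(_ (fun x => mule_ge0 (poweR_ge0 _ _) (F0 x)) s0 t0 st).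
have -> : \int[nu]_x (W x `^ s^-1) `^ s = \int[nu]_x W x.
  by apply: eq_integral => x _; rewrite poweRK// gt_eqF.
have -> : \int[nu]_x (W x `^ t^-1 * F x) `^ t = \int[nu]_x (W x * F x `^ t).
  by apply: eq_integral => x _; rewrite poweRM ?poweR_ge0// poweRK// gt_eqF.
move=> h; apply: (le_trans (le_poweR (ltW t0) _ h)).
  by apply: integral_ge0 => x _; rewrite !mule_ge0 ?poweR_ge0.
rewrite poweRM ?poweR_ge0// poweRK ?gt_eqF//; last first.
  by apply: integral_ge0 => x _; rewrite mule_ge0 ?poweR_ge0.
by rewrite -poweRrM sV divfK// gt_eqF.
Qed.

(** The convex case with exponent 1/r, applied to F^r. *)
Lemma jensen_concave (W F : X -> \bar R) (r : R) : (0 < r)%R -> (r <= 1)%R ->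
  measurable_fun setT W -> (forall x, 0 <= W x) ->
  measurable_fun setT F -> (forall x, 0 <= F x) -> \int[nu]_x W x <= 1 ->
  \int[nu]_x (W x * F x `^ r) <= (\int[nu]_x (W x * F x)) `^ r.
Proof.
move=> r0 r1 mW W0 mF F0 W1.
have rV1 : (1 <= r^-1)%R by rewrite invf_ge1.
have mp : measurable_fun setT (fun x => F x `^ r).
  exact: (measurableT_comp (measurable_poweR _)).
have I0 : 0 <= \int[nu]_x (W x * F x `^ r).
  by apply: integral_ge0 => x _; rewrite mule_ge0 ?poweR_ge0.
have := @jensen_power W (fun x => F x `^ r) r^-1 rV1 mW W0 mp (fun x => poweR_ge0 _ _).
have -> : \int[nu]_x (W x * (F x `^ r) `^ r^-1) = \int[nu]_x (W x * F x).
  by apply: eq_integral => x _; rewrite -poweRrM mulfV ?gt_eqF// poweRe1.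
move=> h; rewrite -[leLHS](@poweRK _ _ r) ?gt_eqF//.
apply: le_poweR; [exact: ltW|exact: poweR_ge0|].
apply: (le_trans h); rewrite -[leRHS]mul1e lee_wpmul2r//.
  by apply: integral_ge0 => x _; rewrite mule_ge0.
rewrite -(@poweR1r _ (r^-1 - 1)%R) le_poweR ?subr_ge0//.
by apply: integral_ge0.
Qed.

End jensen.

(** * Energies against potentials *)

Section energy.
Context d (X : measurableType d) (R : realType).
Variables (sigma mu : {sigma_finite_measure set X -> \bar R}).
Variables (Q N : nat -> X -> set X) (Th : R).
Hypothesis CS : cube_system sigma Q N Th.
Variables (al : nat -> X -> \bar R) (A t : R).
Hypothesis mal : forall i, measurable_fun setT (al i).
Hypothesis al0 : forall i x, 0 <= al i x.
Hypothesis al_cmp : forall i x y, N i x y -> al i y <= A%:E * al i x.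
Hypothesis A0 : (0 <= A)%R.
Hypothesis t1 : (1 < t)%R.
Implicit Types (P : nat -> X -> set X) (g G h : X -> \bar R).

Definition energy P g := \sum_(i <oo) \int[sigma]_x (al i x * (\int[mu]_(y in P i x) g y) `^ t).

Definition pot P z := \sum_(i <oo) (al i z * sigma (Q i z) * mu (P i z) `^ (t - 1)).

Let t0 : (0 < t)%R. Proof. exact: lt_trans t1. Qed.
Let tm1 : (0 < t - 1)%R. Proof. by rewrite subr_gt0. Qed.

Let mp (f : X -> \bar R) r : measurable_fun setT f -> measurable_fun setT (fun x => f x `^ r).
Proof. by move=> mf; exact: (measurableT_comp (measurable_poweR _)). Qed.

Let mI i g : measurable_fun setT g -> (forall x, 0 <= g x) ->
  measurable_fun setT (fun x => \int[mu]_(y in Q i x) g y).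
Proof. by move=> *; apply: measurable_int_rel => //; exact: (cube_measurable CS). Qed.

Let mIN i g : measurable_fun setT g -> (forall x, 0 <= g x) ->
  measurable_fun setT (fun x => \int[mu]_(y in N i x) g y).
Proof. by move=> *; apply: measurable_int_rel => //; exact: (nbhd_measurable CS). Qed.

Lemma pot_term_ge0 P i z : 0 <= al i z * sigma (Q i z) * mu (P i z) `^ (t - 1).
Proof. by rewrite !mule_ge0 ?poweR_ge0. Qed.

Lemma pot_ge0 P z : 0 <= pot P z.
Proof. by apply: nneseries_ge0 => i _ _; exact: pot_term_ge0. Qed.

Lemma measurable_pot_nbhd : measurable_fun setT (pot N).
Proof.
apply: ge0_emeasurable_sum => [i x _ _|i _]; first exact: pot_term_ge0.
apply: emeasurable_funM; last by apply: mp; exact: (measurable_mnbhd CS).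
by apply: emeasurable_funM => //; exact: (measurable_mcube CS).
Qed.

Lemma measurable_pot_cube : measurable_fun setT (pot Q).
Proof.
apply: ge0_emeasurable_sum => [i x _ _|i _]; first exact: pot_term_ge0.
apply: emeasurable_funM; last by apply: mp; exact: (measurable_mcube CS).
by apply: emeasurable_funM => //; exact: (measurable_mcube CS).
Qed.

(** One of the t factors of the integral of [g] is exchanged for integration in [mu]; the other t -
    1 are bounded by mu(Q) G. What remains is a term of the potential times G^t. *)
Lemma energy_cube_le g G : measurable_fun setT g -> (forall x, 0 <= g x) ->
  measurable_fun setT G -> (forall x, g x <= G x) ->
  (forall i z, \int[mu]_(y in Q i z) g y <= mu (Q i z) * G z) ->
  energy Q g <= A%:E * \int[mu]_z (pot Q z * G z `^ t).
Proof.
move=> mg g0 mG gG intG.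
have G0 x : 0 <= G x by exact: le_trans (gG x).
have Ig0 i x : 0 <= \int[mu]_(y in Q i x) g y by exact: integral_ge0.
have mpot := measurable_pot_cube.
rewrite -ge0_integralZl//=; last 2 first.
- by apply: emeasurable_funM => //; exact: mp.
- by move=> z _; rewrite mule_ge0 ?pot_ge0 ?poweR_ge0.
have mterm i : measurable_fun setT (fun z => al i z * sigma (Q i z) * mu (Q i z) `^ (t - 1)).
  apply: emeasurable_funM; last by apply: mp; exact: (measurable_mcube CS).
  by apply: emeasurable_funM => //; exact: (measurable_mcube CS).
have termG0 i z : 0 <= A%:E * (al i z * sigma (Q i z) * mu (Q i z) `^ (t - 1) * G z `^ t).
  by rewrite mule_ge0 ?lee_fin// mule_ge0 ?poweR_ge0// pot_term_ge0.
have -> : \int[mu]_z (A%:E * (pot Q z * G z `^ t)) = \sum_(i <oo)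
   \int[mu]_z (A%:E * (al i z * sigma (Q i z) * mu (Q i z) `^ (t - 1) * G z `^ t)).
  rewrite -integral_nneseries//; last first.
    move=> i; apply: emeasurable_funM => //; apply: emeasurable_funM => //; exact: mp.
  apply: eq_integral => z _; rewrite ge0_nneseriesZl ?lee_fin//; last first.
    by move=> i; rewrite mule_ge0 ?poweR_ge0// pot_term_ge0.
  by rewrite ge0_nneseriesZr ?poweR_ge0// => i; exact: pot_term_ge0.
apply: lee_nneseries => [i _ _|i _].
  by apply: integral_ge0 => x _; rewrite mule_ge0 ?poweR_ge0.
have -> : \int[sigma]_x (al i x * (\int[mu]_(y in Q i x) g y) `^ t) =
  \int[sigma]_x (al i x * (\int[mu]_(y in Q i x) g y) `^ (t - 1) * \int[mu]_(y in Q i x) g y).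
  apply: eq_integral => x _; rewrite -muleA [_ `^ _ * _]muleC mule_poweRB1//.
  exact: ltW.
rewrite (int_cube_swap CS)//; last 2 first.
- by apply: emeasurable_funM => //; apply: mp; exact: mI.
- by move=> x; rewrite mule_ge0 ?poweR_ge0.
apply: le_int => z.
  by rewrite mule_ge0// integral_ge0// => x _; rewrite mule_ge0 ?poweR_ge0.
have inner : \int[sigma]_(x in Q i z) (al i x * (\int[mu]_(y in Q i x) g y) `^ (t - 1)) <=
    A%:E * al i z * (mu (Q i z) * G z) `^ (t - 1) * sigma (Q i z).
  rewrite -integral_cst; last exact: (measurable_cube CS).
  apply: ge0_le_int => //.
  - by move=> x; rewrite mule_ge0 ?poweR_ge0.
  - by move=> x; rewrite !mule_ge0 ?poweR_ge0.
  - move=> x zx /=; apply: lee_pmul; rewrite ?poweR_ge0//.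
      exact: (al_cmp (nbhd_sub CS zx)).
    by rewrite -(cube_eq CS zx) le_poweR// ltW.
apply: (@le_trans _ _ (G z * (A%:E * al i z * (mu (Q i z) * G z) `^ (t - 1) * sigma (Q i z)))).
  apply: lee_pmul => //.
  by apply: integral_ge0 => x _; rewrite mule_ge0 ?poweR_ge0.
rewrite poweRM// -(mule_poweRB1 (G0 z) (ltW t1)).
by rewrite [leLHS](AC (1*((2*2)*1)) (2*((3*6*4)*(1*5))))%AC.
Qed.

(** The power comes from Jensen's inequality with weight of mass at most Th^2, then [A] from the
    variation of [al] on a neighbourhood and [Th] from the mass of [N i y]. *)
Definition nbhd_cst : R := ((Th ^+ 2) `^ (t - 1) * (A * Th))%R.

Lemma nbhd_cst_ge0 : (0 <= nbhd_cst)%R.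
Proof.
have T0 : (0 <= Th)%R by apply: le_trans (doubling_ge1 CS).
by rewrite mulr_ge0 ?powR_ge0// mulr_ge0.
Qed.

Lemma int_nbhd_average i g x : measurable_fun setT g -> (forall x, 0 <= g x) ->
  \int[mu]_(z in N i x) g z <=
  \int[sigma]_y ((\1_(N i x) y)%:E * wt sigma Q i y * \int[mu]_(z in Q i y) g z).
Proof.
move=> mg g0.
have mN := measurable_nbhd CS i x.
have mW : measurable_fun setT (fun y => (\1_(N i x) y)%:E * wt sigma Q i y).
  by apply: emeasurable_funM; [exact: measurable_EFin_indic|exact: (measurable_wt CS)].
have W0 y : 0 <= (\1_(N i x) y)%:E * wt sigma Q i y by rewrite mule_ge0 ?wt_ge0 ?lee_fin.
rewrite (int_cube_swap CS)// [leLHS]integral_in_indic.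
apply: le_int => z; first by rewrite mule_ge0// lee_fin.
rewrite lee_wpmul2l// indicE.
case: (boolP (z \in N i x)) => [/set_mem xz|_]; last by apply: integral_ge0.
rewrite -(int_cube_wt CS i z); apply: ge0_le_int => //.
  by move=> y; exact: wt_ge0.
move=> y zy; rewrite indicE mem_set ?mul1e//.
exact: (cube_sub_nbhd CS xz).
Qed.

(** A neighbourhood consists of boundedly many cubes: Jensen's inequality moves the power onto each
    of them, and an exchange of integrals gives each cube the total weight of its neighbours. *)
Lemma energy_nbhd_le g : measurable_fun setT g -> (forall x, 0 <= g x) ->
  energy N g <= nbhd_cst%:E * energy Q g.
Proof.
move=> mg g0.
have T0 : (0 <= Th)%R by apply: le_trans (doubling_ge1 CS).
have Ig0 i x : 0 <= \int[mu]_(y in Q i x) g y by exact: integral_ge0.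
rewrite /energy -nneseriesZl; last first.
  by move=> i _; apply: integral_ge0 => x _; rewrite mule_ge0 ?poweR_ge0.
apply: lee_nneseries => [i _ _|i _].
  by apply: integral_ge0 => x _; rewrite mule_ge0 ?poweR_ge0.
have mw := measurable_wt CS i.
have mIt : measurable_fun setT (fun y => wt sigma Q i y * (\int[mu]_(z in Q i y) g z) `^ t).
  by apply: emeasurable_funM => //; apply: mp; exact: mI.
have It0 y : 0 <= wt sigma Q i y * (\int[mu]_(z in Q i y) g z) `^ t.
  by rewrite mule_ge0 ?wt_ge0 ?poweR_ge0.
have pw0 : 0 <= ((Th ^+ 2) `^ (t - 1))%:E :> \bar R by rewrite lee_fin powR_ge0.
have step x : (\int[mu]_(y in N i x) g y) `^ t <= ((Th ^+ 2) `^ (t - 1))%:E *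
    \int[sigma]_(y in N i x) (wt sigma Q i y * (\int[mu]_(z in Q i y) g z) `^ t).
  have mN := measurable_nbhd CS i x.
  have mW : measurable_fun setT (fun y => (\1_(N i x) y)%:E * wt sigma Q i y).
    by apply: emeasurable_funM => //; exact: measurable_EFin_indic.
  have W0 y : 0 <= (\1_(N i x) y)%:E * wt sigma Q i y by rewrite mule_ge0 ?wt_ge0 ?lee_fin.
  apply: (le_trans (le_poweR (ltW t0) _ (int_nbhd_average i x mg g0))).
    exact: integral_ge0.
  have := @jensen_power _ _ _ sigma _ (fun y => \int[mu]_(z in Q i y) g z)
    t (ltW t1) mW W0 (mI i mg g0) (Ig0 i).
  move=> h; apply: (le_trans h); apply: lee_pmul.
  - exact: poweR_ge0.
  - by apply: integral_ge0 => y _; rewrite mule_ge0 ?poweR_ge0.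
  - rewrite -poweR_EFin; apply: le_poweR; first exact: ltW.
      by apply: integral_ge0 => y _.
    apply: le_trans (int_nbhd_wt CS i x); rewrite [leRHS]integral_in_indic.
    by apply: le_int => // y; rewrite muleC.
  - rewrite [leRHS]integral_in_indic; apply: le_int => y.
      by rewrite mule_ge0 ?poweR_ge0.
    by rewrite -muleA muleC.
apply: (@le_trans _ _ (((Th ^+ 2) `^ (t - 1))%:E * \int[sigma]_x (al i x *
    \int[sigma]_(y in N i x) (wt sigma Q i y * (\int[mu]_(z in Q i y) g z) `^ t)))).
  rewrite -ge0_integralZl//=; last 2 first.
  - apply: emeasurable_funM => //; apply: measurable_int_rel => //.
    exact: (nbhd_measurable CS).
  - by move=> x _; rewrite mule_ge0// integral_ge0.
  apply: le_int => x; first by rewrite mule_ge0 ?poweR_ge0.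
  by rewrite muleCA lee_wpmul2l.
rewrite (int_nbhd_swap CS)// EFinM -muleA; apply: lee_wpmul2l => //.
rewrite -ge0_integralZl//=; last 3 first.
- by apply: emeasurable_funM => //; apply: mp; exact: mI.
- by move=> x _; rewrite mule_ge0 ?poweR_ge0.
- by rewrite lee_fin mulr_ge0.
apply: le_int => y; first by rewrite mule_ge0// integral_ge0.
have inner : \int[sigma]_(x in N i y) al i x <= A%:E * al i y * (Th%:E * sigma (Q i y)).
  apply: (@le_trans _ _ (A%:E * al i y * sigma (N i y))).
    rewrite -integral_cst; last exact: (measurable_nbhd CS).
    apply: ge0_le_int => //; first by move=> x; rewrite mule_ge0 ?lee_fin.
    by move=> x yx /=; exact: al_cmp.
  by rewrite lee_wpmul2l ?mule_ge0 ?lee_fin//; exact: (nbhd_doubling CS).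
apply: (le_trans (lee_wpmul2l (It0 y) inner)).
rewrite [leLHS](AC (2*(2*2)) ((3*5)*(4*2)*(6*1)))%AC /= (wtK CS) mule1 EFinM.
by [].
Qed.

(* [G] dominates the averages of [h] over [Q i x], taken relative to [N i x], on all of [N i x]. *)
Lemma pot_nbhd_le h G : measurable_fun setT h -> (forall x, 0 <= h x) ->
  measurable_fun setT G -> (forall x, 0 <= G x) ->
  (forall i x, mu (N i x) < +oo) ->
  (forall i x y, N i x y -> nbhd_avg mu Q N h i x <= G y) ->
  \int[mu]_z (h z * pot N z) <= A%:E * energy N (fun y => G y `^ t^-1).
Proof.
move=> mh h0 mG G0 muN avgG.
have mNn i x := measurable_nbhd CS i x.
have mterm i : measurable_fun setT (fun z => al i z * sigma (Q i z) * mu (N i z) `^ (t - 1)).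
  apply: emeasurable_funM; last by apply: mp; exact: (measurable_mnbhd CS).
  by apply: emeasurable_funM => //; exact: (measurable_mcube CS).
have -> : \int[mu]_z (h z * pot N z) = \sum_(i <oo)
   \int[mu]_z (h z * (al i z * sigma (Q i z) * mu (N i z) `^ (t - 1))).
  rewrite -integral_nneseries//; last 2 first.
  - by move=> i; exact: emeasurable_funM.
  - by move=> i x _; rewrite mule_ge0// pot_term_ge0.
  apply: eq_integral => z _; rewrite ge0_nneseriesZl ?lee_fin// => i.
  exact: pot_term_ge0.
have mGt : measurable_fun setT (fun y => G y `^ t^-1) by exact: mp.
have In0 i x : 0 <= \int[mu]_(y in N i x) G y `^ t^-1.
  by apply: integral_ge0 => y _; exact: poweR_ge0.
rewrite /energy -nneseriesZl; last first.
  by move=> i _; apply: integral_ge0 => x _; rewrite mule_ge0 ?poweR_ge0.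
apply: lee_nneseries => [i _ _|i _].
  by apply: integral_ge0 => x _; rewrite mule_ge0// pot_term_ge0.
pose F i x := al i x * mu (N i x) `^ (t - 1).
have F0 j x : 0 <= F j x by rewrite mule_ge0 ?poweR_ge0.
have mF j : measurable_fun setT (F j).
  by apply: emeasurable_funM => //; apply: mp; exact: (measurable_mnbhd CS).
apply: (@le_trans _ _ (A%:E * \int[sigma]_x (F i x * \int[mu]_(y in Q i x) h y))); last first.
  apply: lee_wpmul2l; first by rewrite lee_fin.
  apply: le_int => x; first by rewrite mule_ge0// integral_ge0.
  rewrite /F -muleA lee_wpmul2l//.
  have [mu0|mun0] := eqVneq (mu (N i x)) 0.
    by rewrite mu0 poweR0r ?gt_eqF// mul0e poweR_ge0.
  have mufin : mu (N i x) \is a fin_num by rewrite ge0_fin_numE.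
  have avg0 : 0 <= nbhd_avg mu Q N h i x by exact: nbhd_avg_ge0.
  have intE : \int[mu]_(y in Q i x) h y = mu (N i x) * nbhd_avg mu Q N h i x.
    by rewrite /nbhd_avg muleA divee// mul1e.
  rewrite intE.
  (* In this form the average sits inside as its t-th root, which is dominated on all of [N i x] by
     that of [G]. *)
  have -> : mu (N i x) `^ (t - 1) * (mu (N i x) * nbhd_avg mu Q N h i x) =
      (mu (N i x) * nbhd_avg mu Q N h i x `^ t^-1) `^ t.
    rewrite muleA [_ `^ _ * _]muleC (mule_poweRB1 (measure_ge0 _ _) (ltW t1)).
    by rewrite poweRM ?poweR_ge0// poweRK ?gt_eqF.
  apply: le_poweR; first exact: ltW.
    by rewrite mule_ge0 ?poweR_ge0.
  rewrite muleC -integral_cst//; apply: ge0_le_int => //.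
  - by move=> y; exact: poweR_ge0.
  - by move=> y; exact: poweR_ge0.
  - move=> y xy /=; apply: le_poweR => //; last exact: avgG xy.
    by rewrite invr_ge0 ltW.
rewrite (int_cube_swap CS)//.
rewrite -ge0_integralZl//=; last 2 first.
- apply: emeasurable_funM => //; apply: measurable_int_rel => //.
  exact: (cube_measurable CS).
- by move=> x _; rewrite mule_ge0// integral_ge0.
apply: le_int => z; first by rewrite mule_ge0// pot_term_ge0.
rewrite [leRHS]muleCA lee_wpmul2l//.
have le1 x : Q i z x -> al i z <= A%:E * al i x.
  by move=> zx; apply: al_cmp; apply: (nbhd_sym CS); exact: (nbhd_sub CS).
rewrite -ge0_integralZl//=; last 2 first.
- exact: (measurable_cube CS).
- by apply: measurable_funTS.
apply: (@le_trans _ _ (\int[sigma]_(x in Q i z) (cst (al i z * mu (N i z) `^ (t - 1)) x))).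
  rewrite integral_cst; last exact: (measurable_cube CS).
  by rewrite muleAC.
apply: ge0_le_int => //.
- by move=> x; rewrite /= mule_ge0 ?poweR_ge0.
- by move=> x; rewrite mule_ge0 ?lee_fin.
- move=> x zx; rewrite /F muleA /= -(nbhd_eq CS zx) lee_wpmul2r ?poweR_ge0//.
  exact: le1.
Qed.

End energy.

Section triangular_sums.
Context {R : realType}.

Lemma sum_triangle (a c : nat -> \bar R) M : (forall i, 0 <= a i) ->
  (forall i, 0 <= c i) ->
  \sum_(j < M) (a j * \sum_(i < j.+1) c i) =
  \sum_(i < M) (c i * \sum_(i <= l < M) a l).
Proof.
move=> a0 c0; elim: M => [|M IH]; first by rewrite !big_ord0.
rewrite big_ord_recr/= IH [RHS]big_ord_recr/= big_nat1.
rewrite [in RHS](eq_bigr (fun i : 'I_M => c i * \sum_(i <= l < M) a l + c i * a M)).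
  rewrite big_split/= -addeA; congr (_ + _).
  rewrite big_ord_recr/= ge0_muleDr ?sume_ge0//; congr (_ + _); last exact: muleC.
  by rewrite ge0_sume_distrr//; apply: eq_bigr => i _; rewrite muleC.
by move=> i _; rewrite big_nat_recr ?ge0_muleDr ?sume_ge0//= ltnW.
Qed.

(** Either y <= e x, or x is below y/e. The small factor [e] falls on the term that is absorbed
    later. *)
Lemma mule_poweR_split (x y : \bar R) (e t : R) : 0 <= x -> 0 <= y ->
  (0 < e)%R -> (2 < t)%R ->
  x `^ (t - 2) * y <= e%:E * x `^ (t - 1) + ((e^-1) `^ (t - 2))%:E * y `^ (t - 1).
Proof.
move=> x0 y0 e0 t2.
have ei0 : (0 < e^-1)%R by rewrite invr_gt0.
have p1 : 0 <= e%:E * x `^ (t - 1) by rewrite mule_ge0 ?poweR_ge0// lee_fin ltW.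
have p2 : 0 <= ((e^-1) `^ (t - 2))%:E * y `^ (t - 1).
  by rewrite mule_ge0 ?poweR_ge0// lee_fin powR_ge0.
have sp (z : \bar R) : 0 <= z -> z * z `^ (t - 2) = z `^ (t - 1).
  move=> z0; rewrite -(mule_poweRB1 z0 (_ : (1 <= t - 1)%R)); last lra.
  by congr (_ * _ `^ _); ring.
have [yx|xy] := leP y (e%:E * x).
  apply: (@le_trans _ _ (e%:E * x `^ (t - 1))); last by rewrite leeDl.
  rewrite -sp// muleA muleC lee_wpmul2r ?poweR_ge0//.
apply: (@le_trans _ _ (((e^-1) `^ (t - 2))%:E * y `^ (t - 1))); last by rewrite leeDr.
rewrite -sp// muleCA muleC lee_wpmul2l//.
rewrite -poweR_EFin -poweRM ?lee_fin ?(ltW ei0)//.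
apply: le_poweR => //; first lra.
by rewrite muleC lee_pdivlMr// muleC ltW.
Qed.

End triangular_sums.

(** * The L^t norm of the dyadic operator is bounded by the energy *)

Section wolff_potential.
Context d (X : measurableType d) (R : realType).
Variables (sigma mu : {sigma_finite_measure set X -> \bar R}).
Variables (Q N : nat -> X -> set X) (Th : R).
Hypothesis CS : cube_system sigma Q N Th.
Variables (k : nat -> R) (A t : R).
Hypothesis k0 : forall i, (0 <= k i)%R.
Hypothesis A0 : (0 <= A)%R.
Hypothesis t1 : (1 < t)%R.

(* [tailsum], [kap] and [wolff_coef] stand for [\int_0^r k(s) sigma(B(x,s)) ds/s], for [kbar(r)(x)] and for [k(r) kbar(r)(x)^(t-1)], with [r] of the order of the side of [Q i x]. *)
Definition tailsum i x := \sum_(l <oo | (i <= l)%N) ((k l)%:E * sigma (Q l x)).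

Definition kap i x := wt sigma Q i x * tailsum i x.

Definition wolff_coef i x := (k i)%:E * kap i x `^ (t - 1).

Hypothesis kap_cmp : forall i x y, N i x y -> kap i y <= A%:E * kap i x.

Let t0 : (0 < t)%R. Proof. exact: lt_trans t1. Qed.
Let tm1 : (0 < t - 1)%R. Proof. by rewrite subr_gt0. Qed.

Let mp (f : X -> \bar R) r : measurable_fun setT f -> measurable_fun setT (fun x => f x `^ r).
Proof. by move=> mf; exact: (measurableT_comp (measurable_poweR _)). Qed.

Let kE0 i : 0 <= (k i)%:E. Proof. by rewrite lee_fin. Qed.

Lemma tailsum_term_ge0 l x : 0 <= (k l)%:E * sigma (Q l x).
Proof. by rewrite mule_ge0. Qed.

Lemma tailsum_ge0 i x : 0 <= tailsum i x.
Proof. by apply: nneseries_ge0 => l _ _; exact: tailsum_term_ge0. Qed.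

Lemma kap_ge0 i x : 0 <= kap i x.
Proof. by rewrite mule_ge0 ?wt_ge0 ?tailsum_ge0. Qed.

Lemma wolff_coef_ge0 i x : 0 <= wolff_coef i x.
Proof. by rewrite mule_ge0 ?poweR_ge0. Qed.

Lemma tailsumE i x : tailsum i x = sigma (Q i x) * kap i x.
Proof. by rewrite /kap muleA (wtK CS) mul1e. Qed.

Lemma measurable_tailsum i : measurable_fun setT (tailsum i).
Proof.
apply: ge0_emeasurable_sum => [l x _ _|l _]; first exact: tailsum_term_ge0.
by apply: emeasurable_funM => //; exact: (measurable_mcube CS).
Qed.

Lemma measurable_kap i : measurable_fun setT (kap i).
Proof. by apply: emeasurable_funM; [exact: (measurable_wt CS)|exact: measurable_tailsum]. Qed.

Lemma measurable_wolff_coef i : measurable_fun setT (wolff_coef i).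
Proof. by apply: emeasurable_funM => //; apply: mp; exact: measurable_kap. Qed.

Lemma wolff_coef_cmp i x y : N i x y -> wolff_coef i y <= (A `^ (t - 1))%:E * wolff_coef i x.
Proof.
move=> xy; rewrite /wolff_coef muleCA lee_wpmul2l// -poweR_EFin -poweRM ?lee_fin ?kap_ge0//.
by apply: le_poweR; [exact: ltW|exact: kap_ge0|exact: kap_cmp].
Qed.

(** Conditional expectation: [U] is constant on the cubes of generation [i], so [F] may be replaced
    by its averages over them. *)
Lemma int_saturated i (U F : X -> \bar R) : measurable_fun setT U ->
  (forall x, 0 <= U x) -> (forall x y, Q i x y -> U y = U x) ->
  measurable_fun setT F -> (forall x, 0 <= F x) ->
  \int[sigma]_x (U x * F x) =
  \int[sigma]_x (U x * (wt sigma Q i x * \int[sigma]_(y in Q i x) F y)).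
Proof.
move=> mU U0 satU mF F0.
rewrite (int_average CS i); last 2 first.
- exact: emeasurable_funM.
- by move=> x; rewrite mule_ge0.
apply: eq_integral => x _; rewrite muleCA; congr (_ * _).
have mQ := measurable_cube CS i x.
rewrite -ge0_integralZl//; last exact: measurable_funTS.
by apply: eq_integral => y /set_mem xy; rewrite (satU x y).
Qed.

Section fixed_density.
Variable g : X -> \bar R.
Hypothesis mg : measurable_fun setT g.
Hypothesis g0 : forall x, 0 <= g x.

Let J i x := \int[mu]_(y in N i x) g y.
Let a i x := (k i)%:E * J i x.

Let J0 i x : 0 <= J i x. Proof. exact: integral_ge0. Qed.
Let a0 i x : 0 <= a i x. Proof. by rewrite mule_ge0. Qed.
Let mJ i : measurable_fun setT (J i).
Proof. by apply: measurable_int_rel => //; exact: (nbhd_measurable CS). Qed.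
Let ma i : measurable_fun setT (a i).
Proof. exact: emeasurable_funM. Qed.
Let satJ i l x y : (l <= i)%N -> Q i x y -> J l y = J l x.
Proof. by move=> li xy; rewrite /J (nbhd_eq CS (cube_nestn CS li xy)). Qed.

(** The estimate that creates [kap]. After exchanging the integrals, a point z of [N i x] receives
    k_l sigma(N l z) from each l >= i, in total at most Th times its tail sum, and this is
    comparable with sigma(Q i x) kap_i(x). The second [Th] compares the masses of [Q i z] and
    [Q i x]. *)
Lemma avg_suffix_le i M x :
  wt sigma Q i x * \int[sigma]_(y in Q i x) \sum_(i <= l < M) a l y <=
  (Th ^+ 2 * A)%:E * (kap i x * J i x).
Proof.
have T0 : (0 <= Th)%R by apply: le_trans (doubling_ge1 CS).
have mQ := measurable_cube CS i x.
have mN := measurable_nbhd CS i x.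
rewrite ge0_integral_sum//; last first.
  by move=> l; exact: measurable_funTS.
have step l : (i <= l)%N -> \int[sigma]_(y in Q i x) a l y <=
    \int[mu]_(z in N i x) (g z * (Th%:E * ((k l)%:E * sigma (Q l z)))).
  move=> il.
  have m1 : measurable_fun setT (fun y => (\1_(Q i x) y)%:E : \bar R).
    exact: measurable_EFin_indic.
  rewrite ge0_integralZl//; last exact: measurable_funTS.
  rewrite (_ : \int[sigma]_(y in Q i x) J l y =
    \int[sigma]_y ((\1_(Q i x) y)%:E * \int[mu]_(z in N l y) g z)); last first.
    by rewrite integral_in_indic; apply: eq_integral => y _; rewrite muleC.
  rewrite (int_nbhd_swap CS)//.
  rewrite -ge0_integralZl//=; last 2 first.
  - apply: emeasurable_funM => //; apply: measurable_int_rel => //.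
    exact: (nbhd_measurable CS).
  - by move=> z _; rewrite mule_ge0// integral_ge0.
  rewrite [leRHS]integral_in_indic; apply: le_int => z.
    by apply: mule_ge0 => //; apply: mule_ge0 => //; apply: integral_ge0 => y _; rewrite lee_fin.
  rewrite muleCA -[leRHS]muleA lee_wpmul2l// indicE.
  case: (boolP (z \in N i x)) => [/set_mem xz|/negP nxz].
    rewrite mule1 muleCA lee_wpmul2l//.
    apply: le_trans (nbhd_doubling CS l z).
    rewrite -[leRHS]mul1e -integral_cst; last exact: (measurable_nbhd CS).
    by apply: ge0_le_int => // y _; rewrite /= lee_fin indicE; case: (_ \in _).
  (* No y of [Q i x] is near such a z at generation [l]: it would be near z at the coarser
     generation [i] too, which puts z in [N i x]. *)
  rewrite mule0 (_ : \int[sigma]_(y in N l z) _ = 0) ?mule0//.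
  apply: integral0_eq => y zy; rewrite indicE memNset// => xy; apply: nxz.
  apply/mem_set; apply: (nbhd_cube CS xy); apply: (nbhd_sym CS).
  exact: (nbhd_nestn CS il zy).
have stepsum : \sum_(i <= l < M) \int[sigma]_(y in Q i x) a l y <=
    \int[mu]_(z in N i x) (g z * (Th%:E * tailsum i z)).
  apply: (@le_trans _ _ (\sum_(i <= l < M)
      \int[mu]_(z in N i x) (g z * (Th%:E * ((k l)%:E * sigma (Q l z)))))).
    rewrite big_nat_cond [leRHS]big_nat_cond; apply: lee_sum => l /andP[/andP[il _] _].
    exact: step.
  rewrite -ge0_integral_sum//; last 2 first.
  - move=> l; apply: measurable_funTS; apply: emeasurable_funM => //.
    apply: emeasurable_funM => //; apply: emeasurable_funM => //.
    exact: (measurable_mcube CS).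
  - by move=> l z _; rewrite !mule_ge0.
  apply: ge0_le_int => //.
  - by move=> z; apply: sume_ge0 => l _; rewrite !mule_ge0.
  - by move=> z; rewrite !mule_ge0// tailsum_ge0.
  move=> z _; rewrite -ge0_sume_distrr; last by move=> l _; rewrite !mule_ge0.
  rewrite lee_wpmul2l// -ge0_sume_distrr; last by move=> l _; rewrite mule_ge0.
  rewrite lee_wpmul2l//.
  rewrite (@big_nat_widenl _ _ _ _ 0%N)// /tailsum.
  exact: (@nneseries_lim_ge _ (fun l => (k l)%:E * sigma (Q l z)) (fun l => (i <= l)%N) 0%N M
    (fun n _ _ => tailsum_term_ge0 n z)).
apply: (le_trans (lee_wpmul2l (wt_ge0 _ _ i x) stepsum)).
have tail_le z : N i x z ->
    tailsum i z <= Th%:E * sigma (Q i x) * (A%:E * kap i x).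
  move=> xz; rewrite tailsumE; apply: lee_pmul; rewrite ?kap_ge0//; last exact: kap_cmp.
  apply: le_trans (nbhd_doubling CS i x); apply: le_measure; rewrite ?inE//.
    exact: (measurable_cube CS).
  by move=> y; exact: (cube_sub_nbhd CS xz).
have K0 : 0 <= Th%:E * (Th%:E * sigma (Q i x) * (A%:E * kap i x)).
  apply: mule_ge0 => //; apply: mule_ge0; first exact: mule_ge0.
  by apply: mule_ge0 => //; exact: kap_ge0.
apply: (@le_trans _ _ (wt sigma Q i x * \int[mu]_(z in N i x)
    (g z * (Th%:E * (Th%:E * sigma (Q i x) * (A%:E * kap i x)))))).
  rewrite lee_wpmul2l ?wt_ge0//; apply: ge0_le_int => //.
  - by move=> z; rewrite !mule_ge0// tailsum_ge0.
  - by move=> z; exact: mule_ge0.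
  - by move=> z xz; rewrite lee_wpmul2l// lee_wpmul2l//; exact: tail_le.
rewrite ge0_integralZr//; last exact: measurable_funTS.
rewrite [leLHS](AC (1*(1*(1*(2*2)))) ((5*1)*((3*4*6)*(7*2))))%AC /=.
by rewrite (wtK CS) mul1e expr2 !EFinM.
Qed.

Let Lam M x := \sum_(i < M) a i x.
Let Lam0 M x : 0 <= Lam M x. Proof. exact: sume_ge0. Qed.

Let C1 := (Th ^+ 2 * A)%R.
Let C1_ge0 : (0 <= C1)%R.
Proof. by rewrite mulr_ge0// exprn_ge0//; apply: le_trans (doubling_ge1 CS). Qed.

Let mS i M : measurable_fun setT (fun x => \sum_(i <= l < M) a l x).
Proof. exact: emeasurable_sum. Qed.

Let S0 i M x : 0 <= \sum_(i <= l < M) a l x. Proof. exact: sume_ge0. Qed.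

Let kJ0 i x : 0 <= kap i x * J i x. Proof. by apply: mule_ge0; [exact: kap_ge0|]. Qed.

Let mkJ i : measurable_fun setT (fun x => kap i x * J i x).
Proof. by apply: emeasurable_funM => //; exact: measurable_kap. Qed.

Let energy_term i x : a i x * (kap i x * J i x) `^ (t - 1) = wolff_coef i x * J i x `^ t.
Proof.
rewrite poweRM ?kap_ge0// -(mule_poweRB1 (J0 i x) (ltW t1)) /wolff_coef /a.
by rewrite [LHS](AC (2*2) ((1*3)*(2*4)))%AC.
Qed.

(* For [t <= 2] the power [t - 1] is concave, so Jensen's inequality applies to the tail of the sum on each cube. *)
Lemma wolff_upper_le2 M : (t <= 2)%R ->
  \int[sigma]_x Lam M x `^ t <= (t * C1 `^ (t - 1))%:E * energy sigma mu wolff_coef t N g.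
Proof.
move=> t2.
have mLS i : measurable_fun setT (fun x => a i x * (\sum_(i <= l < M) a l x) `^ (t - 1)).
  by apply: emeasurable_funM => //; exact: mp.
apply: (@le_trans _ _ (\int[sigma]_x (t%:E *
    \sum_(i < M) (a i x * (\sum_(i <= l < M) a l x) `^ (t - 1))))).
  apply: le_int => x; first exact: poweR_ge0.
  by apply: sum_poweR_le_suffix => //; exact: ltW.
rewrite ge0_integralZl//=; last 3 first.
- exact: emeasurable_sum.
- by move=> x _; apply: sume_ge0 => i _; rewrite mule_ge0 ?poweR_ge0.
- by rewrite lee_fin ltW.
rewrite EFinM -muleA; apply: lee_wpmul2l; first by rewrite lee_fin ltW.
rewrite ge0_integral_sum//; last by move=> i x _; rewrite mule_ge0 ?poweR_ge0.
apply: (@le_trans _ _ (\sum_(i < M) ((C1 `^ (t - 1))%:E *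
    \int[sigma]_x (wolff_coef i x * J i x `^ t)))); last first.
  rewrite -ge0_sume_distrr; last first.
    by move=> i _; apply: integral_ge0 => x _; rewrite mule_ge0 ?wolff_coef_ge0 ?poweR_ge0.
  rewrite lee_wpmul2l ?lee_fin ?powR_ge0// -(big_mkord xpredT (fun i =>
     \int[sigma]_x (wolff_coef i x * J i x `^ t))).
  apply: nneseries_lim_ge => i _ _.
  by apply: integral_ge0 => x _; rewrite mule_ge0 ?wolff_coef_ge0 ?poweR_ge0.
apply: lee_sum => i _.
rewrite (@int_saturated i (a i))//; last 3 first.
- by move=> x y xy; rewrite /a (satJ (leqnn i) xy).
- exact: mp.
- by move=> x; exact: poweR_ge0.
rewrite -ge0_integralZl//=; last 3 first.
- by apply: emeasurable_funM; [exact: measurable_wolff_coef|exact: mp].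
- by move=> x _; rewrite mule_ge0 ?wolff_coef_ge0 ?poweR_ge0.
- by rewrite lee_fin powR_ge0.
have mw := measurable_wt CS i.
apply: le_int => x.
  rewrite mule_ge0// mule_ge0 ?wt_ge0// integral_ge0// => y _; exact: poweR_ge0.
rewrite -energy_term [leRHS]muleCA lee_wpmul2l//.
rewrite -poweR_EFin -poweRM ?lee_fin//.
apply: (@le_trans _ _ ((wt sigma Q i x * \int[sigma]_(y in Q i x)
   \sum_(i <= l < M) a l y) `^ (t - 1))); last first.
  apply: le_poweR; first exact: ltW.
    by rewrite mule_ge0 ?wt_ge0// integral_ge0.
  exact: avg_suffix_le.
have mQ := measurable_cube CS i x.
have pull (F : X -> \bar R) : measurable_fun setT F -> (forall y, 0 <= F y) ->
    wt sigma Q i x * \int[sigma]_(y in Q i x) F y =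
    \int[sigma]_y ((\1_(Q i x) y)%:E * wt sigma Q i y * F y).
  move=> mF F0; rewrite -ge0_integralZl ?wt_ge0//; last exact: measurable_funTS.
  rewrite integral_in_indic; apply: eq_integral => y _; rewrite indicE.
  case: (boolP (y \in Q i x)) => [/set_mem xy|_]; last by rewrite mule0 !mul0e.
  by rewrite mule1 mul1e (wt_eq CS xy).
rewrite !pull//; [|exact: mp|by move=> y; exact: poweR_ge0].
have mW : measurable_fun setT (fun y => (\1_(Q i x) y)%:E * wt sigma Q i y).
  by apply: emeasurable_funM => //; exact: measurable_EFin_indic.
apply: jensen_concave => //; first lra.
- by move=> y; rewrite mule_ge0 ?wt_ge0 ?lee_fin.
- rewrite -(int_cube_wt CS i x) [leRHS]integral_in_indic le_eqVlt; apply/orP; left.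
  by apply/eqP; apply: eq_integral => y _; rewrite muleC.
Qed.

(** In the second case, with K = t (t - 1) C1, the base 2 (K + 1) is the inverse of the small
    parameter of [mule_poweR_split], and the leading 2 comes from absorbing half of the left-hand
    side. *)
Definition wolff_cst : R :=
  if (t <= 2)%R then (t * C1 `^ (t - 1))%R
  else (2 * (t * (t - 1) * C1 * ((2 * (t * (t - 1) * C1 + 1)) `^ (t - 2))))%R.

(* For [t > 2] Young's inequality produces a multiple of the left-hand side, which is absorbed; the argument is run inside one cube of generation 0, where that integral is finite. *)
Lemma wolff_upper_gt2 M : (2 < t)%R -> (forall x, J 0%N x < +oo) ->
  \int[sigma]_x Lam M x `^ t <=
  (2 * (t * (t - 1) * C1 * ((2 * (t * (t - 1) * C1 + 1)) `^ (t - 2))))%:E *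
  energy sigma mu wolff_coef t N g.
Proof.
move=> t2 Jfin.
set K := (t * (t - 1) * C1)%R.
have K0 : (0 <= K)%R by apply: mulr_ge0; [rewrite mulr_ge0// ltW|exact: C1_ge0].
(* Chosen so that K e <= 1/2, with K + 1 in place of K to keep it positive. *)
pose e := ((2 * (K + 1))^-1)%R.
have K1 : (0 < 2 * (K + 1))%R by rewrite mulr_gt0// ltr_wpDl.
have e0 : (0 < e)%R by rewrite invr_gt0.
have eK : (K * e <= 2^-1)%R.
  rewrite /e invfM mulrCA ler_piMr// ler_pdivrMr ?mul1r ?lerDl// ltr_wpDl//.
pose Y x := \sum_(i < M) (wolff_coef i x * J i x `^ t).
have Yt0 i x : 0 <= wolff_coef i x * J i x `^ t by rewrite mule_ge0 ?wolff_coef_ge0 ?poweR_ge0.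
have Y0 x : 0 <= Y x by exact: sume_ge0.
have mYt i : measurable_fun setT (fun x => wolff_coef i x * J i x `^ t).
  by apply: emeasurable_funM; [exact: measurable_wolff_coef|exact: mp].
have mY : measurable_fun setT Y by exact: emeasurable_sum.
have mLam m : measurable_fun setT (Lam m) by exact: emeasurable_sum.
have mLt : measurable_fun setT (fun x => Lam M x `^ t) by exact: mp.
have pref_le i x : (i < M)%N -> Lam i.+1 x <= Lam M x.
  by move=> iM; apply: (@lee_sum_nneg_ord _ (a ^~ x) xpredT) => //.
have satL i x y : Q i x y -> Lam i.+1 y = Lam i.+1 x.
  move=> xy; apply: eq_bigr => l _; rewrite /a (@satJ i l x y)// -ltnS.
  exact: ltn_ord.
(* The prefix inequality is used twice, for the exponents t and t - 1. Exchanging the two sums then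
   leaves a tail, to which [avg_suffix_le] applies. *)
have point x : Lam M x `^ t <= (t * (t - 1))%:E *
    \sum_(i < M) (a i x * Lam i.+1 x `^ (t - 2) * \sum_(i <= l < M) a l x).
  apply: (le_trans (sum_poweR_le_prefix _ (a0 ^~ x) (ltW t1))).
  rewrite EFinM -muleA; apply: lee_wpmul2l; first by rewrite lee_fin ltW.
  have c0 i : 0 <= a i x * Lam i.+1 x `^ (t - 2) by rewrite mule_ge0 ?poweR_ge0.
  rewrite -[X in _ <= _ * X](@sum_triangle _ (fun l => a l x)
    (fun i => a i x * Lam i.+1 x `^ (t - 2)) M (a0 ^~ x) c0).
  rewrite ge0_sume_distrr; last first.
    by move=> i _; rewrite mule_ge0// sume_ge0// => l _; rewrite mule_ge0 ?poweR_ge0.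
  apply: lee_sum => j _; rewrite muleCA lee_wpmul2l//.
  have tt : (1 <= t - 1)%R by lra.
  have := sum_poweR_le_prefix j.+1 (a0 ^~ x) tt.
  by have -> : (t - 1 - 1 = t - 2)%R by ring.
have local x0 : \int[sigma]_(x in Q 0%N x0) Lam M x `^ t <=
    (2 * (K * (e^-1) `^ (t - 2)))%:E * \int[sigma]_(x in Q 0%N x0) Y x.
  set D := Q 0%N x0; have mD : measurable D by exact: (measurable_cube CS).
  set E := \int[sigma]_(x in D) Lam M x `^ t.
  have E0 : 0 <= E by apply: integral_ge0 => x _; exact: poweR_ge0.
  (* All neighbourhoods of points of [D] lie in the common generation-0 neighbourhood, where the
     integral of [g] is finite. *)
  have [c c0 Lc] : exists2 c : R, (0 <= c)%R & forall x, D x -> Lam M x <= c%:E.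
    exists (fine (\sum_(i < M) ((k i)%:E * J 0%N x0))).
      by apply: fine_ge0; apply: sume_ge0 => i _; rewrite mule_ge0.
    move=> x Dx; rewrite fineK; last first.
      rewrite ge0_fin_numE; last by apply: sume_ge0 => i _; rewrite mule_ge0.
      by apply: lte_sum_pinfty => i _; rewrite lte_mul_pinfty.
    apply: lee_sum => i _; rewrite lee_wpmul2l// -(satJ (leq0n 0%N) Dx).
    by apply: int_set_le => // z; exact: (nbhd_nestn CS (leq0n i)).
  have Efin : E < +oo.
    apply: (@le_lt_trans _ _ (\int[sigma]_(x in D) cst (c `^ t)%:E x)).
      apply: ge0_le_int => //.
      - by move=> x; exact: poweR_ge0.
      - by move=> x; rewrite lee_fin powR_ge0.
      - by move=> x Dx; rewrite /= -poweR_EFin; apply: le_poweR => //; [exact: ltW|exact: Lc].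
    rewrite integral_cst// lte_mul_pinfty ?lee_fin ?powR_ge0//.
    exact: (cube_lty CS).
  have ind0 x : 0 <= (\1_D x)%:E :> \bar R by rewrite lee_fin.
  have mind : measurable_fun setT (fun x => (\1_D x)%:E : \bar R).
    exact: measurable_EFin_indic.
  pose U i x := (\1_D x)%:E * (a i x * Lam i.+1 x `^ (t - 2)).
  have U0 i x : 0 <= U i x by rewrite !mule_ge0 ?poweR_ge0.
  have mU i : measurable_fun setT (U i).
    by apply: emeasurable_funM => //; apply: emeasurable_funM => //; exact: mp.
  have satU i x y : Q i x y -> U i y = U i x.
    move=> xy; rewrite /U /a (satJ (leqnn i) xy) (satL _ _ _ xy).
    congr (_ * _); rewrite !indicE; congr ((_ : bool)%:R%:E).
    have xy0 : Q 0%N x y by exact: (cube_nestn CS (leq0n i)).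
    apply/idP/idP => /set_mem h; apply/mem_set.
      exact: (cube_trans CS h (cube_sym CS xy0)).
    exact: (cube_trans CS h xy0).
  have step : E <= K%:E * \sum_(i < M) \int[sigma]_x (U i x * (kap i x * J i x)).
    apply: (@le_trans _ _ (\int[sigma]_x ((t * (t - 1))%:E *
        \sum_(i < M) (U i x * \sum_(i <= l < M) a l x)))).
      rewrite /E integral_in_indic; apply: le_int => x.
        by rewrite mule_ge0 ?poweR_ge0.
      rewrite (eq_bigr (fun i : 'I_M => (\1_D x)%:E *
        (a i x * Lam i.+1 x `^ (t - 2) * \sum_(i <= l < M) a l x))); last first.
        by move=> i _; rewrite /U -muleA.
      rewrite -ge0_sume_distrr; last by move=> i _; rewrite !mule_ge0 ?poweR_ge0.
      by rewrite muleCA [leLHS]muleC lee_wpmul2l.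
    rewrite ge0_integralZl//=; last 3 first.
    - by apply: emeasurable_sum => i; exact: emeasurable_funM.
    - by move=> x _; apply: sume_ge0 => i _; rewrite mule_ge0.
    - by rewrite lee_fin mulr_ge0 ?(ltW t0) ?(ltW tm1).
    rewrite /K (EFinM (t * (t - 1))%R) -muleA; apply: lee_wpmul2l.
      by rewrite lee_fin mulr_ge0 ?(ltW t0) ?(ltW tm1).
    rewrite ge0_integral_sum//; last 2 first.
    - by move=> i; exact: emeasurable_funM.
    - by move=> i x _; rewrite mule_ge0.
    rewrite ge0_sume_distrr; last by move=> i _; apply: integral_ge0 => x _; rewrite mule_ge0.
    apply: lee_sum => i _; rewrite [leLHS](@int_saturated i (U i))//; last exact: satU.
    rewrite -ge0_integralZl//=; last 2 first.
    - exact: emeasurable_funM.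
    - by move=> x _; rewrite mule_ge0.
    apply: le_int => x.
      by rewrite mule_ge0// mule_ge0 ?wt_ge0// integral_ge0.
    by rewrite [leRHS]muleCA lee_wpmul2l// avg_suffix_le.
  have split2 : \sum_(i < M) \int[sigma]_x (U i x * (kap i x * J i x)) <=
      e%:E * E + ((e^-1) `^ (t - 2))%:E * \int[sigma]_(x in D) Y x.
    rewrite -ge0_integral_sum//; last 2 first.
    - by move=> i; exact: emeasurable_funM.
    - by move=> i x _; rewrite mule_ge0.
    have p0 : 0 <= ((e^-1) `^ (t - 2))%:E :> \bar R by rewrite lee_fin powR_ge0.
    rewrite /E -!ge0_integralZl//=; last 4 first.
    - exact: measurable_funTS.
    - exact: measurable_funTS.
    - by move=> x _; exact: poweR_ge0.
    - by rewrite lee_fin ltW.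
    rewrite -ge0_integralD//=; last 4 first.
    - by move=> x _; rewrite mule_ge0 ?poweR_ge0// lee_fin ltW.
    - by apply: measurable_funTS; exact: emeasurable_funM.
    - by move=> x _; rewrite mule_ge0.
    - by apply: measurable_funTS; exact: emeasurable_funM.
    rewrite [leRHS]integral_in_indic; apply: le_int => x.
      by apply: sume_ge0 => i _; rewrite mule_ge0.
    rewrite (eq_bigr (fun i : 'I_M => (\1_D x)%:E *
      (a i x * (Lam i.+1 x `^ (t - 2) * (kap i x * J i x))))); last first.
      by move=> i _; rewrite /U !muleA.
    have term0 (i : 'I_M) : 0 <= a i x * (Lam i.+1 x `^ (t - 2) * (kap i x * J i x)).
      by rewrite mule_ge0// mule_ge0 ?poweR_ge0.
    rewrite -ge0_sume_distrr// [leLHS]muleC lee_wpmul2r//.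
    apply: (@le_trans _ _ (\sum_(i < M) (e%:E * Lam M x `^ (t - 1) * a i x +
        ((e^-1) `^ (t - 2))%:E * (wolff_coef i x * J i x `^ t)))).
      apply: lee_sum => i _; rewrite -energy_term.
      rewrite [X in _ <= X + _]muleC [X in _ <= _ + X]muleCA -ge0_muleDr; last 2 first.
      - by rewrite mule_ge0 ?poweR_ge0// lee_fin ltW.
      - by rewrite mule_ge0 ?poweR_ge0.
      rewrite lee_wpmul2l//.
      apply: (@le_trans _ _ (Lam M x `^ (t - 2) * (kap i x * J i x))).
        by rewrite lee_wpmul2r// le_poweR ?pref_le// subr_ge0 ltW.
      exact: mule_poweR_split.
    rewrite big_split/= -!ge0_sume_distrr//= leeD2r// -muleA lee_wpmul2l//.
      by rewrite lee_fin ltW.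
    by rewrite muleC (mule_poweRB1 (Lam0 M x) (ltW t1)).
  have Yint0 : 0 <= \int[sigma]_(x in D) Y x by exact: integral_ge0.
  have : E <= (2^-1)%:E * E + (K * e^-1 `^ (t - 2))%:E * \int[sigma]_(x in D) Y x.
    apply: (le_trans step); apply: (le_trans (lee_wpmul2l _ split2)).
      by rewrite lee_fin.
    rewrite ge0_muleDr; last 2 first.
    - by rewrite mule_ge0// lee_fin ltW.
    - by rewrite mule_ge0// lee_fin powR_ge0.
    rewrite leeD// ?muleA -?EFinM ?lexx//.
    by rewrite lee_wpmul2r// lee_fin.
  (* Absorption: [E] is finite, so half of it can be subtracted from both sides. *)
  move=> h0; rewrite EFinM -muleA; move: h0.
  have Z0 : 0 <= (K * e^-1 `^ (t - 2))%:E * \int[sigma]_(x in D) Y x.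
    by rewrite mule_ge0// lee_fin mulr_ge0 ?powR_ge0.
  have Ef : E \is a fin_num by rewrite ge0_fin_numE.
  move: Z0; case: (_ * \int[sigma]_(x in D) Y x) => [z| |//] z0; last first.
    by rewrite gt0_muley ?leey.
  rewrite -(fineK Ef) -!EFinM -EFinD !lee_fin => h; lra.
have eE : (e^-1 = 2 * (K + 1))%R by rewrite invrK.
have mD x0 : measurable (Q 0%N x0) by exact: (measurable_cube CS).
have cst0 : (0 <= 2 * (K * (e^-1) `^ (t - 2)))%R.
  by apply: mulr_ge0 => //; apply: mulr_ge0; [exact: K0|exact: powR_ge0].
rewrite (int_average CS 0%N)//; last by move=> x; exact: poweR_ge0.
apply: (@le_trans _ _ (\int[sigma]_x0 (wt sigma Q 0%N x0 *
   ((2 * (K * (e^-1) `^ (t - 2)))%:E * \int[sigma]_(x in Q 0%N x0) Y x)))).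
  apply: le_int => x0; last by rewrite lee_wpmul2l ?wt_ge0.
  by rewrite mule_ge0 ?wt_ge0// integral_ge0// => x _; exact: poweR_ge0.
under eq_integral do rewrite muleCA.
have mw := measurable_wt CS 0%N.
rewrite ge0_integralZl//=; last 2 first.
- apply: emeasurable_funM => //; apply: measurable_int_rel => //.
  exact: (cube_measurable CS).
- by move=> x _; rewrite mule_ge0 ?wt_ge0// integral_ge0.
rewrite -(int_average CS)// eE; apply: lee_wpmul2l; first by rewrite lee_fin -eE.
rewrite ge0_integral_sum// -(big_mkord xpredT (fun i =>
     \int[sigma]_x (wolff_coef i x * J i x `^ t))).
apply: nneseries_lim_ge => i _ _.
by apply: integral_ge0 => x _.
Qed.

Lemma wolff_upper M : (forall x, J 0%N x < +oo) ->
  \int[sigma]_x Lam M x `^ t <= wolff_cst%:E * energy sigma mu wolff_coef t N g.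
Proof.
rewrite /wolff_cst; case: ifPn => [t2 _|]; first exact: wolff_upper_le2.
by rewrite -ltNge => t2 Jfin; exact: wolff_upper_gt2.
Qed.

End fixed_density.
End wolff_potential.

(** * The dyadic trace inequality *)

Section cube_maximal.
Context d (X : measurableType d) (R : realType).
Variables (sigma nu : {sigma_finite_measure set X -> \bar R}).
Variables (Q N : nat -> X -> set X) (Th : R).
Hypothesis CS : cube_system sigma Q N Th.
Let QS := cube_system_self CS.

Definition cubemax (f : X -> \bar R) := maxfun sigma nu Q Q f.

Lemma int_cube_le_cubemax (f : X -> \bar R) i x : measurable_fun setT f ->
  (forall x, 0 <= f x) -> nu (Q i x) < +oo ->
  \int[nu]_(y in Q i x) f y <= nu (Q i x) * cubemax f x.
Proof.
move=> mf f0 nuQ; have mQ := measurable_cube CS i x.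
have [nz|nnz] := eqVneq (nu (Q i x)) 0.
  rewrite nz mul0e integral_in_indic.
  under eq_integral do rewrite muleC.
  rewrite integral_eq0_mul//; first exact: measurable_EFin_indic.
  by rewrite integral_indic// setIT.
have nf : nu (Q i x) \is a fin_num by rewrite ge0_fin_numE.
have := @nbhd_avg_le_maxfun _ _ _ _ nu _ _ _ QS _ _ _ _ f0 (cube_refl CS i x).
move=> /(lee_wpmul2l (measure_ge0 nu (Q i x))).
by rewrite /nbhd_avg muleA divee// mul1e.
Qed.

(** This keeps the maximal function of a bounded test function real-valued and bounded, hence again
    an admissible test function. *)
Lemma cubemax_bounded (f : X -> \bar R) (m : R) x : measurable_fun setT f ->
  (forall x, 0 <= f x) -> (forall x, f x <= m%:E) -> (0 <= m)%R ->
  cubemax f x <= (Th ^+ 2 * m)%:E.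
Proof.
move=> mf f0 fm m0; apply: ge_ereal_sup => _ [i _ <-].
apply: (smooth_avg_le QS) => // y _; rewrite /nbhd_avg.
have mQ := measurable_cube CS i y.
have le1 : \int[nu]_(z in Q i y) f z <= m%:E * nu (Q i y).
  by rewrite -integral_cst//; apply: ge0_le_int.
apply: (le_trans (lee_wpmul2l _ le1)); first by rewrite inve_ge0.
rewrite muleCA -[leRHS]mule1 lee_wpmul2l// muleC.
have [->|nnz] := eqVneq (nu (Q i y)) 0; first by rewrite mul0e.
have [->|nuy] := eqVneq (nu (Q i y)) +oo; first by rewrite invey mule0.
by rewrite divee// ge0_fin_numE// lt_neqAle nuy leey.
Qed.

End cube_maximal.

(** * Dyadic models of the integral operator *)

Section dyadic_operators.
Context d (X : measurableType d) (R : realType).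
Variables (sigma mu : {sigma_finite_measure set X -> \bar R}).
Variables (Q N : nat -> X -> set X) (Th : R).
Hypothesis CS : cube_system sigma Q N Th.
Variables (k : nat -> R) (A t p : R).
Hypothesis k0 : forall i, (0 <= k i)%R.
Hypothesis A0 : (0 <= A)%R.
Hypothesis t1 : (1 < t)%R.
Hypothesis p1 : (1 < p)%R.
Hypothesis pt : (p^-1 + t^-1 = 1)%R.
Let kap := kap sigma Q k.
Hypothesis kap_cmp : forall i x y, N i x y -> kap i y <= A%:E * kap i x.
Hypothesis annulus : forall i x, sigma (Q i x) <= Th%:E * sigma (Q i x `\` Q i.+1 x).

Let QS := cube_system_self CS.
Let t0 : (0 < t)%R. Proof. exact: lt_trans t1. Qed.
Let p0 : (0 < p)%R. Proof. exact: lt_trans p1. Qed.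
Let T0 : (0 <= Th)%R. Proof. by apply: le_trans (doubling_ge1 CS). Qed.
Let kE0 i : 0 <= (k i)%:E. Proof. by rewrite lee_fin. Qed.
Let mp (f : X -> \bar R) r : measurable_fun setT f -> measurable_fun setT (fun x => f x `^ r).
Proof. by move=> mf; exact: (measurableT_comp (measurable_poweR _)). Qed.

Definition cubeop (m : {measure set X -> \bar R}) (f : X -> \bar R) x :=
  \sum_(i <oo) ((k i)%:E * \int[m]_(y in Q i x) f y).

(** For a given y at most one annulus contributes, so this kernel stays below k(|x-y|), unlike the
    kernel of [cubeop]. *)
Definition annop (f : X -> \bar R) x :=
  \sum_(i <oo) ((k i)%:E * \int[sigma]_(y in Q i x `\` Q i.+1 x) f y).

Lemma cubeop_ge0 m f x : (forall x, 0 <= f x) -> 0 <= cubeop m f x.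
Proof. by move=> f0; apply: nneseries_ge0 => i _ _; rewrite mule_ge0// integral_ge0. Qed.

Lemma measurable_cubeop (m : {sigma_finite_measure set X -> \bar R}) f :
  measurable_fun setT f -> (forall x, 0 <= f x) -> measurable_fun setT (cubeop m f).
Proof.
move=> mf f0; apply: ge0_emeasurable_sum => [i x _ _|i _].
  by rewrite mule_ge0// integral_ge0.
apply: emeasurable_funM => //; apply: measurable_int_rel => //.
exact: (cube_measurable CS).
Qed.

(* The sets [Q i x `\` Q i.+1 x] are disjoint, so replacing [f] by its maximal function turns the kernel [\sum_i k_i 1_(Q i)] into one without overlaps. *)
Lemma cubeop_le_annop f x : measurable_fun setT f -> (forall x, 0 <= f x) ->
  cubeop sigma f x <= Th%:E * annop (cubemax sigma sigma Q f) x.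
Proof.
move=> mf f0.
have M0 y : 0 <= cubemax sigma sigma Q f y by exact: maxfun_ge0.
have mM : measurable_fun setT (cubemax sigma sigma Q f) by exact: (measurable_maxfun _ QS).
rewrite /annop -nneseriesZl; last by move=> i _; rewrite mule_ge0// integral_ge0.
apply: lee_nneseries => [i _ _|i _]; first by rewrite mule_ge0// integral_ge0.
rewrite muleCA lee_wpmul2l//.
have mQ := measurable_cube CS.
have mA : measurable (Q i x `\` Q i.+1 x) by exact: measurableD.
have sQ := cube_gt0 CS i x; have sQf := cube_lty CS i x.
set I := \int[sigma]_(y in Q i x) f y.
have avg : I = sigma (Q i x) * nbhd_avg sigma Q Q f i x.
  by rewrite /nbhd_avg muleA divee ?mul1e ?ge0_fin_numE// gt_eqF.
have avg0 : 0 <= nbhd_avg sigma Q Q f i x by exact: nbhd_avg_ge0.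
apply: (@le_trans _ _ (Th%:E * sigma (Q i x `\` Q i.+1 x) * nbhd_avg sigma Q Q f i x)).
  by rewrite avg lee_wpmul2r.
rewrite -muleA lee_wpmul2l// muleC -integral_cst//.
apply: ge0_le_int => // y [xy _] /=.
exact: (@nbhd_avg_le_maxfun _ _ _ sigma sigma Q Q Th QS f i x y f0 xy).
Qed.

Lemma cubeop_dual f g : measurable_fun setT f -> (forall x, 0 <= f x) ->
  measurable_fun setT g -> (forall x, 0 <= g x) ->
  \int[sigma]_x (f x * cubeop mu g x) = \int[mu]_x (g x * cubeop sigma f x).
Proof.
move=> mf f0 mg g0.
have Ig0 (m : {measure set X -> \bar R}) (h : X -> \bar R) i x : (forall x, 0 <= h x) ->
    0 <= (k i)%:E * \int[m]_(y in Q i x) h y.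
  by move=> h0; rewrite mule_ge0// integral_ge0.
have mI (m : {sigma_finite_measure set X -> \bar R}) h i : measurable_fun setT h ->
    (forall x, 0 <= h x) ->
    measurable_fun setT (fun x => (k i)%:E * \int[m]_(y in Q i x) h y).
  move=> mh h0; apply: emeasurable_funM => //; apply: measurable_int_rel => //.
  exact: (cube_measurable CS).
have expand (m m' : {sigma_finite_measure set X -> \bar R}) u v :
    measurable_fun setT u -> (forall x, 0 <= u x) ->
    measurable_fun setT v -> (forall x, 0 <= v x) ->
    \int[m]_x (u x * cubeop m' v x) =
    \sum_(i <oo) ((k i)%:E * \int[m]_x (u x * \int[m']_(y in Q i x) v y)).
  move=> mu' u0 mv v0.
  transitivity (\int[m]_x \sum_(i <oo) (u x * ((k i)%:E * \int[m']_(y in Q i x) v y))).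
    by apply: eq_integral => x _; rewrite ge0_nneseriesZl// => i; exact: Ig0.
  rewrite integral_nneseries//; last 2 first.
  - by move=> i; apply: emeasurable_funM => //; exact: mI.
  - by move=> i x _; rewrite mule_ge0// Ig0.
  apply: eq_eseriesr => i _; rewrite -ge0_integralZl//; last 2 first.
  - apply: emeasurable_funM => //; apply: measurable_int_rel => //.
    exact: (cube_measurable CS).
  - by move=> x _; rewrite mule_ge0// integral_ge0.
  by apply: eq_integral => x _; rewrite muleCA.
rewrite !expand//; apply: eq_eseriesr => i _; congr (_ * _).
by rewrite (int_cube_swap CS).
Qed.

(** Keep in the average of [cubeop mu g] over [Q i x] only the generations l >= i. Exchanging the
    integrals turns it into the average of [g] times the tail sum, and the tail sum is almost
    constant on the cube. *)
Lemma kap_int_le_cubemax g i x : measurable_fun setT g -> (forall x, 0 <= g x) ->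
  kap i x * \int[mu]_(y in Q i x) g y <= A%:E * cubemax sigma sigma Q (cubeop mu g) x.
Proof.
move=> mg g0.
have L0 y : 0 <= cubeop mu g y by exact: cubeop_ge0.
have mL : measurable_fun setT (cubeop mu g) by exact: measurable_cubeop.
have mQ := measurable_cube CS i x.
have := @nbhd_avg_le_maxfun _ _ _ _ sigma _ _ _ QS _ _ _ _ L0 (cube_refl CS i x).
move=> /(lee_wpmul2l (_ : 0 <= A%:E)) => /(_ A0); apply: le_trans.
rewrite /nbhd_avg.
have lb : \int[mu]_(z in Q i x) (g z * tailsum sigma Q k i z) <=
    \int[sigma]_(y in Q i x) cubeop mu g y.
  have mI l : measurable_fun setT (fun y => (k l)%:E * \int[mu]_(z in Q l y) g z).
    apply: emeasurable_funM => //; apply: measurable_int_rel => //.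
    exact: (cube_measurable CS).
  have I0 l y : 0 <= (k l)%:E * \int[mu]_(z in Q l y) g z.
    by rewrite mule_ge0// integral_ge0.
  have mks l : measurable_fun setT (fun z => (k l)%:E * sigma (Q l z)).
    by apply: emeasurable_funM => //; exact: (measurable_mcube CS).
  rewrite /cubeop integral_nneseries//; last by move=> l; exact: measurable_funTS.
  have -> : \int[mu]_(z in Q i x) (g z * tailsum sigma Q k i z) =
    \sum_(l <oo) \int[mu]_(z in Q i x)
      (g z * (if (i <= l)%N then (k l)%:E * sigma (Q l z) else 0)).
    rewrite -integral_nneseries//; last 2 first.
    - move=> l; apply: measurable_funTS; apply: emeasurable_funM => //.
      by case: (i <= l)%N => //; exact: measurable_cst.
    - by move=> l z _; apply: mule_ge0 => //; case: ifP => // _; rewrite mule_ge0.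
    apply: eq_integral => z _; rewrite ge0_nneseriesZl//; last first.
      by move=> l; case: ifP => // _; rewrite mule_ge0.
    by rewrite /tailsum eseries_mkcond.
  apply: lee_nneseries => [l _ _|l _].
    by apply: integral_ge0 => z _; apply: mule_ge0 => //; case: ifP => // _; rewrite mule_ge0.
  case: (boolP (i <= l)%N) => [il|_]; last first.
    rewrite [leLHS](_ : _ = 0); first exact: integral_ge0.
    by apply: integral0_eq => z _; rewrite mule0.
  have m1 : measurable_fun setT (fun y => (\1_(Q i x) y)%:E : \bar R).
    exact: measurable_EFin_indic.
  rewrite [leRHS]ge0_integralZl//; last 2 first.
  - apply: measurable_funTS; apply: measurable_int_rel => //.
    exact: (cube_measurable CS).
  - by move=> y _; exact: integral_ge0.
  rewrite (_ : \int[sigma]_(y in Q i x) _ = \int[sigma]_y ((\1_(Q i x) y)%:E *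
     \int[mu]_(z in Q l y) g z)); last first.
    by rewrite integral_in_indic; apply: eq_integral => y _; rewrite muleC.
  rewrite (int_cube_swap CS)//.
  rewrite -ge0_integralZl//; last 2 first.
  - apply: emeasurable_funM => //; apply: measurable_int_rel => //.
    exact: (cube_measurable CS).
  - by move=> y _; rewrite mule_ge0// integral_ge0// => z _; rewrite lee_fin.
  apply: ge0_le_int => //.
  - by move=> z; rewrite !mule_ge0.
  - by move=> z; rewrite !mule_ge0// integral_ge0// => y _; rewrite lee_fin.
  move=> z xz; rewrite [leRHS]muleCA lee_wpmul2l// lee_wpmul2l//.
  (* For l >= i the whole cube [Q l z] lies in [Q i x], so its full mass is available. *)
  rewrite -[leLHS]mul1e -integral_cst; last exact: (measurable_cube CS).
  apply: ge0_le_int => // y zy; rewrite /= indicE mem_set//.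
  exact: (cube_trans CS xz (cube_nestn CS il zy)).
apply: (@le_trans _ _ (A%:E * ((sigma (Q i x))^-1 *
    \int[mu]_(z in Q i x) (g z * tailsum sigma Q k i z)))); last first.
  by rewrite lee_wpmul2l// lee_wpmul2l ?inve_ge0.
have lb2 : \int[mu]_(z in Q i x) (g z * (sigma (Q i x) * kap i x)) <=
    A%:E * \int[mu]_(z in Q i x) (g z * tailsum sigma Q k i z).
  rewrite -ge0_integralZl//; last 2 first.
  - apply: measurable_funTS; apply: emeasurable_funM => //.
    exact: (measurable_tailsum CS).
  - by move=> z _; apply: mule_ge0 => //; exact: tailsum_ge0.
  apply: ge0_le_int => //.
  - by move=> z; apply: mule_ge0 => //; apply: mule_ge0 => //; exact: kap_ge0.
  - by move=> z; apply: mule_ge0 => //; apply: mule_ge0 => //; exact: tailsum_ge0.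
  move=> z xz; rewrite [leRHS]muleCA lee_wpmul2l// (tailsumE CS) [leRHS]muleCA.
  rewrite -(cube_eq CS xz) lee_wpmul2l//.
  by apply: kap_cmp; apply: (nbhd_sub CS); exact: (cube_sym CS).
rewrite [leRHS]muleCA.
apply: le_trans (lee_wpmul2l _ lb2); last by rewrite inve_ge0.
have kx0 : 0 <= kap i x by exact: kap_ge0.
rewrite ge0_integralZr//; last 2 first.
- exact: measurable_funTS.
- exact: mule_ge0.
rewrite [leRHS](AC (1*(1*2)) ((3*1)*(4*2)))%AC /= divee ?mul1e//.
  by rewrite ge0_fin_numE ?(cube_lty CS).
by rewrite gt_eqF// (cube_gt0 CS).
Qed.

End dyadic_operators.

(** * Relations between the exponents *)

Section exponents.
Context {R : realType}.

Lemma mule_poweR_le_add (x y : \bar R) (t : R) : 0 <= x -> 0 <= y -> (1 < t)%R ->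
  x * y `^ (t - 1) <= x `^ t + y `^ t.
Proof.
move=> x0 y0 t1; have t0 : (0 <= t - 1)%R by rewrite subr_ge0 ltW.
have [xy|/ltW yx] := leP x y.
  rewrite -(mule_poweRB1 y0 (ltW t1)).
  by apply: le_trans (leeDr _ (poweR_ge0 _ _)); rewrite lee_wpmul2r ?poweR_ge0.
rewrite -(mule_poweRB1 x0 (ltW t1)).
apply: le_trans (leeDl _ (poweR_ge0 _ _)); rewrite lee_wpmul2l//.
exact: le_poweR.
Qed.

Lemma maxe_poweR_le_add (x y : \bar R) (t : R) : (maxe x y) `^ t <= x `^ t + y `^ t.
Proof.
by rewrite /Order.max; case: ifP => _; [rewrite leeDr|rewrite leeDl]; rewrite ?poweR_ge0.
Qed.

Variables p q : R.
Hypotheses (q_gt1 : (1 < q)%R) (q_ltp : (q < p)%R).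
Let t := (p / (p - 1))%R.
Let s := (q * (p - 1) / (p - q))%R.
Let u := (q / (q - 1))%R.

Lemma exponent_gt1 : (1 < s)%R.
Proof.
have q1 := q_gt1; have qp := q_ltp.
rewrite /s ltr_pdivlMr ?subr_gt0// mul1r -subr_gt0.
have -> : (q * (p - 1) - (p - q) = p * (q - 1))%R by ring.
by rewrite mulr_gt0 ?subr_gt0//; lra.
Qed.

Lemma exponent_dual_gt1 : (1 < u / t)%R.
Proof.
have q1 := q_gt1; have qp := q_ltp.
have q0 : (0 < q - 1)%R by lra.
have p0 : (0 < p)%R by lra.
have pn : (p != 0)%R by rewrite gt_eqF.
have p1n : (p - 1 != 0)%R by rewrite gt_eqF//; lra.
have qn : (q - 1 != 0)%R by rewrite gt_eqF.
rewrite -subr_gt0.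
have -> : (u / t - 1 = (p - q) / (p * (q - 1)))%R.
  by rewrite /u /t; field; rewrite pn qn p1n.
by rewrite divr_gt0 ?mulr_gt0// subr_gt0.
Qed.

(** The origin of the exponent of the theorem: t-th powers of functions in L^u(mu), with u = q' and
    t = p', lie in L^(u/t)(mu), and s is its conjugate exponent. *)
Lemma exponent_conj : ((u / t)^-1 + s^-1 = 1)%R.
Proof. have q1 := q_gt1; have qp := q_ltp; by rewrite /u /t /s; field; lra. Qed.

Lemma exponent_u_gt1 : (1 < u)%R.
Proof. have q1 := q_gt1; have qp := q_ltp; by rewrite /u ltr_pdivlMr ?mul1r; lra. Qed.

Lemma exponent_u_conj : (u^-1 + q^-1 = 1)%R.
Proof. have q1 := q_gt1; have qp := q_ltp; by rewrite /u; field; lra. Qed.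

End exponents.

(** * From the annular trace bound to the potential *)

Section necessity.
Context d (X : measurableType d) (R : realType).
Variables (sigma mu : {sigma_finite_measure set X -> \bar R}).
Variables (Q N : nat -> X -> set X) (Th : R).
Hypothesis CS : cube_system sigma Q N Th.
Variables (k : nat -> R) (A t p : R).
Hypothesis k0 : forall i, (0 <= k i)%R.
Hypothesis A0 : (0 <= A)%R.
Hypothesis t1 : (1 < t)%R.
Hypothesis p1 : (1 < p)%R.
Hypothesis pt : (p^-1 + t^-1 = 1)%R.
Hypothesis kap_cmp : forall i x y, N i x y ->
  kap sigma Q k i y <= A%:E * kap sigma Q k i x.
Hypothesis annulus : forall i x, sigma (Q i x) <= Th%:E * sigma (Q i x `\` Q i.+1 x).
Hypothesis muN : forall i x, mu (N i x) < +oo.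

Let al := wolff_coef sigma Q k t.
Let QS := cube_system_self CS.
Let t0 : (0 < t)%R. Proof. exact: lt_trans t1. Qed.
Let p0 : (0 < p)%R. Proof. exact: lt_trans p1. Qed.
Let T0 : (0 <= Th)%R. Proof. by apply: le_trans (doubling_ge1 CS). Qed.
Let kE0 i : 0 <= (k i)%:E. Proof. by rewrite lee_fin. Qed.
Let mp (f : X -> \bar R) r : measurable_fun setT f -> measurable_fun setT (fun x => f x `^ r).
Proof. by move=> mf; exact: (measurableT_comp (measurable_poweR _)). Qed.

Definition cube_energy_cst : R := (A `^ (t - 1) * (1 + strong_cst (2 * Th ^+ 2) t))%R.

Lemma cube_energy_cst_ge0 : (0 <= cube_energy_cst)%R.
Proof. by rewrite mulr_ge0 ?powR_ge0// addr_ge0 ?strong_cst_ge0. Qed.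

(** By duality the test bound says that L, the operator applied to [g], has L^t(sigma) norm at most
    [B]. Each energy term is k_i times the integral of [g] over the cube times a power t - 1 of
    kap_i times that integral; the latter is at most A M L, so summation gives L (A M L)^(t-1), and
    M is bounded on L^t(sigma). *)
Lemma energy_cube_dual (g : X -> \bar R) (B : R) : measurable_fun setT g ->
  (forall x, 0 <= g x) -> (0 <= B)%R ->
  (forall f : X -> R, measurable_fun setT f -> (forall x, (0 <= f x)%R) ->
    (exists M, forall x, (f x <= M)%R) -> \int[sigma]_x ((f x)%:E `^ p) < +oo ->
    \int[mu]_x (g x * cubeop Q k sigma (EFin \o f) x) <=
      B%:E * (\int[sigma]_x ((f x)%:E `^ p)) `^ p^-1) ->
  energy sigma mu al t Q g <= (cube_energy_cst * B `^ t)%:E.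
Proof.
move=> mg g0 B0 H.
set L := cubeop Q k mu g.
have L0 x : 0 <= L x by exact: cubeop_ge0.
have mL : measurable_fun setT L by exact: (measurable_cubeop CS).
have LB : \int[sigma]_x L x `^ t <= (B `^ t)%:E.
  apply: (Lp_converse_hoelder (sigma_finiteT sigma) p0 t1 pt B0 mL L0).
  move=> f mf f0 fb fp; apply: le_trans (H f mf f0 fb fp).
  have mEf : measurable_fun setT (EFin \o f) by exact/measurable_EFinP.
  have Ef0 x : 0 <= (EFin \o f) x by rewrite lee_fin.
  by rewrite -(cubeop_dual mu CS k0 mEf Ef0 mg g0).
have M0 x : 0 <= cubemax sigma sigma Q L x by exact: maxfun_ge0.
have mM : measurable_fun setT (cubemax sigma sigma Q L) by exact: (measurable_maxfun _ QS).
have al0 i x : 0 <= al i x by exact: wolff_coef_ge0.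
have I0 i x : 0 <= \int[mu]_(y in Q i x) g y by exact: integral_ge0.
have mI i : measurable_fun setT (fun x => \int[mu]_(y in Q i x) g y).
  by apply: measurable_int_rel => //; exact: (cube_measurable CS).
have A'0 : 0 <= (A `^ (t - 1))%:E :> \bar R by rewrite lee_fin powR_ge0.
apply: (@le_trans _ _ ((A `^ (t - 1))%:E * \int[sigma]_x
    (L x `^ t + cubemax sigma sigma Q L x `^ t))).
  rewrite -ge0_integralZl//=; last 2 first.
  - by apply: emeasurable_funD; exact: mp.
  - by move=> x _; rewrite adde_ge0 ?poweR_ge0.
  rewrite /energy -integral_nneseries//; last 2 first.
  - move=> i; apply: emeasurable_funM; last exact: mp.
    exact: (measurable_wolff_coef CS).
  - by move=> i x _; rewrite mule_ge0 ?poweR_ge0.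
  apply: le_int => x.
    by apply: nneseries_ge0 => i _ _; rewrite mule_ge0 ?poweR_ge0.
  apply: (@le_trans _ _ (L x * (A%:E * cubemax sigma sigma Q L x) `^ (t - 1))); last first.
    rewrite poweRM// poweR_EFin muleCA lee_wpmul2l//.
    exact: mule_poweR_le_add.
  rewrite /L /cubeop -ge0_nneseriesZr ?poweR_ge0//; last by move=> i; rewrite mule_ge0.
  apply: lee_nneseries => [i _ _|i _]; first by rewrite mule_ge0 ?poweR_ge0.
  rewrite -(mule_poweRB1 (I0 i x) (ltW t1)) /al /wolff_coef.
  rewrite [leLHS](AC (2*2) ((1*3)*(2*4)))%AC /= lee_wpmul2l ?mule_ge0//.
  rewrite -poweRM ?kap_ge0//; apply: le_poweR; first by rewrite subr_ge0 ltW.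
    by apply: mule_ge0 => //; exact: kap_ge0.
  exact: (kap_int_le_cubemax mu CS).
rewrite ge0_integralD//; last 4 first.
- by move=> x _; exact: poweR_ge0.
- exact: mp.
- by move=> x _; exact: poweR_ge0.
- exact: mp.
rewrite /cube_energy_cst -mulrA (EFinM (A `^ (t - 1))%R); apply: lee_wpmul2l => //.
rewrite mulrDl mul1r EFinD leeD//.
apply: (le_trans (@maxfun_strong _ _ _ sigma sigma Q Q Th QS L t t1 mL L0)).
by rewrite (EFinM (strong_cst _ _)) lee_wpmul2l// lee_fin strong_cst_ge0.
Qed.

Variables (q B : R).
Hypothesis B0 : (0 <= B)%R.
Hypothesis annop_bounded : forall f : X -> R, measurable_fun setT f ->
  (forall x, (0 <= f x)%R) -> (exists M, forall x, (f x <= M)%R) ->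
  \int[sigma]_x ((f x)%:E `^ p) < +oo ->
  (\int[mu]_x annop sigma Q k (EFin \o f) x `^ q) `^ q^-1 <=
  B%:E * (\int[sigma]_x ((f x)%:E `^ p)) `^ p^-1.

Let S := (strong_cst (2 * Th ^+ 2) p `^ p^-1)%R.
Let S0 : (0 <= S)%R. Proof. exact: powR_ge0. Qed.

Lemma measurable_annop (f : X -> \bar R) : measurable_fun setT f -> (forall x, 0 <= f x) ->
  measurable_fun setT (annop sigma Q k f).
Proof.
move=> mf f0; apply: ge0_emeasurable_sum => [i x _ _|i _].
  by rewrite mule_ge0// integral_ge0.
apply: emeasurable_funM => //; apply: measurable_int_rel => //.
apply: (@measurableD _ _ [set z : X * X | Q i z.1 z.2] [set z : X * X | Q i.+1 z.1 z.2]);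
  exact: (cube_measurable CS).
Qed.

Lemma annop_ge0 (f : X -> \bar R) x : (forall x, 0 <= f x) -> 0 <= annop sigma Q k f x.
Proof. by move=> f0; apply: nneseries_ge0 => i _ _; rewrite mule_ge0// integral_ge0. Qed.

(** The hypothesis on [annop] is applied to the maximal function of [f], whose L^p(sigma) norm costs
    the factor [S]. *)
Lemma cubemax_annop_bounded (f : X -> R) : measurable_fun setT f ->
  (forall x, (0 <= f x)%R) -> (exists M, forall x, (f x <= M)%R) ->
  \int[sigma]_x ((f x)%:E `^ p) < +oo ->
  (\int[mu]_x annop sigma Q k (cubemax sigma sigma Q (EFin \o f)) x `^ q) `^ q^-1 <=
  (B * S)%:E * (\int[sigma]_x ((f x)%:E `^ p)) `^ p^-1.
Proof.
move=> mf f0 [M fM] fp.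
have mEf : measurable_fun setT (EFin \o f) by exact/measurable_EFinP.
have Ef0 x : 0 <= (EFin \o f) x by rewrite lee_fin.
set m := cubemax sigma sigma Q (EFin \o f).
have m0 x : 0 <= m x by exact: maxfun_ge0.
have mm : measurable_fun setT m by exact: (measurable_maxfun _ QS).
have mb x : m x <= (Th ^+ 2 * Num.max M 0)%:E.
  apply: (cubemax_bounded sigma CS) => //; last by rewrite le_max lexx orbT.
  by move=> y; rewrite lee_fin le_max fM.
have mE x : (fine (m x))%:E = m x.
  by rewrite fineK// ge0_fin_numE// (le_lt_trans (mb x))// ltry.
have strong : \int[sigma]_x m x `^ p <=
    (strong_cst (2 * Th ^+ 2) p)%:E * \int[sigma]_x ((f x)%:E `^ p).
  exact: (@maxfun_strong _ _ _ sigma sigma Q Q Th QS (EFin \o f) p p1 mEf Ef0).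
have mEE : EFin \o (fine \o m) = m by apply/funext => x /=; rewrite mE.
have := annop_bounded (f := fine \o m); rewrite mEE => H.
have {H} := H _ _ _ _.
have eqm : \int[sigma]_x ((fine \o m) x)%:E `^ p = \int[sigma]_x m x `^ p.
  by apply: eq_integral => x _; congr (_ `^ _); exact: mE.
rewrite eqm => H; apply: le_trans (H _ _ _ _) _.
- by apply/measurable_EFinP; rewrite mEE.
- by move=> x; rewrite -lee_fin (mE x).
- by exists (Th ^+ 2 * Num.max M 0)%R => x; rewrite -lee_fin (mE x).
- apply: (le_lt_trans strong); rewrite lte_mul_pinfty//.
  by rewrite lee_fin strong_cst_ge0.
rewrite EFinM -muleA; apply: lee_wpmul2l; first by rewrite lee_fin.
rewrite /S -poweR_EFin -poweRM ?lee_fin ?strong_cst_ge0//; last first.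
  by apply: integral_ge0 => x _; exact: poweR_ge0.
apply: le_poweR => //; first by rewrite invr_ge0 ltW.
by apply: integral_ge0 => x _; exact: poweR_ge0.
Qed.

(** The last hypothesis says that [g] has norm at most [c] in the dual of L^q(mu). Stated by
    testing, it covers q = 1, where the dual is L^infinity, together with q > 1. *)
Lemma cubeop_test (g : X -> \bar R) (c : R) : measurable_fun setT g ->
  (forall x, 0 <= g x) -> (0 <= c)%R ->
  (forall T : X -> \bar R, measurable_fun setT T -> (forall x, 0 <= T x) ->
     \int[mu]_x (g x * T x) <= c%:E * (\int[mu]_x T x `^ q) `^ q^-1) ->
  energy sigma mu al t Q g <= (cube_energy_cst * (Th * c * (B * S)) `^ t)%:E.
Proof.
move=> mg g0 c0 H; apply: energy_cube_dual => //; first by rewrite !mulr_ge0.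
move=> f mf f0 fb fp.
have mEf : measurable_fun setT (EFin \o f) by exact/measurable_EFinP.
have Ef0 x : 0 <= (EFin \o f) x by rewrite lee_fin.
have m0 x : 0 <= cubemax sigma sigma Q (EFin \o f) x by exact: maxfun_ge0.
have mm : measurable_fun setT (cubemax sigma sigma Q (EFin \o f)).
  exact: (measurable_maxfun _ QS).
have mT := measurable_annop mm m0.
have aT x := annop_ge0 x m0.
apply: (@le_trans _ _ (Th%:E * \int[mu]_x (g x * annop sigma Q k (cubemax sigma sigma Q (EFin \o f)) x))).
  rewrite -ge0_integralZl//=; last 2 first.
  - exact: emeasurable_funM.
  - by move=> x _; rewrite mule_ge0.
  apply: le_int => x; first by rewrite mule_ge0// cubeop_ge0.
  by rewrite [leRHS]muleCA lee_wpmul2l// (cubeop_le_annop CS).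
rewrite -mulrA EFinM -muleA; apply: lee_wpmul2l => //.
apply: (le_trans (H _ mT aT)).
rewrite EFinM -muleA; apply: lee_wpmul2l; first by rewrite lee_fin.
exact: cubemax_annop_bounded.
Qed.

Definition energy_cst : R :=
  (nbhd_cst Th (A `^ (t - 1)) t * (cube_energy_cst * (Th * (B * S)) `^ t))%R.

Let A'0 : (0 <= A `^ (t - 1))%R. Proof. exact: powR_ge0. Qed.

Lemma energy_cst_ge0 : (0 <= energy_cst)%R.
Proof.
rewrite mulr_ge0 ?(nbhd_cst_ge0 CS)//.
by rewrite mulr_ge0 ?powR_ge0// cube_energy_cst_ge0.
Qed.

Lemma energy_nbhd_test (g : X -> \bar R) (c : R) : measurable_fun setT g ->
  (forall x, 0 <= g x) -> (0 <= c)%R ->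
  (forall T : X -> \bar R, measurable_fun setT T -> (forall x, 0 <= T x) ->
     \int[mu]_x (g x * T x) <= c%:E * (\int[mu]_x T x `^ q) `^ q^-1) ->
  energy sigma mu al t N g <= (energy_cst * c `^ t)%:E.
Proof.
move=> mg g0 c0 H.
have mal i : measurable_fun setT (al i) by exact: (measurable_wolff_coef CS).
have al0 i x : 0 <= al i x by exact: wolff_coef_ge0.
have acmp i x y : N i x y -> al i y <= (A `^ (t - 1))%:E * al i x by exact: wolff_coef_cmp.
apply: (le_trans (energy_nbhd_le mu CS mal al0 acmp A'0 t1 mg g0)).
rewrite /energy_cst -mulrA (EFinM (nbhd_cst _ _ _)); apply: lee_wpmul2l; first by rewrite lee_fin (nbhd_cst_ge0 CS).
apply: (le_trans (cubeop_test mg g0 c0 H)).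
rewrite lee_fin -[leRHS]mulrA; apply: ler_wpM2l; first exact: cube_energy_cst_ge0.
rewrite -powRM ?mulr_ge0//.
by have -> : (Th * c * (B * S) = Th * (B * S) * c)%R by ring.
Qed.

Definition necessity_cst : R :=
  let v := (q / (q - 1) / t)%R in
  let s := (q * (p - 1) / (p - q))%R in
  if q == 1%R then (A `^ (t - 1) * energy_cst)%R
  else ((A `^ (t - 1) * energy_cst * strong_cst (2 * Th ^+ 2) v `^ v^-1) `^ s)%R.

Hypothesis tE : (t = p / (p - 1))%R.
Hypothesis q1 : (1 <= q)%R.
Hypothesis qp : (q < p)%R.

Theorem dyadic_necessity :
  \int[mu]_x pot sigma mu Q al t N x `^ (q * (p - 1) / (p - q)) <= necessity_cst%:E.
Proof.
have mal i : measurable_fun setT (al i) by exact: (measurable_wolff_coef CS).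
have al0 i x : 0 <= al i x by exact: wolff_coef_ge0.
have acmp i x y : N i x y -> al i y <= (A `^ (t - 1))%:E * al i x by exact: wolff_coef_cmp.
have pot0 x : 0 <= pot sigma mu Q al t N x by exact: pot_ge0.
have mpot : measurable_fun setT (pot sigma mu Q al t N) by exact: (measurable_pot_nbhd mu CS t mal al0).
rewrite /necessity_cst; case: ifPn => [/eqP q1E|qn1].
  (* Here the exponent of the potential is 1, and constants are the only test functions needed. *)
  rewrite q1E mul1r divff ?subr_eq0 ?gt_eqF//.
  have -> : \int[mu]_x pot sigma mu Q al t N x `^ 1 =
      \int[mu]_x (cst 1 x * pot sigma mu Q al t N x).
    by apply: eq_integral => x _; rewrite poweRe1// mul1e.
  apply: (@le_trans _ _ ((A `^ (t - 1))%:E * energy sigma mu al t N (fun=> 1 `^ t^-1))).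
    apply: (pot_nbhd_le CS) => //.
    move=> i x y _; rewrite /nbhd_avg integral_cst ?mul1e; last exact: (measurable_cube CS).
    change ((mu (N i x))^-1 * mu (Q i x) <= 1).
    have le_QN : mu (Q i x) <= mu (N i x) by exact: (cube_le_nbhd CS).
    have [nz|nnz] := eqVneq (mu (N i x)) 0.
      have -> : mu (Q i x) = 0 by apply/eqP; rewrite eq_le measure_ge0 -nz le_QN.
      by rewrite mule0.
    have nf : mu (N i x) \is a fin_num by rewrite ge0_fin_numE.
    by rewrite -(divee nf nnz) muleC lee_wpmul2r ?inve_ge0.
  rewrite EFinM; apply: lee_wpmul2l; first by rewrite lee_fin.
  have := @energy_nbhd_test (fun=> 1 `^ t^-1) 1%R.
  rewrite powR1 mulr1; apply => //.
  - by move=> x; exact: poweR_ge0.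
  - move=> T mT T1; rewrite q1E invr1 mul1e poweRe1; last first.
      by apply: integral_ge0 => x _; exact: poweR_ge0.
    apply: le_int => x; first by rewrite mule_ge0 ?poweR_ge0.
    by rewrite poweR1r mul1e poweRe1.
have q1' : (1 < q)%R by rewrite lt_neqAle eq_sym qn1.
set u := (q / (q - 1))%R; set v := (u / t)%R; set s := (q * (p - 1) / (p - q))%R.
have s1 : (1 < s)%R by exact: (exponent_gt1 q1' qp).
have v1 : (1 < v)%R by rewrite /v /u tE; exact: (exponent_dual_gt1 q1' qp).
have v0 : (0 < v)%R by exact: lt_trans v1.
have u1 : (1 < u)%R by exact: (exponent_u_gt1 q1' qp).
have u0 : (0 < u)%R by exact: lt_trans u1.
have vs : (v^-1 + s^-1 = 1)%R by rewrite /v /u tE; exact: (exponent_conj q1' qp).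
have uq : (u^-1 + q^-1 = 1)%R by exact: (exponent_u_conj q1' qp).
have ec0 := energy_cst_ge0.
apply: (Lp_converse_hoelder (sigma_finiteT mu) v0 s1 vs) => //.
  by rewrite mulr_ge0 ?powR_ge0// mulr_ge0.
move=> h mh h0 _ hv.
have mEh : measurable_fun setT (EFin \o h) by exact/measurable_EFinP.
have Eh0 x : 0 <= (EFin \o h) x by rewrite lee_fin.
set G := maxfun sigma mu Q N (EFin \o h).
have G0 x : 0 <= G x by exact: maxfun_ge0.
have mG : measurable_fun setT G by exact: (measurable_maxfun _ CS).
have strong : \int[mu]_x G x `^ v <=
    (strong_cst (2 * Th ^+ 2) v)%:E * \int[mu]_x ((h x)%:E `^ v).
  exact: (@maxfun_strong _ _ _ sigma mu Q N Th CS (EFin \o h) v v1 mEh Eh0).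
have Gfin : \int[mu]_x G x `^ v < +oo.
  apply: (le_lt_trans strong); rewrite lte_mul_pinfty//.
  by rewrite lee_fin strong_cst_ge0.
set I := \int[mu]_x G x `^ v in strong Gfin.
have I0 : 0 <= I by apply: integral_ge0 => x _; exact: poweR_ge0.
have If : I \is a fin_num by rewrite ge0_fin_numE.
apply: (@le_trans _ _ ((A `^ (t - 1))%:E * energy sigma mu al t N (fun y => G y `^ t^-1))).
  apply: (@pot_nbhd_le _ _ _ sigma mu Q N Th CS al (A `^ (t - 1))%R t mal al0 acmp A'0 t1
     (EFin \o h) G mEh Eh0 mG G0 muN).
  by move=> i x y xy; exact: (nbhd_avg_le_maxfun mu CS).
rewrite -(mulrA (A `^ (t - 1))%R energy_cst) (EFinM (A `^ (t - 1))%R) -muleA.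
apply: lee_wpmul2l; first by rewrite lee_fin.
(* The L^u(mu) norm of G^(1/t), since u/t = v. Its t-th power is then the L^v(mu) norm of G. *)
pose c := (fine I `^ u^-1)%R.
have c0 : (0 <= c)%R by exact: powR_ge0.
apply: (@le_trans _ _ (energy_cst * c `^ t)%:E).
  apply: energy_nbhd_test => //; first exact: mp.
    by move=> x; exact: poweR_ge0.
  move=> T mT T1.
  have -> : c%:E = (\int[mu]_x (G x `^ t^-1) `^ u) `^ u^-1.
    rewrite (_ : \int[mu]_x (G x `^ t^-1) `^ u = I).
      by rewrite -(fineK If) poweR_EFin.
    by apply: eq_integral => x _; rewrite -poweRrM mulrC.
  apply: hoelder_ereal => //; first exact: mp.
  - by move=> x; exact: poweR_ge0.
  - exact: lt_trans q1'.
rewrite !(EFinM energy_cst) -muleA; apply: lee_wpmul2l; first by rewrite lee_fin.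
have -> : (c `^ t)%:E = I `^ v^-1.
  rewrite /c -powRrM -(fineK If) poweR_EFin; congr (_ `^ _)%:E.
  by rewrite (invf_div u t) mulrC.
have h00 : 0 <= \int[mu]_x ((h x)%:E `^ v) by apply: integral_ge0 => x _; exact: poweR_ge0.
rewrite -poweR_EFin -poweRM ?lee_fin ?strong_cst_ge0//.
by apply: le_poweR => //; rewrite invr_ge0 ltW.
Qed.

End necessity.

(** * From the potential to the dyadic trace inequality *)

Section sufficiency.
Context d (X : measurableType d) (R : realType).
Variables (sigma mu : {sigma_finite_measure set X -> \bar R}).
Variables (Q N : nat -> X -> set X) (Th : R).
Hypothesis CS : cube_system sigma Q N Th.
Variables (k : nat -> R) (A t p : R).
Hypothesis k0 : forall i, (0 <= k i)%R.
Hypothesis A0 : (0 <= A)%R.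
Hypothesis t1 : (1 < t)%R.
Hypothesis p1 : (1 < p)%R.
Hypothesis pt : (p^-1 + t^-1 = 1)%R.
Hypothesis kap_cmp : forall i x y, N i x y ->
  kap sigma Q k i y <= A%:E * kap sigma Q k i x.
Hypothesis muN : forall i x, mu (N i x) < +oo.

Let al := wolff_coef sigma Q k t.
Let QS := cube_system_self CS.
Let t0 : (0 < t)%R. Proof. exact: lt_trans t1. Qed.
Let p0 : (0 < p)%R. Proof. exact: lt_trans p1. Qed.
Let T0 : (0 <= Th)%R. Proof. by apply: le_trans (doubling_ge1 CS). Qed.
Let kE0 i : 0 <= (k i)%:E. Proof. by rewrite lee_fin. Qed.
Let mp (f : X -> \bar R) r : measurable_fun setT f -> measurable_fun setT (fun x => f x `^ r).
Proof. by move=> mf; exact: (measurableT_comp (measurable_poweR _)). Qed.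
Let A'0 : (0 <= A `^ (t - 1))%R. Proof. exact: powR_ge0. Qed.

(** Finitely many generations, as required by [wolff_upper]; the number [M] goes to infinity in
    [dyadic_sufficiency]. *)
Definition nbhdop (m : {measure set X -> \bar R}) M (f : X -> \bar R) x :=
  \sum_(i < M) ((k i)%:E * \int[m]_(y in N i x) f y).

Lemma nbhdop_ge0 m M f x : (forall x, 0 <= f x) -> 0 <= nbhdop m M f x.
Proof. by move=> f0; apply: sume_ge0 => i _; rewrite mule_ge0// integral_ge0. Qed.

Let mI (m : {sigma_finite_measure set X -> \bar R}) f i : measurable_fun setT f ->
  (forall x, 0 <= f x) -> measurable_fun setT (fun x => \int[m]_(y in N i x) f y).
Proof. by move=> *; apply: measurable_int_rel => //; exact: (nbhd_measurable CS). Qed.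

Lemma measurable_nbhdop (m : {sigma_finite_measure set X -> \bar R}) M f :
  measurable_fun setT f -> (forall x, 0 <= f x) -> measurable_fun setT (nbhdop m M f).
Proof. by move=> mf f0; apply: emeasurable_sum => i; apply: emeasurable_funM => //; exact: mI. Qed.

Lemma nbhdop_dual M f g : measurable_fun setT f -> (forall x, 0 <= f x) ->
  measurable_fun setT g -> (forall x, 0 <= g x) ->
  \int[mu]_x (g x * nbhdop sigma M f x) = \int[sigma]_x (f x * nbhdop mu M g x).
Proof.
move=> mf f0 mg g0.
have expand (m m' : {sigma_finite_measure set X -> \bar R}) u v :
    measurable_fun setT u -> (forall x, 0 <= u x) ->
    measurable_fun setT v -> (forall x, 0 <= v x) ->
    \int[m]_x (u x * nbhdop m' M v x) =
    \sum_(i < M) ((k i)%:E * \int[m]_x (u x * \int[m']_(y in N i x) v y)).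
  move=> mu' u0 mv v0.
  have I0 i x : 0 <= (k i)%:E * \int[m']_(y in N i x) v y by rewrite mule_ge0// integral_ge0.
  transitivity (\int[m]_x \sum_(i < M) (u x * ((k i)%:E * \int[m']_(y in N i x) v y))).
    by apply: eq_integral => x _; rewrite /nbhdop ge0_sume_distrr.
  rewrite ge0_integral_sum//; last 2 first.
  - by move=> i; apply: emeasurable_funM => //; apply: emeasurable_funM => //; exact: mI.
  - by move=> i x _; rewrite mule_ge0.
  apply: eq_bigr => i _; rewrite -ge0_integralZl//; last 2 first.
  - by apply: emeasurable_funM => //; exact: mI.
  - by move=> x _; rewrite mule_ge0// integral_ge0.
  by apply: eq_integral => x _; rewrite muleCA.
rewrite !expand//; apply: eq_bigr => i _; congr (_ * _).
by rewrite (int_nbhd_swap CS).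
Qed.

Definition dual_cst : R :=
  (wolff_cst Th A t * (nbhd_cst Th (A `^ (t - 1)) t * A `^ (t - 1)))%R.

Lemma dual_cst_ge0 : (0 <= dual_cst)%R.
Proof.
apply: mulr_ge0; last by rewrite mulr_ge0// (nbhd_cst_ge0 CS).
have C0 : (0 <= Th ^+ 2 * A)%R by rewrite mulr_ge0// exprn_ge0.
have tm : (0 <= t - 1)%R by rewrite subr_ge0 ltW.
rewrite /wolff_cst; case: ifPn => _.
  by apply: mulr_ge0; [exact: ltW|exact: powR_ge0].
apply: mulr_ge0 => //; apply: mulr_ge0; last exact: powR_ge0.
by apply: mulr_ge0 => //; apply: mulr_ge0 => //; exact: ltW.
Qed.

(** Duality, Hoelder's inequality in [sigma] and the energy bounds. The bound [m] on [g] does not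
    enter the estimate: it only makes the integrals of [g] over coarsest neighbourhoods finite,
    which the absorption for t > 2 requires. *)
Lemma nbhdop_test M f g G (m : R) : measurable_fun setT f -> (forall x, 0 <= f x) ->
  measurable_fun setT g -> (forall x, 0 <= g x) -> (forall x, g x <= m%:E) ->
  measurable_fun setT G -> (forall x, g x <= G x) ->
  (forall i z, \int[mu]_(y in Q i z) g y <= mu (Q i z) * G z) ->
  \int[mu]_x (g x * nbhdop sigma M f x) <=
  (\int[sigma]_x f x `^ p) `^ p^-1 *
  (dual_cst%:E * \int[mu]_x (pot sigma mu Q al t Q x * G x `^ t)) `^ t^-1.
Proof.
move=> mf f0 mg g0 gm mG gG intG.
have mal i : measurable_fun setT (al i) by exact: (measurable_wolff_coef CS).
have al0 i x : 0 <= al i x by exact: wolff_coef_ge0.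
have acmp i x y : N i x y -> al i y <= (A `^ (t - 1))%:E * al i x by exact: wolff_coef_cmp.
rewrite nbhdop_dual//.
have mL : measurable_fun setT (nbhdop mu M g) by exact: measurable_nbhdop.
have L0 x : 0 <= nbhdop mu M g x by exact: nbhdop_ge0.
apply: (le_trans (hoelder_ereal sigma mf mL f0 L0 p0 t0 pt)).
apply: lee_wpmul2l; first exact: poweR_ge0.
apply: le_poweR; first by rewrite invr_ge0 ltW.
  by apply: integral_ge0 => x _; exact: poweR_ge0.
have gfin x : \int[mu]_(y in N 0%N x) g y < +oo.
  have mN := measurable_nbhd CS 0%N x.
  apply: (@le_lt_trans _ _ (\int[mu]_(y in N 0%N x) cst m%:E y)).
    by apply: ge0_le_integral => //; exact: measurable_funTS.
  rewrite integral_cst//.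
  have m0 : 0 <= m%:E by exact: le_trans (gm x).
  change (m%:E * mu (N 0%N x) < +oo).
  by apply: lte_mul_pinfty.
apply: (le_trans (wolff_upper CS k0 A0 t1 kap_cmp mg g0 M gfin)).
have wc0 : 0 <= (wolff_cst Th A t)%:E.
  rewrite lee_fin /wolff_cst.
  have C0 : (0 <= Th ^+ 2 * A)%R by rewrite mulr_ge0// exprn_ge0.
  have tm : (0 <= t - 1)%R by rewrite subr_ge0 ltW.
  case: ifPn => _.
    by apply: mulr_ge0; [exact: ltW|exact: powR_ge0].
  apply: mulr_ge0 => //; apply: mulr_ge0; last exact: powR_ge0.
  by apply: mulr_ge0 => //; apply: mulr_ge0 => //; exact: ltW.
rewrite /dual_cst (EFinM (wolff_cst _ _ _)) -muleA; apply: lee_wpmul2l => //.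
apply: (le_trans (energy_nbhd_le mu CS mal al0 acmp A'0 t1 mg g0)).
rewrite (EFinM (nbhd_cst _ _ _)) -muleA; apply: lee_wpmul2l.
  by rewrite lee_fin (nbhd_cst_ge0 CS).
by apply: (energy_cube_le CS mal al0 _ A'0 t1 mg g0 mG gG intG).
Qed.

Variables (q B : R).
Hypothesis tE : (t = p / (p - 1))%R.
Hypothesis q1 : (1 <= q)%R.
Hypothesis qp : (q < p)%R.
Hypothesis pot_bounded :
  \int[mu]_x pot sigma mu Q al t Q x `^ (q * (p - 1) / (p - q)) <= B%:E.

Definition sufficiency_cst : R :=
  let v := (q / (q - 1) / t)%R in
  let s := (q * (p - 1) / (p - q))%R in
  if q == 1%R then ((dual_cst * B) `^ t^-1)%R
  else (((dual_cst * (B `^ s^-1 *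
     (1 + strong_cst (2 * Th ^+ 2) (q / (q - 1))) `^ v^-1)) `^ t^-1) `^ q)%R.

Lemma nbhdop_bounded M f : measurable_fun setT f -> (forall x, 0 <= f x) ->
  \int[sigma]_x f x `^ p < +oo ->
  \int[mu]_x nbhdop sigma M f x `^ q <=
  sufficiency_cst%:E * ((\int[sigma]_x f x `^ p) `^ p^-1) `^ q.
Proof.
move=> mf f0 ffin.
have mal i : measurable_fun setT (al i) by exact: (measurable_wolff_coef CS).
have al0 i x : 0 <= al i x by exact: wolff_coef_ge0.
set F := (\int[sigma]_x f x `^ p) `^ p^-1.
have F0 : 0 <= F by exact: poweR_ge0.
have Ff : F \is a fin_num.
  by rewrite fin_num_poweR// ge0_fin_numE// integral_ge0// => x _; exact: poweR_ge0.
have pot0 x : 0 <= pot sigma mu Q al t Q x by exact: pot_ge0.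
have mpot : measurable_fun setT (pot sigma mu Q al t Q).
  exact: (measurable_pot_cube mu CS t mal al0).
have dc0 := dual_cst_ge0.
have T_0 x : 0 <= nbhdop sigma M f x by exact: nbhdop_ge0.
have mT : measurable_fun setT (nbhdop sigma M f) by exact: measurable_nbhdop.
have tV0 : (0 <= t^-1)%R by rewrite invr_ge0 ltW.
rewrite /sufficiency_cst; case: ifPn => [/eqP q1E|qn1].
  (* For q = 1 the exponent of the potential is 1, and testing with g = G = 1 already gives the
     whole integral. *)
  move: pot_bounded; rewrite q1E mul1r divff ?subr_eq0 ?gt_eqF// => potB.
  rewrite poweRe1//.
  have -> : \int[mu]_x nbhdop sigma M f x `^ 1 = \int[mu]_x (cst 1 x * nbhdop sigma M f x).
    by apply: eq_integral => x _; rewrite poweRe1// mul1e.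
  apply: (le_trans (@nbhdop_test M f (cst 1) (cst 1) 1%R mf f0 _ _ _ _ _ _)) => //.
  - move=> i z; rewrite integral_cst; last exact: (measurable_cube CS).
    by rewrite mul1e mule1.
  rewrite muleC lee_wpmul2r// -poweR_EFin; apply: le_poweR => //.
    rewrite mule_ge0 ?lee_fin// integral_ge0// => x _.
    by rewrite mule_ge0 ?poweR_ge0.
  rewrite (EFinM dual_cst); apply: lee_wpmul2l; first by rewrite lee_fin.
  apply: le_trans potB.
  apply: le_int => x; first by rewrite mule_ge0 ?poweR_ge0.
  by rewrite poweR1r mule1 poweRe1.
have q1' : (1 < q)%R by rewrite lt_neqAle eq_sym qn1.
set u := (q / (q - 1))%R; set v := (u / t)%R; set s := (q * (p - 1) / (p - q))%R.
have q0 : (0 < q)%R by exact: lt_trans q1'.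
have s1 : (1 < s)%R by exact: (exponent_gt1 q1' qp).
have s0 : (0 < s)%R by exact: lt_trans s1.
have v1 : (1 < v)%R by rewrite /v /u tE; exact: (exponent_dual_gt1 q1' qp).
have v0 : (0 < v)%R by exact: lt_trans v1.
have u1 : (1 < u)%R by exact: (exponent_u_gt1 q1' qp).
have u0 : (0 < u)%R by exact: lt_trans u1.
have vs : (v^-1 + s^-1 = 1)%R by rewrite /v /u tE; exact: (exponent_conj q1' qp).
have uq : (u^-1 + q^-1 = 1)%R by exact: (exponent_u_conj q1' qp).
have st0 : (0 <= 1 + strong_cst (2 * Th ^+ 2) u)%R by rewrite addr_ge0 ?strong_cst_ge0.
set W := (B `^ s^-1 * (1 + strong_cst (2 * Th ^+ 2) u) `^ v^-1)%R.
have W0 : (0 <= W)%R by apply: mulr_ge0; exact: powR_ge0.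
set D := ((dual_cst * W) `^ t^-1)%R.
have D0 : (0 <= D)%R by exact: powR_ge0.
have -> : (D `^ q)%:E * F `^ q = ((D * fine F) `^ q)%:E.
  by rewrite -(fineK Ff) poweR_EFin -EFinM -powRM// fine_ge0.
apply: (Lp_converse_hoelder (sigma_finiteT mu) u0 q1' uq) => //.
  by rewrite mulr_ge0// fine_ge0.
move=> g mg g0 [m gm] gu.
have mEg : measurable_fun setT (EFin \o g) by exact/measurable_EFinP.
have Eg0 x : 0 <= (EFin \o g) x by rewrite lee_fin.
set c := cubemax sigma mu Q (EFin \o g).
have c0 x : 0 <= c x by exact: maxfun_ge0.
have mc : measurable_fun setT c by exact: (measurable_maxfun _ QS).
(* The maximal function controls the cube averages of [g]; the maximum with [g] secures the
   pointwise bound g <= G everywhere. *)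
pose G x := maxe (g x)%:E (c x).
have G0 x : 0 <= G x by rewrite le_max c0 orbT.
have mG : measurable_fun setT G by exact: measurable_maxe.
have muQ i x : mu (Q i x) < +oo.
  by apply: le_lt_trans (muN i x); exact: (cube_le_nbhd CS).
set I := \int[mu]_x ((g x)%:E `^ u).
have I0 : 0 <= I by apply: integral_ge0 => x _; exact: poweR_ge0.
have strong : \int[mu]_x G x `^ u <= (1 + strong_cst (2 * Th ^+ 2) u)%:E * I.
  apply: (@le_trans _ _ (\int[mu]_x ((g x)%:E `^ u + c x `^ u))).
    by apply: le_int => x; [exact: poweR_ge0|exact: maxe_poweR_le_add].
  rewrite ge0_integralD//; last 4 first.
  - by move=> x _; exact: poweR_ge0.
  - exact: mp.
  - by move=> x _; exact: poweR_ge0.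
  - exact: mp.
  rewrite EFinD ge0_muleDl ?lee_fin ?strong_cst_ge0// mul1e leeD2l//.
  exact: (@maxfun_strong _ _ _ sigma mu Q Q Th QS (EFin \o g) u u1 mEg Eg0).
apply: (le_trans (@nbhdop_test M f (EFin \o g) G m mf f0 mEg Eg0 _ mG _ _)).
- by move=> x; rewrite lee_fin.
- by move=> x; rewrite le_max lexx.
- move=> i z; apply: (le_trans (int_cube_le_cubemax CS mEg Eg0 (muQ i z))).
  by rewrite lee_wpmul2l// le_max lexx orbT.
have hold : \int[mu]_x (pot sigma mu Q al t Q x * G x `^ t) <= W%:E * I `^ v^-1.
  apply: (le_trans (hoelder_ereal mu mpot (mp t mG) pot0 (fun x => poweR_ge0 _ _) s0 v0 _)).
    by rewrite addrC.
  rewrite /W EFinM -muleA; apply: lee_pmul; rewrite ?poweR_ge0//.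
    rewrite -poweR_EFin; apply: le_poweR => //; first by rewrite invr_ge0 ltW.
    by apply: integral_ge0 => x _; exact: poweR_ge0.
  rewrite -poweR_EFin -poweRM ?lee_fin//; apply: le_poweR.
  - by rewrite invr_ge0 ltW.
  - by apply: integral_ge0 => x _; exact: poweR_ge0.
  - apply: le_trans strong; apply: le_int => x; first exact: poweR_ge0.
    by rewrite -poweRrM /v mulrC divfK// gt_eqF.
rewrite -/F (EFinM D) (fineK Ff) (muleC D%:E) -muleA; apply: lee_wpmul2l => //.
rewrite /D -poweR_EFin.
have -> : I `^ u^-1 = (I `^ v^-1) `^ t^-1.
  rewrite -poweRrM; congr (_ `^ _); rewrite /v (invf_div u t) mulrAC divff ?mul1r//.
  by rewrite gt_eqF.
have dW0 : 0 <= (dual_cst * W)%:E by rewrite lee_fin mulr_ge0.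
rewrite -(poweRM _ dW0 (poweR_ge0 _ _)); apply: le_poweR => //.
  by rewrite mule_ge0 ?lee_fin// integral_ge0// => x _; rewrite mule_ge0 ?poweR_ge0.
by rewrite (EFinM dual_cst) -muleA; apply: lee_wpmul2l; rewrite ?lee_fin.
Qed.

Theorem dyadic_sufficiency f : measurable_fun setT f -> (forall x, 0 <= f x) ->
  \int[sigma]_x f x `^ p < +oo ->
  \int[mu]_x (\sum_(i <oo) ((k i)%:E * \int[sigma]_(y in N i x) f y)) `^ q <=
  sufficiency_cst%:E * ((\int[sigma]_x f x `^ p) `^ p^-1) `^ q.
Proof.
move=> mf f0 ffin.
have q0 : (0 < q)%R by exact: lt_le_trans q1.
have term0 i x : 0 <= (k i)%:E * \int[sigma]_(y in N i x) f y.
  by rewrite mule_ge0// integral_ge0.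
apply: (@integral_le_sup _ _ _ mu (fun M x => nbhdop sigma M f x `^ q)).
- by move=> M; apply: mp; exact: measurable_nbhdop.
- by move=> M x; exact: poweR_ge0.
- by move=> x; exact: poweR_ge0.
- move=> x M M' MM'; apply: le_poweR; [exact: ltW|exact: nbhdop_ge0|].
  exact: (@lee_sum_nneg_ord _ (fun i => (k i)%:E * \int[sigma]_(y in N i x) f y) xpredT).
- move=> x; apply: (@poweR_le_sup _ (fun M => nbhdop sigma M f x)) => //.
  + by move=> M; exact: nbhdop_ge0.
  + exact: nneseries_ge0.
  + move=> c le_c; apply: lime_le; first exact: is_cvg_nneseries.
    by apply: nearW => M; rewrite big_mkord; exact: le_c.
- by move=> M; exact: nbhdop_bounded.
Qed.

End sufficiency.

(** * Dyadic cubes of the Euclidean space *)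

Section floor_complements.
Context {R : realType}.
Local Open Scope ring_scope.

Lemma floor_half (u : R) : Num.floor u = (Num.floor (u * 2) %/ 2)%Z.
Proof.
apply: floor_def.
have /andP[] := floor_itv (u * 2); set m := Num.floor _ => l r.
have l1 : ((m %/ 2)%Z * 2 <= m) by lia.
have r1 : (m + 1 <= ((m %/ 2)%Z + 1) * 2) by lia.
move: l1 r1; rewrite -!(ler_int R) !intrM => l1 r1.
apply/andP; split.
  by rewrite -(ler_pM2r (_ : 0 < 2 :> R))//; exact: le_trans l.
by rewrite -(ltr_pM2r (_ : 0 < 2 :> R))//; exact: lt_le_trans r1.
Qed.

Lemma floor_dist_lt (u v : R) (m : int) : `|Num.floor u - Num.floor v| <= m ->
  `|u - v| < m%:~R + 1.
Proof.
have /andP[lu ru] := floor_itv u; have /andP[lv rv] := floor_itv v.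
rewrite ler_norml ltr_norml => /andP[]; rewrite -!(ler_int R).
by move: lu ru lv rv; rewrite !intrD !intrN; lra.
Qed.

Lemma dist_floor_le (u v : R) (m : int) : `|u - v| < m%:~R ->
  `|Num.floor u - Num.floor v| <= m.
Proof.
have /andP[lu ru] := floor_itv u; have /andP[lv rv] := floor_itv v.
rewrite ltr_norml => /andP[h1 h2]; rewrite ler_norml.
have a : Num.floor u - Num.floor v < m + 1.
  by rewrite -(ltr_int R); move: lu ru lv rv; rewrite !intrD !intrN; lra.
have b : - (m + 1) < Num.floor u - Num.floor v.
  by rewrite -(ltr_int R); move: lu ru lv rv; rewrite !intrN !intrD !intrN; lra.
by lia.
Qed.

End floor_complements.

Section euclidean_cubes.
Context {R : realType} {n : nat}.
Implicit Types (x y z : 'rV[R]_n) (d e r : R) (c : 'I_n) (K : nat).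
Local Open Scope ring_scope.

Lemma coord_le_dist x y c : `|x ord0 c - y ord0 c| <= euclid_dist x y.
Proof.
rewrite -sqrtr_sqr /euclid_dist ler_wsqrtr// (bigD1 c)//= !mxE lerDl.
by apply: sumr_ge0 => i _; exact: sqr_ge0.
Qed.

Lemma dist_le_coord x y e : 0 <= e -> (forall c, `|x ord0 c - y ord0 c| <= e) ->
  euclid_dist x y <= n%:R * e.
Proof.
move=> e0 xy; have ne0 : 0 <= n%:R * e by rewrite mulr_ge0.
rewrite -(ger0_norm ne0) -sqrtr_sqr /euclid_dist ler_wsqrtr//.
apply: (@le_trans _ _ (\sum_(i < n) e ^+ 2)).
  apply: ler_sum => i _; rewrite !mxE -real_normK ?num_real//.
  by rewrite ler_sqr ?nnegrE.
rewrite sumr_const card_ord -[_ *+ n]mulr_natl exprMn; apply: ler_wpM2r; first exact: sqr_ge0.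
by rewrite -natrX ler_nat; case: (n) => // m; rewrite leq_pmulr.
Qed.

Lemma distxx x : euclid_dist x x = 0.
Proof.
rewrite /euclid_dist big1 ?sqrtr0// => i _.
by rewrite !mxE subrr expr0n.
Qed.

Lemma dist_gt0 x y : x <> y -> 0 < euclid_dist x y.
Proof.
move=> xy; rewrite lt_neqAle sqrtr_ge0 andbT eq_sym; apply/eqP => d0; apply: xy.
apply/rowP => c; apply/eqP; rewrite -subr_eq0 -normr_le0 -d0.
exact: coord_le_dist.
Qed.

Definition cellidx d x c : int := Num.floor (x ord0 c / d).

Definition cube d x : set 'rV[R]_n := [set y | forall c, cellidx d y c = cellidx d x c].

Definition cube_nbhd K d x : set 'rV[R]_n :=
  [set y | forall c, `|cellidx d y c - cellidx d x c| <= K%:Z].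

Definition cube_center d x : 'rV[R]_n := \row_c (d * ((cellidx d x c)%:~R + 2^-1)).

(** Passing to the parent cube halves the integer index and rounds down, so nesting reduces to
    integer arithmetic. *)
Lemma cellidx_half d x c : cellidx d x c = (cellidx (d / 2) x c %/ 2)%Z.
Proof. by rewrite /cellidx floor_half invf_div mulrCA mulrA mulrC !mulrA. Qed.

Lemma cube_half d x y : cube (d / 2) x y -> cube d x y.
Proof. by move=> xy c; rewrite !(cellidx_half d) xy. Qed.

Lemma cube_nbhd_half K d x y : (0 < K)%N -> cube_nbhd K (d / 2) x y -> cube_nbhd K d x y.
Proof. by move=> K0 xy c; rewrite !(cellidx_half d); have := xy c; lia. Qed.

Lemma cube_nbhd_dist K d x y : 0 < d -> cube_nbhd K d x y ->
  euclid_dist x y <= n%:R * ((K.+1)%:R * d).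
Proof.
move=> d0 xy; apply: dist_le_coord => [|c]; first by rewrite mulr_ge0// ltW.
have := floor_dist_lt (xy c); rewrite -mulrBl normrM (gtr0_norm (_ : 0 < d^-1)) ?invr_gt0//.
by rewrite ltr_pdivrMr// distrC -natr1 => /ltW.
Qed.

Lemma cube_dist d x y : 0 < d -> cube d x y -> euclid_dist x y <= n%:R * d.
Proof.
move=> d0 xy; rewrite -[d in leRHS]mul1r; apply: (@cube_nbhd_dist 0) => // c.
by rewrite xy subrr.
Qed.

Lemma dist_cube_nbhd K d x y : 0 < d -> euclid_dist x y < K%:R * d -> cube_nbhd K d x y.
Proof.
move=> d0 xy c; apply: dist_floor_le.
rewrite -mulrBl normrM (gtr0_norm (_ : 0 < d^-1)) ?invr_gt0// ltr_pdivrMr//.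
by apply: le_lt_trans xy; rewrite distrC coord_le_dist.
Qed.

Lemma center_dist d x c : 0 < d -> `|cube_center d x ord0 c - x ord0 c| <= d / 2.
Proof.
move=> d0; rewrite mxE; have /andP[] := floor_itv (x ord0 c / d).
rewrite -/(cellidx d x c) ler_pdivlMr// ltr_pdivrMr// intrD => l r.
by rewrite ler_norml; apply/andP; split; lra.
Qed.

Lemma ball_center_sub d x y : 0 < d -> eball (cube_center d x) (d / 2) y -> cube d x y.
Proof.
move=> d0; rewrite /eball/= => xy c; apply: floor_def.
have := le_lt_trans (coord_le_dist _ _ c) xy; rewrite mxE ltr_norml => /andP[l r].
by rewrite ler_pdivlMr// ltr_pdivrMr// intrD; apply/andP; split; lra.
Qed.

(** In each coordinate a point of the neighbourhood is within (K + 2) d of the centre, one [d] being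
    spent on the centre itself. The factor n passes to the Euclidean distance, 4 converts [d] into
    the inradius d/4 of a half cube, and 2^w > w. *)
Lemma cube_nbhd_ball K d x y (w : nat) : 0 < d ->
  (4 * n * K.+2 < w)%N -> cube_nbhd K d x y ->
  eball (cube_center (d / 2) x) (2 ^+ w * (d / 2 / 2)) y.
Proof.
move=> d0 hw xy; rewrite /eball/=.
have d20 : 0 < d / 2 by rewrite divr_gt0.
apply: (@le_lt_trans _ _ (n%:R * (K.+2%:R * d))).
  apply: dist_le_coord => [|c]; first by rewrite mulr_ge0// ltW.
  have h1 := center_dist x c d20.
  have := floor_dist_lt (xy c); rewrite -mulrBl normrM (gtr0_norm (_ : 0 < d^-1)) ?invr_gt0//.
  rewrite ltr_pdivrMr// => h2.
  apply: (le_trans (ler_distD (x ord0 c) _ _)); rewrite (distrC (x ord0 c)).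
  have -> : K.+2%:R = K%:R + 1 + 1 :> R by rewrite -!natr1.
  by move: h1 h2; rewrite -pmulrn; lra.
have -> : n%:R * (K.+2%:R * d) = (4 * n * K.+2)%:R * (d / 2 / 2) :> R.
  by rewrite !natrM; field.
rewrite ltr_pM2r ?divr_gt0// -natrX ltr_nat; apply: (ltn_trans hw).
exact: ltn_expl.
Qed.

(* [y] is [x] moved by half a side in the direction [c], without leaving the cube of [x]. *)
Lemma cube_sibling d x (c : 'I_n) : 0 < d -> exists y, cube d x y /\
  (forall z, cube (d / 2) y z -> cube d x z /\ ~ cube (d / 2) x z).
Proof.
move=> d0; have d20 : 0 < d / 2 by rewrite divr_gt0.
(* The sibling index: move up from an even index and down from an odd one. *)
have [e [e1 eE]] : exists e : int, e != 0 /\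
    ((cellidx (d / 2) x c + e) %/ 2 = cellidx (d / 2) x c %/ 2)%Z.
  have [ev|od] := boolP ((cellidx (d / 2) x c %% 2)%Z == 0).
    by exists 1; split => //; lia.
  by exists (- 1); split => //; lia.
pose y : 'rV[R]_n := \row_i (x ord0 i + (if i == c then e%:~R * (d / 2) else 0)).
have yE i : cellidx (d / 2) y i = cellidx (d / 2) x i + (if i == c then e else 0).
  rewrite /cellidx mxE; case: ifPn => _; last by rewrite !addr0.
  by rewrite mulrDl mulfK ?gt_eqF// floorDrz ?intr_int// intrKfloor.
have yx z : cube (d / 2) y z -> cube d x z.
  move=> yz i; rewrite !(cellidx_half d) yz yE.
  by have [->|_] := eqVneq i c; rewrite ?addr0.
exists y; split; first by apply: yx => i.
move=> z yz; split; first exact: yx.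
move=> /(_ c); rewrite yz yE eqxx => /eqP.
by rewrite -subr_eq0 addrAC subrr add0r (negbTE e1).
Qed.

End euclidean_cubes.

(** * Borel measurability of cubes and balls *)

Section borel_measurability.
Context {R : realType} {n : nat}.
Local Notation X := (borelRn R n).
Local Open Scope ring_scope.

Lemma measurable_coord (c : 'I_n) : measurable_fun setT (fun x : X => (x : 'rV[R]_n) ord0 c).
Proof.
apply: (measurability (@RGenOpens.G R)); first exact: RGenOpens.measurableE.
move=> _ [_ [a [b ->]] <-]; rewrite setTI; apply: sub_sigma_algebra.
by apply: open_comp; [move=> x _; exact: coord_continuous|exact: interval_open].
Qed.

Lemma measurable_euclid_dist :
  measurable_fun setT (fun z : X * X => euclid_dist z.1 z.2).
Proof.
apply: (measurableT_comp (continuous_measurable_fun (@sqrt_continuous R))).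
apply: measurable_sum => i; apply: measurable_funX.
under eq_fun do rewrite !mxE.
apply: measurable_funB; apply: (measurableT_comp (measurable_coord i)).
  exact: measurable_fst.
exact: measurable_snd.
Qed.

Lemma measurable_cellidx (d : R) c :
  measurable_fun setT (fun x : X => (cellidx d x c)%:~R : R).
Proof.
have mfl : measurable_fun setT (fun u : R => (Num.floor u)%:~R : R).
  by apply: nondecreasing_measurable => // u v uv; rewrite ler_int le_floor.
apply: (measurableT_comp mfl); apply: measurable_funM => //.
exact: measurable_coord.
Qed.

Lemma measurable_cube_nbhd_rel (K : nat) (d : R) :
  measurable [set z : X * X | cube_nbhd K d z.1 z.2].
Proof.
rewrite (_ : mkset _ = \bigcap_(c in [set: 'I_n])
  [set z : X * X | `|(cellidx d z.2 c)%:~R - (cellidx d z.1 c)%:~R : R| <= K%:R]).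
  apply: fin_bigcap_measurable => [|c _]; first exact: finite_finset.
  rewrite -[X in measurable X]setTI.
  apply: (measurable_fun_ler _ (measurable_cst (K%:R : R)) measurableT (Y := [set true])) => //.
  apply: (measurableT_comp (@normr_measurable _ _)).
  apply: measurable_funB; apply: (measurableT_comp (measurable_cellidx d c)).
    exact: measurable_snd.
  exact: measurable_fst.
by apply/seteqP; split => z h c; [move: (h c)|move: (h c I)]; rewrite /= -(ler_int R) intr_norm intrB.
Qed.

Lemma measurable_cube_rel (d : R) : measurable [set z : X * X | cube d z.1 z.2].
Proof.
rewrite (_ : mkset _ = [set z : X * X | cube_nbhd 0 d z.1 z.2]).
  exact: measurable_cube_nbhd_rel.
apply/seteqP; split => z h c; first by rewrite /= h subrr.
by have := h c; rewrite normr_le0 subr_eq0 => /eqP.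
Qed.

Lemma measurable_dist (x : X) : measurable_fun setT (fun y : X => euclid_dist x y).
Proof.
have mp : measurable_fun setT (fun y : X => (x, y)).
  by apply/measurable_fun_pairP; split; [exact: measurable_cst|exact: measurable_id].
exact: (measurableT_comp measurable_euclid_dist mp).
Qed.

Lemma measurable_eball x r : measurable (eball x r : set X).
Proof.
rewrite -[X in measurable X]setTI.
exact: (measurable_fun_ltr (measurable_dist x) (measurable_cst (r : R)) measurableT (Y := [set true])).
Qed.

End borel_measurability.

(** * Doubling measures *)

Section sigma_finite_copy.
Context d (T : measurableType d) (R : realType) (mu : {measure set T -> \bar R}).
Hypothesis mu_sf : sigma_finite setT mu.

(* The phantom proof argument keys the sigma-finite instance. *)
Definition sigma_finite_copy of sigma_finite setT mu : set T -> \bar R := mu.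
HB.instance Definition _ := Measure.on (sigma_finite_copy mu_sf).
HB.instance Definition _ := Measure_isSigmaFinite.Build _ _ _ (sigma_finite_copy mu_sf) mu_sf.

End sigma_finite_copy.

Lemma sigma_finite_measureP d (T : measurableType d) (R : realType)
    (mu : {measure set T -> \bar R}) : sigma_finite setT mu ->
  exists nu : {sigma_finite_measure set T -> \bar R}, mu = nu.
Proof. by move=> h; exists (sigma_finite_copy h); move: h; case: mu. Qed.

Section locally_finite_measures.
Context {R : realType} {n : nat}.
Local Notation X := (borelRn R n).
Variable mu : {measure set X -> \bar R}.

Lemma eball_le (m : {measure set X -> \bar R}) x (r s : R) : (r <= s)%R ->
  m (eball x r) <= m (eball x s).
Proof.
move=> rs; apply: le_measure; rewrite ?inE; [exact: measurable_eball|exact: measurable_eball|].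
by move=> y /lt_le_trans; apply.
Qed.

Lemma measurable_open (U : set 'rV[R]_n) : open U -> measurable (U : set X).
Proof. exact: sub_sigma_algebra. Qed.

Hypothesis mu_lf : locally_finite mu.

(** The ball lies in a compact box, which finitely many open sets of finite measure cover. *)
Lemma locally_finite_ball x r : mu (eball x r) < +oo.
Proof.
have [U HU] := choice (fun y => (let: ex_intro2 U a b := mu_lf y in
  ex_intro (fun U => open_nbhs y U /\ mu U < +oo) U (conj a b))).
pose A := [set y : 'rV[R]_n | forall c, y ord0 c \in `[(x ord0 c - r)%R, (x ord0 c + r)%R]].
have cA : compact A.
  apply: (@rV_compact _ _ (fun c => `[(x ord0 c - r)%R, (x ord0 c + r)%R]%classic)).
  by move=> c; exact: segment_compact.
move: cA; rewrite compact_cover => /(_ _ setT U) [].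
- by move=> y _; case: (HU y) => -[].
- by move=> y _; exists y => //; case: (HU y) => -[].
move=> D _; move: (finite_fset D); set E := (X in finite_set X) => fE AD.
have mU y : measurable (U y : set X) by apply: measurable_open; case: (HU y) => -[].
have BA : eball x r `<=` \bigcup_(y in E) U y.
  move=> y yr; apply: AD => c; rewrite in_itv/=.
  have := le_lt_trans (coord_le_dist x y c) yr; rewrite ltr_norml => /andP[h1 h2].
  by apply/andP; split; lra.
apply: (@le_lt_trans _ _ (mu (\bigcup_(y in E) U y))).
  apply: le_measure => //; rewrite inE; first exact: measurable_eball.
  by apply: fin_bigcup_measurable.
have mBU : measurable (\bigcup_(y in E) U y : set X) by apply: fin_bigcup_measurable.
have h := content_sub_fsum mu fE (fun y _ => mU y) mBU (@subset_refl _ _).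
apply: (le_lt_trans h).
rewrite fsbig_finite//=; apply: lte_sum_pinfty => y _; case: (HU y) => //.
Qed.

Lemma bigcup_eball (x : X) (r : nat -> R) : (forall M : R, exists m, (M < r m)%R) ->
  \bigcup_m eball x (r m) = setT.
Proof.
move=> hr; apply/seteqP; split => // y _.
by have [m hm] := hr (euclid_dist x y); exists m.
Qed.

Lemma locally_finite_sigma_finite : sigma_finite setT mu.
Proof.
exists (fun m => eball 0 m%:R).
  rewrite bigcup_eball// => M; exists (Num.truncn M).+1.
  by have [M0|M0] := leP 0%R M; [exact: truncnS_gt|apply: lt_le_trans M0 _].
by move=> m; split; [exact: measurable_eball|exact: locally_finite_ball].
Qed.

End locally_finite_measures.

Section doubling_measures.
Context {R : realType} {n : nat}.
Local Notation X := (borelRn R n).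
Variable sigma : {measure set X -> \bar R}.

Lemma doubling_ge1_cst : doubling sigma -> exists2 C : R, (1 <= C)%R &
  forall (x : 'rV[R]_n) (r : R), (0 < r)%R ->
    sigma (eball x (2 * r)%R) <= C%:E * sigma (eball x r).
Proof.
move=> [_ [C HC]]; exists (Num.max C 1%R); first by rewrite le_max lexx orbT.
move=> x r r0; apply: (le_trans (HC x r r0)); apply: lee_wpmul2r => //.
by rewrite lee_fin le_max lexx.
Qed.

Variable C : R.
Hypothesis C1 : (1 <= C)%R.
Hypothesis sigmaD : forall (x : 'rV[R]_n) (r : R), (0 < r)%R ->
  sigma (eball x (2 * r)%R) <= C%:E * sigma (eball x r).
Let C0 : (0 <= C)%R. Proof. by rewrite (le_trans _ C1). Qed.

Lemma doubling_iter w x r : (0 < r)%R ->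
  sigma (eball x (2 ^+ w * r)%R) <= (C ^+ w)%:E * sigma (eball x r).
Proof.
move=> r0; elim: w => [|w IH]; first by rewrite !expr0 mul1r mul1e.
rewrite exprS -mulrA; apply: (le_trans (sigmaD x _)).
  by rewrite mulr_gt0// exprn_gt0.
by rewrite exprS (EFinM C) -muleA; apply: lee_wpmul2l; rewrite ?lee_fin.
Qed.

(** If one ball were null, doubling would make all its dilates null, and these exhaust the space. *)
Lemma doubling_ball_gt0 x r : (exists2 S : set X, measurable S & sigma S != 0) ->
  (0 < r)%R -> 0 < sigma (eball x r).
Proof.
move=> [S mS S0] r0; rewrite lt_neqAle measure_ge0 andbT eq_sym; apply/eqP => B0.
move/eqP: S0; apply.
apply/eqP; rewrite eq_le measure_ge0 andbT.
have zero w : sigma (eball x (2 ^+ w * r)%R) = 0.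
  apply/eqP; rewrite eq_le measure_ge0 andbT.
  by apply: (le_trans (doubling_iter w x r0)); rewrite B0 mule0.
have cover : \bigcup_w eball x (2 ^+ w * r)%R = setT.
  apply: bigcup_eball => M; exists (Num.truncn (`|M| / r)).+1.
  have h : (`|M| / r < (Num.truncn (`|M| / r)).+1%:R)%R by exact: truncnS_gt.
  apply: (le_lt_trans (ler_norm M)); rewrite -ltr_pdivrMr//.
  by apply: (lt_trans h); rewrite -natrX ltr_nat ltn_expl.
apply: (@le_trans _ _ (\sum_(w <oo) sigma (eball x (2 ^+ w * r)%R))).
  apply: measure_sigma_subadditive => //; last by rewrite cover.
  by move=> w; exact: measurable_eball.
by rewrite eseries0// => w _ _; exact: zero.
Qed.

Hypothesis ball_gt0 : forall x r, (0 < r)%R -> 0 < sigma (eball x r).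
Hypothesis ball_lty : forall x r, sigma (eball x r) < +oo.
Hypothesis n0 : (0 < n)%N.

(* With [8 * n] the neighbourhood of a cube of side [d] contains the balls of radius [8 n d]; [2 ^+ doubling_order] is the number of dilations by which a ball inscribed in a half cube covers that neighbourhood. *)
Definition nbhd_radius : nat := (8 * n)%N.
Definition doubling_order : nat := (4 * n * nbhd_radius.+2).+1.
Local Notation K := nbhd_radius.
Definition cube_doubling_cst : R := (C ^+ doubling_order)%R.
Local Notation Th := cube_doubling_cst.

Lemma measurable_cube_nbhd (m : nat) d x : measurable (cube_nbhd m d x : set X).
Proof. by apply: measurable_section; exact: measurable_cube_nbhd_rel. Qed.

Lemma measurable_cell d x : measurable (cube d x : set X).
Proof. by apply: measurable_section; exact: measurable_cube_rel. Qed.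

(** The comparison reaches the half cube, not only the cube: this gains one generation, which both
    the annulus estimate and the comparison with balls spend. *)
Lemma nbhd_le_half_cube d x : (0 < d)%R ->
  sigma (cube_nbhd K d x) <= Th%:E * sigma (cube (d / 2)%R x).
Proof.
move=> d0; have d20 : (0 < d / 2)%R by rewrite divr_gt0.
have d40 : (0 < d / 2 / 2)%R by rewrite divr_gt0.
apply: (@le_trans _ _ (sigma (eball (cube_center (d / 2)%R x)
    (2 ^+ doubling_order * (d / 2 / 2))%R))).
  apply: le_measure; rewrite ?inE.
  - exact: measurable_cube_nbhd.
  - exact: measurable_eball.
  - by move=> y; apply: cube_nbhd_ball.
apply: (le_trans (doubling_iter _ _ d40)); apply: lee_wpmul2l.
  by rewrite lee_fin exprn_ge0.
apply: le_measure; rewrite ?inE.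
- exact: measurable_eball.
- exact: measurable_cell.
- by move=> y; exact: ball_center_sub.
Qed.

Lemma half_cube_le d x : sigma (cube (d / 2)%R x) <= sigma (cube d x).
Proof.
by apply: le_measure; rewrite ?inE; [exact: measurable_cell|exact: measurable_cell|exact: cube_half].
Qed.

Lemma sub_cube_nbhd (m : nat) d (x y : 'rV[R]_n) : cube d x y -> cube_nbhd m d x y.
Proof. by move=> xy c; rewrite xy subrr. Qed.

Lemma cube_le_cube_nbhd d x : sigma (cube d x) <= sigma (cube_nbhd K d x).
Proof.
by apply: le_measure; rewrite ?inE; [exact: measurable_cell|exact: measurable_cube_nbhd|exact: sub_cube_nbhd].
Qed.

Lemma cube_doubling_ge1 : (1 <= Th)%R.
Proof. exact: exprn_ege1. Qed.

(** The annulus contains a sibling half cube, and the neighbourhood of the sibling's centre of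
    reference [y] contains the whole cube. *)
Lemma cube_annulus d x : (0 < d)%R ->
  sigma (cube d x) <= Th%:E * sigma (cube d x `\` cube (d / 2)%R x).
Proof.
move=> d0; have [y [xy yz]] := cube_sibling x (Ordinal n0) d0.
have -> : cube d x = cube d y by apply/seteqP; split => z h c; rewrite h (xy c).
apply: (le_trans (cube_le_cube_nbhd d y)); apply: (le_trans (nbhd_le_half_cube _ d0)).
apply: lee_wpmul2l; first by rewrite lee_fin exprn_ge0.
apply: le_measure; rewrite ?inE.
- exact: measurable_cell.
- by apply: measurableD; exact: measurable_cell.
- move=> z hz; have [h1 h2] := yz z hz; split => // c.
  by rewrite h1 (xy c).
Qed.

Definition scale (D : R) (i : nat) : R := (D / 2 ^+ i)%R.

Lemma scaleS D i : scale D i.+1 = (scale D i / 2)%R.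
Proof. by rewrite /scale exprSr invfM mulrA. Qed.

Lemma scale_gt0 D i : (0 < D)%R -> (0 < scale D i)%R.
Proof. by move=> D0; rewrite divr_gt0// exprn_gt0. Qed.

Definition dyadic_cube (D : R) (i : nat) : X -> set X := cube (scale D i).
Definition dyadic_nbhd (D : R) (i : nat) : X -> set X := cube_nbhd K (scale D i).

Lemma dyadic_cube_system D : (0 < D)%R ->
  cube_system sigma (dyadic_cube D) (dyadic_nbhd D) Th.
Proof.
move=> D0; split.
- by move=> i x c.
- by move=> i x y h c; rewrite h.
- by move=> i x y z h h' c; rewrite h' h.
- by move=> i x y; rewrite /dyadic_cube scaleS; exact: cube_half.
- by move=> i x y h c; rewrite distrC.
- by move=> i x y; exact: sub_cube_nbhd.
- move=> i x y; rewrite /dyadic_nbhd scaleS; apply: cube_nbhd_half.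
  by rewrite muln_gt0.
- by move=> i x y z h h' c; rewrite -(h c).
- by move=> i; exact: measurable_cube_rel.
- by move=> i; exact: measurable_cube_nbhd_rel.
- move=> i x; have d0 := scale_gt0 i D0.
  apply: (@lt_le_trans _ _ (sigma (eball (cube_center (scale D i) x) (scale D i / 2)%R))).
    by apply: ball_gt0; rewrite divr_gt0.
  apply: le_measure; rewrite ?inE; [exact: measurable_eball|exact: measurable_cell|].
  by move=> y; exact: ball_center_sub.
- move=> i x; have d0 := scale_gt0 i D0.
  apply: le_lt_trans (ball_lty (cube_center (scale D i / 2)%R x)
    (2 ^+ doubling_order * (scale D i / 2 / 2))%R).
  apply: le_measure; rewrite ?inE; [exact: measurable_cube_nbhd|exact: measurable_eball|].
  by move=> y; apply: cube_nbhd_ball.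
- move=> i x; apply: (le_trans (nbhd_le_half_cube x (scale_gt0 i D0))).
  by apply: lee_wpmul2l; [rewrite lee_fin exprn_ge0|exact: half_cube_le].
- exact: cube_doubling_ge1.
Qed.

Lemma measurable_singleton (x : X) : measurable ([set x] : set X).
Proof.
rewrite -[X in measurable X]setCK; apply: measurableC; apply: measurable_open.
by apply: closed_openC; apply: accessible_closed_set1; exact: hausdorff_accessible (@norm_hausdorff _ _).
Qed.

(* The sets [Q i `\` Q i.+1] are disjoint, and each carries at least the mass of the point up to the factor [Th]. *)
Lemma doubling_no_atom (x : X) : sigma [set x] = 0.
Proof.
pose Q i := cube (scale 1 i) x : set X; pose ann i := Q i `\` Q i.+1.
have mQ i : measurable (Q i) by exact: measurable_cell.
have mA i : measurable (ann i) by exact: measurableD.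
have nest i j : (i <= j)%N -> Q j `<=` Q i.
  move=> /subnK <-; elim: (j - i)%N => [//|m IH] y hy; apply: IH.
  by apply: cube_half; rewrite -scaleS -addSn.
have triv : trivIset setT ann.
  apply/trivIsetP => i j _ _; wlog : i j / (i < j)%N.
    move=> H; rewrite neq_lt => /orP[ij|ji]; first by apply: H => //; rewrite lt_eqF.
    by rewrite setIC; apply: H => //; rewrite lt_eqF.
  by move=> ij _; rewrite -subset0 => y [[_ h] [h' _]]; apply: h; exact: nest ij y h'.
have Q0fin : sigma (Q 0%N) < +oo.
  have d0 := scale_gt0 0 (ltr01 : (0 < 1 :> R)%R).
  apply: le_lt_trans (nbhd_lty (dyadic_cube_system ltr01) 0%N x).
  exact: cube_le_cube_nbhd.
have le1 i : sigma [set x] <= Th%:E * sigma (ann i).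
  apply: (@le_trans _ _ (sigma (Q i))).
    by apply: le_measure; rewrite ?inE//; [exact: measurable_singleton|move=> _ ->].
  apply: (le_trans (cube_annulus x (scale_gt0 i ltr01))).
  by rewrite /ann /Q scaleS.
have Th0 : 0 <= Th%:E by rewrite lee_fin exprn_ge0.
have bound : \sum_(i <oo) sigma [set x] <= Th%:E * sigma (Q 0%N).
  apply: (@le_trans _ _ (\sum_(i <oo) (Th%:E * sigma (ann i)))).
    by apply: lee_nneseries => // i _.
  rewrite nneseriesZl//; apply: lee_wpmul2l => //.
  have -> : \sum_(i <oo) sigma (ann i) = sigma (\bigcup_i ann i).
    by rewrite measure_bigcup//; apply: eq_eseriesl => i; rewrite in_setT.
  apply: le_measure; rewrite ?inE//; first exact: bigcup_measurable.
  by move=> y [i _ [h _]]; exact: nest (leq0n i) y h.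
apply/eqP; rewrite eq_le measure_ge0 andbT leNgt; apply/negP => a0.
move: bound; apply/negP; rewrite -ltNge.
apply: (@lt_le_trans _ _ +oo); first by apply: lte_mul_pinfty.
rewrite -ge0_integral_count// integral_cst//.
change (+oo <= sigma [set x] * @counting nat R setT).
by rewrite /counting asboolF ?gt0_muley//; exact: infinite_nat.
Qed.

End doubling_measures.

(** * Kernels and nonlinear potentials *)

Section kernel_weights.
Context {R : realType}.
Local Open Scope ring_scope.

Lemma nonincreasing_in_measurable (D : set R) (f : R -> R) : is_interval D ->
  {in D &, nonincreasing_fun f} -> measurable_fun D f.
Proof.
move=> iD f_ni; have mD : measurable D by exact: is_interval_measurable.
apply: (measurability (@RGenCInfty.G R)) => [|/= _ [_] [r] -> <-].
  exact: RGenCInfty.measurableE.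
apply: is_interval_measurable => s t/= [Ds].
rewrite !in_itv/= !andbT => fs [Dt ft] u /andP[su ut].
have Du : D u by apply: (iD s t) => //; rewrite su.
by split => //; rewrite in_itv/= andbT (le_trans ft)// f_ni ?inE.
Qed.

Variable k : R -> R.
Hypothesis k_ge0 : forall r : R, 0 < r -> 0 <= k r.
Hypothesis k_noninc : forall r s : R, 0 < r -> r <= s -> k s <= k r.

(** The values of [k] on nonpositive reals are arbitrary; cutting them off makes the function
    measurable on the whole line, as Tonelli's theorem requires. *)
Definition kernel_weight (s : R) : R := if 0 < s then k s / s else 0.

Lemma kernel_weight_ge0 s : 0 <= kernel_weight s.
Proof. by rewrite /kernel_weight; case: ifPn => // s0; rewrite divr_ge0 ?k_ge0// ltW. Qed.

Definition kernel_pos (r : R) : R := if 0 < r then k r else 0.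

Lemma kernel_pos_ge0 r : 0 <= kernel_pos r.
Proof. by rewrite /kernel_pos; case: ifPn => // /k_ge0. Qed.

Lemma measurable_kernel_pos : measurable_fun setT kernel_pos.
Proof.
rewrite (_ : kernel_pos = k \_ (`]0, +oo[%classic : set R)); last first.
  apply/funext => s; rewrite /kernel_pos /patch.
  have -> : (s \in (`]0, +oo[%classic : set R)) = (0 < s); last by [].
  by apply/idP/idP; rewrite inE/= in_itv/= andbT.
apply/(measurable_restrictT _ _).1 => //; apply: nonincreasing_in_measurable.
  exact: interval_is_interval.
by move=> r s; rewrite !inE/= !in_itv/= !andbT => r0 s0; exact: k_noninc.
Qed.

Lemma measurable_kernel0 : measurable_fun setT (kernel0 k).
Proof.
rewrite (_ : kernel0 k = fun r => if 0 < r then (kernel_pos r)%:E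
                                  else lim ((k s)%:E @[s --> 0^'+])); last first.
  by apply/funext => r; rewrite /kernel0 /kernel_pos; case: ifP.
apply: measurable_fun_ifT => //; first exact: measurable_fun_ltr.
by apply/measurable_EFinP; exact: measurable_kernel_pos.
Qed.

Lemma measurable_kernel_weight : measurable_fun setT kernel_weight.
Proof.
rewrite (_ : kernel_weight = (fun s => k s / s) \_ (`]0, +oo[%classic : set R)); last first.
  apply/funext => s; rewrite /kernel_weight /patch.
  have -> : (s \in (`]0, +oo[%classic : set R)) = (0 < s); last by [].
  by apply/idP/idP; rewrite inE/= in_itv/= andbT.
apply/(measurable_restrictT _ _).1 => //; apply: nonincreasing_in_measurable.
  exact: interval_is_interval.
move=> r s; rewrite !inE/= !in_itv/= !andbT => r0 s0 rs.
rewrite ler_pM ?k_ge0// ?invr_ge0 ?(ltW s0)//; first exact: k_noninc.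
by rewrite lef_pV2 ?posrE.
Qed.

End kernel_weights.

(** * Joint measurability of the potentials *)

Section potentials_measurable.
Context {R : realType} {n : nat}.
Local Notation X := (borelRn R n).
Variables sigma mu : {sigma_finite_measure set X -> \bar R}.
Variable k : R -> R.
Hypothesis k_ge0 : forall r : R, (0 < r)%R -> (0 <= k r)%R.
Hypothesis k_noninc : forall r s : R, (0 < r)%R -> (r <= s)%R -> (k s <= k r)%R.
Local Notation w := (kernel_weight k).

Lemma measurable_fun_lt_EFin d (T : measurableType d) (f g : T -> R) :
  measurable_fun setT f -> measurable_fun setT g ->
  measurable_fun setT (fun z => ((f z < g z)%R : bool)%:R%:E : \bar R).
Proof.
move=> mf mg; apply: (eq_measurable_fun (fun z => (\1_[set z | (f z < g z)%R] z)%:E)).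
  by move=> z _; rewrite indicE; congr ((_ : bool)%:R%:E); apply/idP/idP; rewrite inE.
apply: measurable_EFin_indic; rewrite -[X in measurable X]setTI.
exact: (measurable_fun_ltr mf mg measurableT (Y := [set true])).
Qed.

Lemma measurable_ball_indic (f : X * R * X -> X) (g : X * R * X -> X) (h : X * R * X -> R) :
  measurable_fun setT f -> measurable_fun setT g -> measurable_fun setT h ->
  measurable_fun setT (fun z => ((euclid_dist (f z) (g z) < h z)%R : bool)%:R%:E : \bar R).
Proof.
move=> mf mg mh; apply: measurable_fun_lt_EFin => //.
have mfg : measurable_fun setT (fun z => (f z, g z)) by apply/measurable_fun_pairP; split.
exact: (measurableT_comp measurable_euclid_dist mfg).
Qed.

Lemma indic_eball x r (y : X) :
  (\1_(eball x r) y)%:E = ((euclid_dist x y < r)%R : bool)%:R%:E :> \bar R.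
Proof. by rewrite indicE; congr ((_ : bool)%:R%:E); apply/idP/idP; rewrite inE. Qed.

Lemma measurable_int_ball (m : {sigma_finite_measure set X -> \bar R}) (F : X * R -> \bar R) :
  measurable_fun setT F -> (forall z, 0 <= F z) ->
  measurable_fun setT (fun z : X * R => \int[m]_(y in eball z.1 z.2) F (y, z.2)).
Proof.
move=> mF F0; pose G (u : X * R * X) := F (u.2, u.1.2) *
  ((euclid_dist u.1.1 u.2 < u.1.2)%R : bool)%:R%:E.
apply: (eq_measurable_fun (fun z => \int[m]_y G (z, y))).
  move=> z _; rewrite (integral_in_indic m (eball z.1 z.2) (fun y => F (y, z.2))).
  by apply: eq_integral => y _; rewrite /G/= indic_eball.
apply: (@measurable_fun_fubini_tonelli_F _ _ _ _ _ m G).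
  apply: emeasurable_funM.
    apply: (measurableT_comp mF); apply/measurable_fun_pairP; split.
      exact: measurable_snd.
    exact: (measurableT_comp measurable_snd measurable_fst).
  apply: measurable_ball_indic; last 2 first.
  - exact: measurable_snd.
  - exact: (measurableT_comp measurable_snd measurable_fst).
  - exact: (measurableT_comp measurable_fst measurable_fst).
by move=> u; rewrite mule_ge0.
Qed.

Lemma measurable_ball_mass (m : {sigma_finite_measure set X -> \bar R}) :
  measurable_fun setT (fun z : X * R => m (eball z.1 z.2)).
Proof.
apply: (eq_measurable_fun (fun z : X * R => \int[m]_(y in eball z.1 z.2) (cst 1 : X * R -> \bar R) (y, z.2))).
  by move=> z _; rewrite integral_cst ?mul1e//; exact: measurable_eball.
by apply: measurable_int_ball.
Qed.

Lemma patch_itv0 (F : R -> \bar R) r s :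
  (F \_ (`]0%R, r[%classic : set R)) s = if (0 < s)%R then (if (s < r)%R then F s else 0) else 0.
Proof.
rewrite /patch; have -> : (s \in (`]0%R, r[%classic : set R)) = (0 < s < r)%R.
  by apply/idP/idP; rewrite inE/= in_itv/=.
by case: (0 < s)%R; case: (s < r)%R.
Qed.

Definition kernel_int (r : R) (x : X) : \bar R :=
  \int[lebesgue_measure]_(s in `]0%R, r[) ((w s)%:E * sigma (eball x s)).

Lemma kbarE r x : kbar k sigma r x = (sigma (eball x r))^-1 * kernel_int r x.
Proof.
congr (_ * _); apply: eq_integral => s; rewrite inE/= in_itv/= => /andP[s0 _].
by rewrite /kernel_weight s0 EFinM muleAC.
Qed.

Lemma kernel_int_ge0 r x : 0 <= kernel_int r x.
Proof. by apply: integral_ge0 => s _; rewrite mule_ge0// lee_fin kernel_weight_ge0. Qed.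

Lemma kbar_ge0 r x : 0 <= kbar k sigma r x.
Proof. by rewrite kbarE mule_ge0 ?inve_ge0// kernel_int_ge0. Qed.

Lemma measurable_weighted_mass :
  measurable_fun setT (fun z : X * R => (w z.2)%:E * sigma (eball z.1 z.2)).
Proof.
apply: emeasurable_funM; last exact: measurable_ball_mass.
apply/measurable_EFinP; apply: (measurableT_comp (measurable_kernel_weight _ _)) => //.
Qed.

Lemma measurable_kernel_int : measurable_fun setT (fun z : X * R => kernel_int z.2 z.1).
Proof.
pose G (u : X * R * R) := (w u.2)%:E * sigma (eball u.1.1 u.2) *
  ((u.2 < u.1.2)%R : bool)%:R%:E.
apply: (eq_measurable_fun (fun z : X * R => \int[lebesgue_measure]_s G (z, s))).
  move=> z _; rewrite /kernel_int [RHS]integral_mkcond; apply: eq_integral => s _.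
  rewrite /G/= patch_itv0; have [s0|s0] := ltP 0%R s; first by case: ifP; rewrite ?mule1 ?mule0.
  by rewrite /kernel_weight ltNge s0/= !mul0e.
apply: (@measurable_fun_fubini_tonelli_F _ _ _ _ _ lebesgue_measure G).
  apply: emeasurable_funM.
    have mp : measurable_fun setT (fun u : X * R * R => (u.1.1, u.2)).
      apply/measurable_fun_pairP; split; last exact: measurable_snd.
      exact: (measurableT_comp measurable_fst measurable_fst).
    exact: (measurableT_comp measurable_weighted_mass mp).
  apply: measurable_fun_lt_EFin; first exact: measurable_snd.
  exact: (measurableT_comp measurable_snd measurable_fst).
by move=> u; rewrite !mule_ge0 ?lee_fin ?kernel_weight_ge0.
Qed.

Lemma measurable_kbar : measurable_fun setT (fun z : X * R => kbar k sigma z.2 z.1).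
Proof.
under eq_fun do rewrite kbarE; apply: emeasurable_funM; last exact: measurable_kernel_int.
by apply: measurable_inve => //; exact: measurable_ball_mass.
Qed.

Definition wolff_density (p : R) (x : X) (r : R) : \bar R :=
  (w r)%:E * (sigma (eball x r) *
    (\int[mu]_(y in eball x r) kbar k sigma r y) `^ (conjexp p - 1)).

Lemma wolff_density_ge0 p x r : 0 <= wolff_density p x r.
Proof. by rewrite !mule_ge0 ?poweR_ge0// lee_fin kernel_weight_ge0. Qed.

Lemma measurable_wolff_density p :
  measurable_fun setT (fun z : X * R => wolff_density p z.1 z.2).
Proof.
rewrite /wolff_density; under eq_fun do rewrite muleA.
apply: emeasurable_funM; first exact: measurable_weighted_mass.
apply: (measurableT_comp (measurable_poweR _)).
apply: (measurable_int_ball mu (F := fun z => kbar k sigma z.2 z.1)); first exact: measurable_kbar.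
by move=> z; exact: kbar_ge0.
Qed.

Definition wolff_trunc (p r : R) (x : X) : \bar R :=
  \int[lebesgue_measure]_(s in `]0%R, r[) wolff_density p x s.

Lemma wolffE p x : wolff k sigma mu p x =
  \int[lebesgue_measure]_(s in `]0%R, +oo[) wolff_density p x s.
Proof.
apply: eq_integral => s; rewrite inE/= in_itv/= andbT => s0.
by rewrite /wolff_density /kernel_weight s0 EFinM [LHS](ACl ((1*4)*(2*3)))%AC.
Qed.

Lemma measurable_wolff p : measurable_fun setT (wolff k sigma mu p).
Proof.
apply: (eq_measurable_fun (fun x => \int[lebesgue_measure]_s wolff_density p x s)).
  move=> x _; rewrite wolffE [RHS]integral_mkcond; apply: eq_integral => s _; rewrite /patch.
  case: ifPn => //; rewrite notin_setE/= in_itv/= andbT => /negP s0.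
  by rewrite /wolff_density /kernel_weight (negbTE s0) mul0e.
apply: (@measurable_fun_fubini_tonelli_F _ _ _ _ _ lebesgue_measure
  (fun z : X * R => wolff_density p z.1 z.2)); first exact: measurable_wolff_density.
by move=> z; exact: wolff_density_ge0.
Qed.

Lemma measurable_wolff_trunc p r : measurable_fun setT (wolff_trunc p r).
Proof.
pose G (z : X * R) := wolff_density p z.1 z.2 * ((z.2 < r)%R : bool)%:R%:E.
apply: (eq_measurable_fun (fun x => \int[lebesgue_measure]_s G (x, s))).
  move=> x _; rewrite /wolff_trunc [RHS]integral_mkcond; apply: eq_integral => s _.
  rewrite /G/= patch_itv0; have [s0|s0] := ltP 0%R s; first by case: ifP; rewrite ?mule1 ?mule0.
  by rewrite /wolff_density /kernel_weight ltNge s0/= !mul0e.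
apply: (@measurable_fun_fubini_tonelli_F _ _ _ _ _ lebesgue_measure G).
  apply: emeasurable_funM; first exact: measurable_wolff_density.
  by apply: measurable_fun_lt_EFin; [exact: measurable_snd|exact: measurable_cst].
by move=> u; rewrite mule_ge0 ?wolff_density_ge0.
Qed.

End potentials_measurable.

(** * Removing the diagonal from the kernel *)

Section off_diagonal.
Context {R : realType} {n : nat}.
Local Notation X := (borelRn R n).
Variable sigma : {measure set X -> \bar R}.
Variable k : R -> R.
Hypothesis k_ge0 : forall r : R, (0 < r)%R -> (0 <= k r)%R.
Hypothesis k_noninc : forall r s : R, (0 < r)%R -> (r <= s)%R -> (k s <= k r)%R.
Hypothesis no_atom : forall x : X, sigma [set x] = 0.
Hypothesis measurable_point : forall x : X, measurable ([set x] : set X).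
Implicit Types (x y : X) (f : X -> R).

(* The value of the kernel at 0 is replaced by 0, which is harmless since [sigma] has no atoms. *)
Definition offdiag f x y : \bar R := (kernel_pos k (euclid_dist x y) * f y)%:E.

Lemma measurable_offdiag f : measurable_fun setT f ->
  measurable_fun setT (fun z : X * X => offdiag f z.1 z.2).
Proof.
move=> mf; apply/measurable_EFinP; apply: measurable_funM.
  exact: (measurableT_comp (measurable_kernel_pos k_noninc) measurable_euclid_dist).
exact: (measurableT_comp mf measurable_snd).
Qed.

Lemma measurable_offdiag_at f x : measurable_fun setT f -> measurable_fun setT (offdiag f x).
Proof.
by move=> mf; exact: (measurableT_comp (measurable_offdiag mf) (pair1_measurable x)).
Qed.

Lemma measurable_kernel0_at f x : measurable_fun setT f ->
  measurable_fun setT (fun y => kernel0 k (euclid_dist x y) * (f y)%:E).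
Proof.
move=> mf; apply: emeasurable_funM; last exact/measurable_EFinP.
apply: (measurableT_comp (measurable_kernel0 k_noninc)).
exact: measurable_dist.
Qed.

Lemma kernel0_offdiag f x : ae_eq sigma setT
  (fun y => kernel0 k (euclid_dist x y) * (f y)%:E) (offdiag f x).
Proof.
exists [set x]; split => // y /= h; apply: contrapT => yx; apply: h => _.
rewrite /offdiag /kernel0 /kernel_pos dist_gt0//.
by move=> xy; apply: yx.
Qed.

Lemma Tk_offdiag f x : measurable_fun setT f ->
  Tk k sigma f x = \int[sigma]_y offdiag f x y.
Proof.
move=> mf; apply: ae_eq_integral => //; first exact: measurable_kernel0_at.
  exact: measurable_offdiag_at.
exact: kernel0_offdiag.
Qed.

Lemma integral_abs_kernel0 f x : measurable_fun setT f ->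
  \int[sigma]_y `|kernel0 k (euclid_dist x y) * (f y)%:E| =
  \int[sigma]_y offdiag (fun y => `|f y|%R) x y.
Proof.
move=> mf; apply: ae_eq_integral => //.
- by apply: measurableT_comp => //; exact: measurable_kernel0_at.
- by apply: measurable_offdiag_at; exact: measurableT_comp.
- have [S [mS S0 hS]] := kernel0_offdiag f x; exists S; split => // y h; apply: hS => h'.
  by apply: h => _; rewrite h'//= normrM ger0_norm// kernel_pos_ge0.
Qed.

End off_diagonal.

(** * Comparison of balls with dyadic cubes *)

Section ereal_complements.
Context {R : realType}.

Lemma inve_le_scale (a b : \bar R) (c : R) : 0 < a -> a < +oo -> 0 < b -> b < +oo ->
  b <= c%:E * a -> a^-1 <= c%:E * b^-1.
Proof.
case: a => [a| |]//; case: b => [b| |]//; rewrite !lte_fin => a0 _ b0 _ h.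
have bne : b != 0%R by rewrite gt_eqF.
have ane : a != 0%R by rewrite gt_eqF.
rewrite !inver (negbTE bne) (negbTE ane) -EFinM lee_fin ler_pdivlMr// mulrC ler_pdivrMr//.
Qed.

Lemma nneseries_shift (a : nat -> \bar R) i : (forall l, 0 <= a l) ->
  \sum_(l <oo | (i <= l)%N) a l.+1 = \sum_(l <oo | (i.+1 <= l)%N) a l.
Proof.
move=> a0; rewrite [LHS]eseries_mkcond [RHS]eseries_mkcond [RHS]nneseries_recl//=.
rewrite add0e -[RHS](@nneseries_addn _ _ 1%N)/=; last by move=> l; case: ifP.
by apply: eq_eseriesr => l _; rewrite addn1.
by move=> l _; case: ifP.
Qed.

Lemma nneseries_suffix_le (a : nat -> \bar R) i j : (forall l, 0 <= a l) -> (i <= j)%N ->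
  \sum_(l <oo | (j <= l)%N) a l <= \sum_(l <oo | (i <= l)%N) a l.
Proof.
move=> a0 ij; rewrite [leLHS]eseries_mkcond [leRHS]eseries_mkcond.
apply: lee_nneseries => [l _ _|l _]; first by case: ifP.
by case: ifPn => [jl|_]; [rewrite (leq_trans ij)|case: ifP].
Qed.

End ereal_complements.

Section dyadic_radii.
Context {R : realType}.
Implicit Types (f g : R -> \bar R) (a r s : R) (c : \bar R).
Local Notation leb := (@lebesgue_measure R).

Lemma lebesgue_dyadic a : (0 < a)%R -> leb `[a, (2 * a)%R[%classic = a%:E.
Proof.
move=> a0; rewrite lebesgue_measure_itv/= lte_fin ifT; last lra.
by rewrite -EFinD; congr _%:E; lra.
Qed.

(** On [a, 2a) the measure ds/s has mass at least 1/2, as 1/s > 1/(2a); the companion lemma uses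
    that it is at most 1. *)
Lemma int_dyadic_ge f c a : (0 < a)%R -> 0 <= c -> (forall s, 0 <= f s) ->
  (forall s, (a <= s < 2 * a)%R -> c * (s^-1)%:E <= f s) ->
  c <= 2%:E * \int[leb]_(s in `[a, (2 * a)%R[) f s.
Proof.
move=> a0 c0 f0 H.
have a20 : (0 < 2 * a)%R by lra.
have i0 : 0 <= c * ((2 * a)^-1)%:E by rewrite mule_ge0// lee_fin invr_ge0 ltW.
have -> : c = 2%:E * (c * ((2 * a)^-1)%:E * a%:E).
  rewrite -(muleA c) -EFinM muleCA -EFinM (_ : (2 * ((2 * a)^-1 * a) = 1)%R) ?mule1//.
  by field; rewrite gt_eqF.
apply: lee_wpmul2l => //.
rewrite -(lebesgue_dyadic a0) -integral_cst//.
apply: ge0_le_int => // s; rewrite /= in_itv/= => /andP[h1 h2].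
apply: le_trans (H s _); last by rewrite h1.
apply: lee_wpmul2l => //; rewrite lee_fin lef_pV2 ?posrE//; first exact: ltW.
exact: lt_le_trans h1.
Qed.

Lemma int_dyadic_le f c a : (0 < a)%R -> 0 <= c -> (forall s, 0 <= f s) ->
  (forall s, (a <= s < 2 * a)%R -> f s <= c * (s^-1)%:E) ->
  \int[leb]_(s in `[a, (2 * a)%R[) f s <= c.
Proof.
move=> a0 c0 f0 H.
have i0 : 0 <= c * (a^-1)%:E by rewrite mule_ge0// lee_fin invr_ge0 ltW.
have -> : c = c * (a^-1)%:E * a%:E.
  by rewrite -muleA -EFinM mulVf ?gt_eqF// mule1.
rewrite -[in leRHS](lebesgue_dyadic a0) -integral_cst//.
apply: ge0_le_int => // s; rewrite /= in_itv/= => /andP[h1 h2].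
apply: (le_trans (H s _)); first by rewrite h1.
apply: lee_wpmul2l => //; rewrite lee_fin lef_pV2 ?posrE//.
exact: lt_le_trans h1.
Qed.

Variable r : nat -> R.
Hypothesis r0 : (0 < r 0%N)%R.
Hypothesis rS : forall i, r i = (2 * r i.+1)%R.

Lemma radii_gt0 i : (0 < r i)%R.
Proof. by elim: i => // i; rewrite (rS i) pmulr_rgt0. Qed.

Lemma radii_nonincreasing i j : (i <= j)%N -> (r j <= r i)%R.
Proof.
move=> /subnK <-; elim: (j - i)%N => [//|m IH]; apply: le_trans IH.
by rewrite addSn (rS (m + i)%N); have := radii_gt0 (m + i).+1; lra.
Qed.

Lemma radii_itv i s : (0 < s < r i)%R -> exists2 l, (i <= l)%N & (r l.+1 <= s < r l)%R.
Proof.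
move=> /andP[s0 sr].
have rE m : (r (m + i)%N = r i / 2 ^+ m)%R.
  elim: m => [|m IH]; first by rewrite expr0 divr1.
  by rewrite exprS; move: IH; rewrite (rS (m + i)%N) addSn => IH;
     rewrite invfM mulrCA -IH mulrA mulVf ?mul1r.
have ex : exists m, (r (m + i)%N <= s)%R.
  exists (Num.truncn (r i / s)).+1; rewrite rE ler_pdivrMr ?exprn_gt0//.
  rewrite mulrC -ler_pdivrMr//; apply: ltW; apply: (lt_le_trans (truncnS_gt _)).
  by rewrite -natrX ler_nat ltnW// ltn_expl.
case: (ex_minnP ex) => m rm mmin.
case: m rm mmin => [|m] rm mmin; first by move: rm; rewrite add0n leNgt sr.
exists (m + i)%N; rewrite ?leq_addl// -addSn rm/= ltNge; apply/negP => /mmin.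
by rewrite ltnn.
Qed.

Lemma integral_dyadic f i : measurable_fun setT f -> (forall s, 0 <= f s) ->
  \int[leb]_(s in `]0%R, r i[) f s =
  \sum_(l <oo | (i <= l)%N) \int[leb]_(s in `[r l.+1, (2 * r l.+1)%R[) f s.
Proof.
move=> mf f0.
pose F l : set R := if (i <= l)%N then `[r l.+1, (2 * r l.+1)%R[%classic else set0.
have -> : `]0%R, r i[%classic = \bigcup_l F l.
  apply/seteqP; split => s /=.
    rewrite in_itv/= => /radii_itv[l il hl]; exists l => //.
    by rewrite /F il/= in_itv/= -rS.
  move=> [l _]; rewrite /F; case: ifPn => // il; rewrite /= in_itv/= -rS => /andP[h1 h2].
  rewrite in_itv/= (lt_le_trans (radii_gt0 l.+1))//=.
  exact: (lt_le_trans h2 (radii_nonincreasing il)).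
rewrite ge0_integral_bigcup//; last 3 first.
- by move=> l; rewrite /F; case: ifP.
- exact: measurable_funTS.
- apply/trivIsetP => l m _ _; wlog : l m / (l < m)%N.
    move=> H; rewrite neq_lt => /orP[lm|ml]; first by apply: H => //; rewrite lt_eqF.
    by rewrite setIC; apply: H => //; rewrite lt_eqF.
  move=> lm _; rewrite -subset0 /F => s.
  case: ifPn => il; case: ifPn => im; rewrite ?set0I ?setI0//.
  rewrite /= !in_itv/= -!rS => -[/andP[h1 _] /andP[_ h2]].
  by have := lt_le_trans h2 (radii_nonincreasing lm); rewrite ltNge h1.
rewrite [RHS]eseries_mkcond; apply: eq_eseriesr => l _.
by rewrite /F; case: ifP => // _; rewrite integral_set0.
Qed.

End dyadic_radii.

(** * Continuous and dyadic quantities at comparable scales *)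

Section dyadic_comparison.
Context {R : realType} {n : nat}.
Local Notation X := (borelRn R n).
Variables sigma mu : {sigma_finite_measure set X -> \bar R}.
Variables (k : R -> R) (C A : R).
Hypothesis n0 : (0 < n)%N.
Hypothesis k_ge0 : forall r : R, (0 < r)%R -> (0 <= k r)%R.
Hypothesis k_noninc : forall r s : R, (0 < r)%R -> (r <= s)%R -> (k s <= k r)%R.
Hypothesis C1 : (1 <= C)%R.
Hypothesis sigmaD : forall (x : 'rV[R]_n) (r : R), (0 < r)%R ->
  sigma (eball x (2 * r)%R) <= C%:E * sigma (eball x r).
Hypothesis ball_gt0 : forall (x : X) r, (0 < r)%R -> 0 < sigma (eball x r).
Hypothesis ball_lty : forall (x : X) r, sigma (eball x r) < +oo.
Hypothesis A1 : (1 <= A)%R.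
Hypothesis lbo : forall (x : X) r, (0 < r)%R -> forall y z : X,
  eball x r y -> eball x r z -> kbar k sigma r y <= A%:E * kbar k sigma r z.

Variable D : R.
Hypothesis D0 : (0 < D)%R.

Local Notation w := (kernel_weight k).
Local Notation K := (@nbhd_radius n).
Local Notation Th := (@cube_doubling_cst R n C).
Local Notation Q := (@dyadic_cube R n D).
Local Notation N := (@dyadic_nbhd R n D).
Let CS : cube_system sigma Q N Th := dyadic_cube_system C1 sigmaD ball_gt0 ball_lty n0 D0.
Let C0 : (0 <= C)%R. Proof. exact: le_trans C1. Qed.
Let A0 : (0 <= A)%R. Proof. exact: le_trans A1. Qed.
Let T1 : (1 <= Th)%R. Proof. exact: cube_doubling_ge1. Qed.
Let T0 : (0 <= Th)%R. Proof. exact: le_trans T1. Qed.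
Let TE0 : 0 <= Th%:E. Proof. by rewrite lee_fin. Qed.
Let nR0 : (0 < n%:R :> R)%R. Proof. by rewrite ltr0n. Qed.

(** With d the side of generation i, the next radius 2nd exceeds the bound nd on the diameter of
    [Q i x], while twice this radius is 8nd, the reach of [N i x]. So a radius between consecutive
    ones gives a ball between a cube and a neighbourhood. *)
Definition dyadic_radius (i : nat) : R := (4 * n%:R * scale D i)%R.

Local Notation rho := dyadic_radius.

Lemma dyadic_radius_gt0 i : (0 < rho i)%R.
Proof. by rewrite mulr_gt0 ?scale_gt0// mulr_gt0. Qed.

Lemma dyadic_radiusS i : rho i = (2 * rho i.+1)%R.
Proof. by rewrite /dyadic_radius scaleS; field. Qed.

Lemma dyadic_radius_le i j : (i <= j)%N -> (rho j <= rho i)%R.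
Proof. exact: (radii_nonincreasing (dyadic_radius_gt0 0) dyadic_radiusS). Qed.

Definition dyadic_ker (i : nat) : R := k (rho i).

Lemma dyadic_ker_ge0 i : (0 <= dyadic_ker i)%R.
Proof. by apply: k_ge0; exact: dyadic_radius_gt0. Qed.

Lemma dyadic_kerS i : (dyadic_ker i <= dyadic_ker i.+1)%R.
Proof. by apply: k_noninc; [exact: dyadic_radius_gt0|exact: dyadic_radius_le]. Qed.

Lemma cube_sub_ball i (x : X) s : (rho i.+1 <= s)%R -> Q i x `<=` eball x s.
Proof.
move=> hs y xy; rewrite /eball/=; apply: lt_le_trans hs.
apply: (le_lt_trans (cube_dist (scale_gt0 i D0) xy)).
rewrite /dyadic_radius scaleS; have := mulr_gt0 nR0 (scale_gt0 i D0); lra.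
Qed.

Lemma ball_sub_nbhd i (x : X) s : (s <= 2 * rho i)%R -> eball x s `<=` N i x.
Proof.
move=> hs y xy; apply: dist_cube_nbhd; first exact: scale_gt0.
apply: (lt_le_trans xy); apply: (le_trans hs).
by rewrite /dyadic_radius /nbhd_radius natrM !mulrA -natrM.
Qed.

Lemma mass_cube_le_ball i (x : X) s : (rho i.+1 <= s)%R -> sigma (Q i x) <= sigma (eball x s).
Proof.
move=> hs; apply: le_measure; rewrite ?inE; [exact: measurable_cell|exact: measurable_eball|].
exact: cube_sub_ball.
Qed.

Lemma mass_ball_le_cube i (x : X) s : (s <= 2 * rho i)%R ->
  sigma (eball x s) <= Th%:E * sigma (Q i.+1 x).
Proof.
move=> hs; apply: (@le_trans _ _ (sigma (N i x))).
  apply: le_measure; rewrite ?inE; [exact: measurable_eball|exact: measurable_cube_nbhd|].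
  exact: ball_sub_nbhd.
rewrite /dyadic_cube scaleS; apply: nbhd_le_half_cube => //.
exact: scale_gt0.
Qed.

Local Notation b := (tailsum sigma Q dyadic_ker).
Local Notation kp := (kap sigma Q dyadic_ker).
Local Notation I := (kernel_int sigma k).

Let term0 l x : 0 <= (dyadic_ker l)%:E * sigma (Q l x).
Proof. by rewrite mule_ge0// lee_fin dyadic_ker_ge0. Qed.

(** The kernel does not decrease from one generation to the next finer one, and the mass of the cube
    drops by at most the factor [Th]; so each term is bounded by the following one. *)
Lemma tailsum_leS i x : b i x <= Th%:E * b i.+1 x.
Proof.
rewrite /tailsum -[in leRHS](nneseries_shift _ (fun l => term0 l x)).
rewrite [leLHS]eseries_mkcond [in leRHS]eseries_mkcond -ge0_nneseriesZl//; last first.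
  by move=> l; case: ifP.
apply: lee_nneseries => [l _ _|l _]; first by case: ifP.
case: ifP => _; last by rewrite mule0.
rewrite muleCA; apply: lee_pmul => //; first by rewrite lee_fin dyadic_ker_ge0.
  by rewrite lee_fin dyadic_kerS.
apply: (le_trans (mass_cube_le_ball x (lexx _))); apply: mass_ball_le_cube.
by rewrite (dyadic_radiusS l); have := dyadic_radius_gt0 l.+1; lra.
Qed.

Let wd (x : X) s := (w s)%:E * sigma (eball x s).
Let wd0 x s : 0 <= wd x s.
Proof. by rewrite mule_ge0// lee_fin kernel_weight_ge0. Qed.
Let wdE x s : (0 < s)%R -> wd x s = (k s)%:E * sigma (eball x s) * (s^-1)%:E.
Proof. by move=> s0; rewrite /wd /kernel_weight s0 EFinM muleAC. Qed.

Lemma measurable_weighted_mass_at x : measurable_fun setT (wd x).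
Proof.
exact: (measurableT_comp (measurable_weighted_mass sigma k_ge0 k_noninc) (pair1_measurable x)).
Qed.

Lemma kernel_int_le r s x : (r <= s)%R -> I r x <= I s x.
Proof.
move=> rs; apply: int_set_le => [u|u]; last exact: wd0.
by rewrite /= !in_itv/= => /andP[-> h]; exact: lt_le_trans rs.
Qed.

Lemma dyadic_int_ge f c i : 0 <= c -> (forall s, 0 <= f s) ->
  (forall s, (rho i.+1 <= s < rho i)%R -> c * (s^-1)%:E <= f s) ->
  c <= 2%:E * \int[@lebesgue_measure R]_(s in `[rho i.+1, (2 * rho i.+1)%R[) f s.
Proof.
by move=> c0 f0 H; apply: int_dyadic_ge => // [|s]; rewrite -?dyadic_radiusS ?dyadic_radius_gt0//; exact: H.
Qed.

Lemma dyadic_int_le f c i : 0 <= c -> (forall s, 0 <= f s) ->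
  (forall s, (rho i.+1 <= s < rho i)%R -> f s <= c * (s^-1)%:E) ->
  \int[@lebesgue_measure R]_(s in `[rho i.+1, (2 * rho i.+1)%R[) f s <= c.
Proof.
by move=> c0 f0 H; apply: int_dyadic_le => // [|s]; rewrite -?dyadic_radiusS ?dyadic_radius_gt0//; exact: H.
Qed.

Let sV0 (s : R) i : (rho i.+1 <= s)%R -> 0 <= (s^-1)%:E.
Proof.
move=> h; rewrite lee_fin invr_ge0 ltW//; apply: lt_le_trans h; exact: dyadic_radius_gt0.
Qed.

Lemma kernel_int_ge i x : b i x <= 2%:E * I (rho i) x.
Proof.
rewrite /kernel_int (integral_dyadic (dyadic_radius_gt0 0) dyadic_radiusS _ (measurable_weighted_mass_at x))//.
rewrite /tailsum [leLHS]eseries_mkcond [in leRHS]eseries_mkcond -ge0_nneseriesZl//; last first.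
  by move=> l; case: ifP => // _; apply: integral_ge0.
apply: lee_nneseries => [l _ _|l _]; first by case: ifP.
case: ifP => _; last by rewrite mule0.
apply: dyadic_int_ge => // s /andP[s1 s2].
rewrite wdE; last exact: (lt_le_trans (dyadic_radius_gt0 _) s1).
apply: lee_wpmul2r; first exact: sV0 s1.
apply: lee_pmul => //; first by rewrite lee_fin dyadic_ker_ge0.
  by rewrite lee_fin; apply: k_noninc (ltW s2); exact: (lt_le_trans (dyadic_radius_gt0 _) s1).
exact: mass_cube_le_ball.
Qed.

(** For s between two radii, both k(s) and the mass of the ball are bounded by quantities of the
    finer generation, whence the shift by one. *)
Lemma kernel_int_le_tailsum i x : I (rho i) x <= Th%:E * b i.+1 x.
Proof.
rewrite /kernel_int (integral_dyadic (dyadic_radius_gt0 0) dyadic_radiusS _ (measurable_weighted_mass_at x))//.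
rewrite /tailsum -[in leRHS](nneseries_shift _ (fun l => term0 l x)).
rewrite [leLHS]eseries_mkcond [in leRHS]eseries_mkcond -ge0_nneseriesZl//; last first.
  by move=> l; case: ifP.
apply: lee_nneseries => [l _ _|l _]; first by case: ifP => // _; exact: integral_ge0.
case: ifP => _; last by rewrite mule0.
apply: dyadic_int_le => // [|s /andP[s1 s2]]; first by rewrite mule_ge0.
rewrite wdE; last exact: (lt_le_trans (dyadic_radius_gt0 _) s1).
apply: lee_wpmul2r; first exact: sV0 s1.
rewrite muleCA; apply: lee_pmul => //.
- by rewrite lee_fin k_ge0// (lt_le_trans (dyadic_radius_gt0 _) s1).
- by rewrite lee_fin; apply: k_noninc => //; exact: dyadic_radius_gt0.
- by apply: mass_ball_le_cube; have := dyadic_radius_gt0 l; lra.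
Qed.

Let massQ_gt0 i x : 0 < sigma (Q i x). Proof. exact: (cube_gt0 CS). Qed.
Let massQ_lty i x : sigma (Q i x) < +oo. Proof. exact: (cube_lty CS). Qed.

(** The index [j] is left free because both j = i and j = i + 1 are used. *)
Lemma kbar_le_kap i j x s : (s <= rho i)%R -> (rho j.+1 <= s)%R -> (j <= i.+1)%N ->
  kbar k sigma s x <= Th%:E * kp j x.
Proof.
move=> si js ji; have s0 : (0 < s)%R by apply: lt_le_trans js; exact: dyadic_radius_gt0.
rewrite kbarE /kap muleCA; apply: lee_pmul; rewrite ?inve_ge0 ?kernel_int_ge0//.
  rewrite -[leRHS]mul1e; apply: inve_le_scale => //; first exact: ball_gt0.
  by rewrite mul1e; exact: mass_cube_le_ball.
apply: (le_trans (kernel_int_le x si)); apply: (le_trans (kernel_int_le_tailsum i x)).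
by apply: lee_wpmul2l => //; apply: nneseries_suffix_le.
Qed.

Lemma kap_le_kbar i x s : (rho i.+1 <= s)%R -> (s <= rho i)%R ->
  kp i x <= (2 * Th ^+ 2)%:E * kbar k sigma s x.
Proof.
move=> ls si; have s0 : (0 < s)%R by apply: lt_le_trans ls; exact: dyadic_radius_gt0.
have -> : (2 * Th ^+ 2)%:E * kbar k sigma s x =
    (Th%:E * (sigma (eball x s))^-1) * (Th%:E * (2%:E * I s x)).
  rewrite kbarE expr2 (EFinM 2) (EFinM Th Th).
  by rewrite [LHS](AC ((1*2)*2) ((2*4)*(3*(1*5))))%AC.
apply: lee_pmul.
- exact: wt_ge0.
- by apply: tailsum_ge0 => l; exact: dyadic_ker_ge0.
- apply: inve_le_scale => //; first exact: ball_gt0.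
  apply: (@le_trans _ _ (Th%:E * sigma (Q i.+1 x))).
    by apply: mass_ball_le_cube; have := dyadic_radius_gt0 i; lra.
  apply: lee_wpmul2l => //; rewrite /dyadic_cube scaleS; exact: half_cube_le.
- apply: (le_trans (tailsum_leS i x)); apply: lee_wpmul2l => //.
  apply: (le_trans (kernel_int_ge i.+1 x)); apply: lee_wpmul2l => //.
  exact: kernel_int_le.
Qed.

(** The piece over [r, 2r) is at most k(r) sigma(B(x,2r)), hence at most C^2 k(r) sigma(B(x,r/2)),
    and the piece of [I r x] over [r/2, r) bounds this up to the factor 2. *)
Lemma kernel_int_double r x : (0 < r)%R -> I (2 * r) x <= (1 + 2 * C ^+ 2)%:E * I r x.
Proof.
move=> r0; have r20 : (0 < r / 2)%R by rewrite divr_gt0.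
have r2E : (2 * (r / 2) = r)%R by field.
have mwd := measurable_weighted_mass_at x.
have -> : I (2 * r) x = I r x + \int[@lebesgue_measure R]_(s in `[r, (2 * r)%R[) wd x s.
  rewrite {1}/kernel_int (@itv_bndbnd_setU _ _ _ (BLeft r)) ?bnd_simp//; last lra.
  rewrite ge0_integral_setU//; first exact: measurable_funTS.
    by move=> s _; exact: wd0.
  apply/disj_setPS => s [/=]; rewrite !in_itv/= => /andP[_ h] /andP[h' _].
  by rewrite ltNge h' in h.
have massD : sigma (eball x (2 * r)%R) <= (C ^+ 2)%:E * sigma (eball x (r / 2)%R).
  have := doubling_iter C1 sigmaD 2 x r20.
  by rewrite (_ : 2 ^+ 2 * (r / 2) = 2 * r)%R//; field.
have kr0 : 0 <= (k r)%:E by rewrite lee_fin k_ge0.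
have upper : \int[@lebesgue_measure R]_(s in `[r, (2 * r)%R[) wd x s <=
    (k r)%:E * sigma (eball x (2 * r)%R).
  apply: int_dyadic_le => //; first by rewrite mule_ge0.
  move=> s /andP[s1 s2]; have s0 := lt_le_trans r0 s1.
  rewrite wdE//; apply: lee_wpmul2r; first by rewrite lee_fin invr_ge0 ltW.
  by apply: lee_pmul; rewrite ?lee_fin ?k_ge0 ?k_noninc//; apply: eball_le; exact: ltW.
have lower : (k r)%:E * sigma (eball x (r / 2)%R) <= 2%:E * I r x.
  apply: (@le_trans _ _ (2%:E * \int[@lebesgue_measure R]_(s in `[(r / 2)%R, (2 * (r / 2))%R[) wd x s)).
    apply: int_dyadic_ge => //; first by rewrite mule_ge0.
    rewrite r2E => s /andP[s1 s2]; have s0 := lt_le_trans r20 s1.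
    rewrite wdE//; apply: lee_wpmul2r; first by rewrite lee_fin invr_ge0 ltW.
    by apply: lee_pmul; rewrite ?lee_fin ?k_ge0 ?k_noninc ?(ltW s2)//; exact: eball_le.
  apply: lee_wpmul2l => //; apply: int_set_le => // s; rewrite /= !in_itv/= r2E.
  by move=> /andP[h ->]; rewrite (lt_le_trans r20 h).
rewrite EFinD ge0_muleDl ?kernel_int_ge0// ?lee_fin; last by rewrite mulr_ge0 ?exprn_ge0.
rewrite mul1e leeD2l//; apply: (le_trans upper).
apply: (le_trans (lee_wpmul2l kr0 massD)); rewrite muleCA.
rewrite (EFinM 2%R) (muleC 2%:E) -muleA.
by apply: lee_wpmul2l => //; rewrite lee_fin exprn_ge0.
Qed.

Let E := (1 + 2 * C ^+ 2)%R.
Let E0 : (0 <= E)%R. Proof. by rewrite addr_ge0// mulr_ge0// exprn_ge0. Qed.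

Lemma kbar_expand m r x : (0 < r)%R ->
  kbar k sigma (2 ^+ m * r) x <= (E ^+ m)%:E * kbar k sigma r x.
Proof.
move=> r0; elim: m => [|m IH]; first by rewrite !expr0 mul1r mul1e.
rewrite !exprS -mulrA (EFinM E) -muleA; set s := (2 ^+ m * r)%R in IH *.
have s0 : (0 < s)%R by rewrite mulr_gt0// exprn_gt0.
apply: (@le_trans _ _ (E%:E * kbar k sigma s x)); last by apply: lee_wpmul2l; rewrite ?lee_fin.
rewrite !kbarE muleCA; apply: lee_pmul; rewrite ?inve_ge0 ?kernel_int_ge0//; last first.
  exact: kernel_int_double.
have s20 : (0 < 2 * s)%R by rewrite mulr_gt0.
rewrite -[leRHS]mul1e; apply: inve_le_scale; rewrite ?ball_lty ?ball_gt0//.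
by rewrite mul1e; apply: eball_le; lra.
Qed.

Lemma kbar_shrink m r x : (0 < r)%R ->
  kbar k sigma r x <= (C ^+ m)%:E * kbar k sigma (2 ^+ m * r) x.
Proof.
move=> r0; have s0 : (0 < 2 ^+ m * r)%R by rewrite mulr_gt0// exprn_gt0.
have m1 : (1 <= 2 ^+ m :> R)%R by rewrite exprn_ege1// ler1n.
rewrite !kbarE muleA; apply: lee_pmul; rewrite ?inve_ge0 ?kernel_int_ge0//.
  apply: inve_le_scale; rewrite ?ball_lty ?ball_gt0//.
  exact: doubling_iter.
by apply: kernel_int_le; rewrite ler_peMl// ltW.
Qed.

Definition kap_cmp_cst : R :=
  (2 * Th ^+ 2 * (C ^+ K.+1 * (A * ((1 + 2 * C ^+ 2) ^+ K.+1 * Th))))%R.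

Lemma kap_cmp_cst_ge0 : (0 <= kap_cmp_cst)%R.
Proof.
by rewrite /kap_cmp_cst !mulr_ge0// ?exprn_ge0.
Qed.

(** A point of [N i x] may lie outside the ball of radius [rho i], so LBO is applied at the radius
    2^(K+1) [rho i]: pass from y to the large radius by [kbar_shrink], move to x, and return by
    [kbar_expand]. *)
Lemma dyadic_kap_cmp i x y : N i x y -> kp i y <= kap_cmp_cst%:E * kp i x.
Proof.
move=> xy; have r0 := dyadic_radius_gt0 i; set M := K.+1.
have R0 : (0 < 2 ^+ M * rho i)%R by rewrite mulr_gt0// exprn_gt0.
have xyB : eball x (2 ^+ M * rho i)%R y.
  rewrite /eball/=; have d0 := scale_gt0 i D0.
  apply: (le_lt_trans (cube_nbhd_dist d0 xy)).
  have h : (K.+1%:R < 2 ^+ M :> R)%R by rewrite -natrX ltr_nat ltn_expl.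
  rewrite /dyadic_radius -/M in h *.
  have -> : (n%:R * (M%:R * scale D i) = M%:R * (n%:R * scale D i))%R by ring.
  have -> : (2 ^+ M * (4 * n%:R * scale D i) = (2 ^+ M * 4) * (n%:R * scale D i))%R by ring.
  rewrite ltr_pM2r ?mulr_gt0//; apply: (lt_le_trans h).
  by rewrite ler_peMr ?exprn_ge0//; lra.
have xxB : eball x (2 ^+ M * rho i)%R x by rewrite /eball/= distxx.
have rS : (rho i.+1 <= rho i)%R by exact: dyadic_radius_le.
apply: (le_trans (kap_le_kbar y rS (lexx _))).
rewrite /kap_cmp_cst (EFinM (2 * Th ^+ 2)%R) -muleA; apply: lee_wpmul2l.
  by rewrite lee_fin mulr_ge0// exprn_ge0.
apply: (le_trans (kbar_shrink M y r0)).
rewrite (EFinM (C ^+ M)%R) -muleA; apply: lee_wpmul2l; first by rewrite lee_fin exprn_ge0.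
apply: (le_trans (lbo R0 xyB xxB)).
rewrite (EFinM A) -muleA; apply: lee_wpmul2l; first by rewrite lee_fin.
apply: (le_trans (kbar_expand M x r0)).
rewrite (EFinM ((1 + 2 * C ^+ 2) ^+ M)%R) -muleA; apply: lee_wpmul2l.
  by rewrite lee_fin exprn_ge0.
exact: (@kbar_le_kap i i).
Qed.

Variable p : R.
Hypothesis p1 : (1 < p)%R.
Local Notation t := (conjexp p).
Local Notation alc := (wolff_coef sigma Q dyadic_ker t).

Let tm1 : (0 <= t - 1)%R.
Proof.
have pm : (0 < p - 1)%R by rewrite subr_gt0.
by rewrite /conjexp subr_ge0 ler_pdivlMr// mul1r lerBlDr lerDl.
Qed.

Let kp0 i x : 0 <= kp i x.
Proof. by apply: kap_ge0 => l; exact: dyadic_ker_ge0. Qed.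

Let bk0 s x : 0 <= kbar k sigma s x. Proof. exact: kbar_ge0. Qed.

Let pot_term P i x := alc i x * sigma (Q i x) * mu (P i x) `^ (t - 1).

Let pot_term0 P i x : 0 <= pot_term P i x.
Proof.
apply: mule_ge0; last exact: poweR_ge0.
by apply: mule_ge0 => //; apply: wolff_coef_ge0 => l; exact: dyadic_ker_ge0.
Qed.

Let pot_termE P i x : pot_term P i x =
  (dyadic_ker i)%:E * sigma (Q i x) * (kp i x * mu (P i x)) `^ (t - 1).
Proof. by rewrite /pot_term /wolff_coef (poweRM _ (kp0 i x) (measure_ge0 mu _)) [LHS](ACl ((1*3)*(2*4)))%AC. Qed.

Lemma measurable_wolff_density_at x : measurable_fun setT (wolff_density sigma mu k p x).
Proof.
exact: (measurableT_comp (measurable_wolff_density sigma mu k_ge0 k_noninc p) (pair1_measurable x)).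
Qed.

Lemma measurable_kbar_at s : measurable_fun setT (kbar k sigma s).
Proof.
exact: (measurableT_comp (measurable_kbar sigma k_ge0 k_noninc) (pair2_measurable s)).
Qed.

Let dens0 x s : 0 <= wolff_density sigma mu k p x s.
Proof. exact: wolff_density_ge0. Qed.

Let densE x s : (0 < s)%R -> wolff_density sigma mu k p x s =
  (k s)%:E * sigma (eball x s) * (\int[mu]_(y in eball x s) kbar k sigma s y) `^ (t - 1) * (s^-1)%:E.
Proof.
by move=> s0; rewrite /wolff_density /kernel_weight s0 EFinM [RHS](ACl ((1*4)*(2*3)))%AC.
Qed.

Lemma wolff_trunc_series x : wolff_trunc sigma mu k p (rho 0) x =
  \sum_(l <oo) \int[@lebesgue_measure R]_(s in `[rho l.+1, (2 * rho l.+1)%R[)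
    wolff_density sigma mu k p x s.
Proof.
rewrite /wolff_trunc (integral_dyadic (dyadic_radius_gt0 0) dyadic_radiusS _ (measurable_wolff_density_at x))//.
Qed.

Definition wolff_lower_cst : R := (2 * (2 * Th ^+ 2 * A) `^ (t - 1))%R.

Lemma wolff_lower_cst_ge0 : (0 <= wolff_lower_cst)%R.
Proof. by rewrite mulr_ge0// powR_ge0. Qed.

(** For s between the radii of generations i + 1 and i, the ball contains [Q i x] but perhaps not
    [N i x], which is why only cubes appear here. *)
Lemma pot_le_wolff x : pot sigma mu Q alc t Q x <= wolff_lower_cst%:E * wolff k sigma mu p x.
Proof.
have c0 := wolff_lower_cst_ge0; have cE0 : 0 <= wolff_lower_cst%:E by rewrite lee_fin.
set G := (2 * Th ^+ 2 * A)%R; have G0 : (0 <= G)%R by rewrite mulr_ge0// mulr_ge0// exprn_ge0.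
apply: (@le_trans _ _ (wolff_lower_cst%:E * wolff_trunc sigma mu k p (rho 0) x)); last first.
  apply: lee_wpmul2l => //; rewrite wolffE; apply: int_set_le => // s.
  by rewrite /= !in_itv/= andbT => /andP[].
rewrite wolff_trunc_series -ge0_nneseriesZl//; last by move=> l; exact: integral_ge0.
apply: lee_nneseries => [i _ _|i _]; first exact: pot_term0.
change (pot_term Q i x <= wolff_lower_cst%:E *
  \int[@lebesgue_measure R]_(s in `[rho i.+1, (2 * rho i.+1)%R[) wolff_density sigma mu k p x s).
rewrite /wolff_lower_cst -/G (EFinM 2%R) -muleA -ge0_integralZl//; last 2 first.
- by apply: measurable_funTS; exact: measurable_wolff_density_at.
- by rewrite lee_fin powR_ge0.
apply: dyadic_int_ge => // [s|s /andP[s1 s2]]; first by rewrite mule_ge0// lee_fin powR_ge0.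
have s0 : (0 < s)%R := lt_le_trans (dyadic_radius_gt0 _) s1.
rewrite densE// pot_termE muleA; apply: lee_wpmul2r; first exact: sV0 s1.
rewrite muleCA; apply: lee_pmul; rewrite ?poweR_ge0 ?mule_ge0 ?lee_fin ?dyadic_ker_ge0//.
  apply: lee_pmul => //; rewrite ?lee_fin ?dyadic_ker_ge0//; last exact: mass_cube_le_ball.
  by apply: k_noninc => //; exact: ltW.
rewrite -poweR_EFin -poweRM ?lee_fin//; last by apply: integral_ge0 => y _; exact: bk0.
apply: le_poweR => //; first by rewrite mule_ge0.
have mQ : measurable (Q i x) by exact: measurable_cell.
have mB : measurable (eball x s : set X) by exact: measurable_eball.
rewrite -ge0_integralZl// ?lee_fin//; last by apply: measurable_funTS; exact: measurable_kbar_at.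
have xs : eball x s x by rewrite /eball/= distxx.
apply: (@le_trans _ _ (\int[mu]_(y in Q i x) cst (kp i x) y)); first by rewrite integral_cst.
have QB := cube_sub_ball s1.
apply: (@le_trans _ _ (\int[mu]_(y in Q i x) (G%:E * kbar k sigma s y))); last first.
  by apply: int_set_le; [exact: QB|move=> y; rewrite mule_ge0// lee_fin].
apply: ge0_le_int => [//|y|y|y Qy]; first exact: kp0.
  by apply: mule_ge0; rewrite ?lee_fin.
apply: (le_trans (kap_le_kbar x s1 (ltW s2))).
rewrite /G (EFinM (2 * Th ^+ 2)%R) -muleA; apply: lee_wpmul2l.
  by rewrite lee_fin mulr_ge0// exprn_ge0.
by apply: (lbo s0 xs); exact: QB.
Qed.

Definition wolff_upper_cst : R := (Th * (A * Th) `^ (t - 1))%R.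

Lemma wolff_upper_cst_ge0 : (0 <= wolff_upper_cst)%R.
Proof. by rewrite mulr_ge0// powR_ge0. Qed.

(** For s between the radii of generations i + 1 and i, the ball lies in [N i.+1 x]. The dyadic sum
    thus starts at index 1, and the term of index 0 is added for free. *)
Lemma wolff_trunc_le_pot x :
  wolff_trunc sigma mu k p (rho 0) x <= wolff_upper_cst%:E * pot sigma mu Q alc t N x.
Proof.
have c0 := wolff_upper_cst_ge0; have cE0 : 0 <= wolff_upper_cst%:E by rewrite lee_fin.
rewrite wolff_trunc_series.
apply: (@le_trans _ _ (wolff_upper_cst%:E * \sum_(i <oo | (0 <= i)%N) pot_term N i.+1 x)); last first.
  apply: lee_wpmul2l => //; rewrite (nneseries_shift _ (fun l => pot_term0 N l x)).
  exact: (nneseries_suffix_le (fun l => pot_term0 N l x) (leq0n 1)).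
rewrite -ge0_nneseriesZl//; apply: lee_nneseries => [i _ _|i _]; first exact: integral_ge0.
apply: dyadic_int_le => // [|s /andP[s1 s2]]; first by rewrite mule_ge0.
have s0 : (0 < s)%R := lt_le_trans (dyadic_radius_gt0 _) s1.
rewrite densE//; apply: lee_wpmul2r; first exact: sV0 s1.
rewrite pot_termE /wolff_upper_cst (EFinM Th).
rewrite [leRHS](AC (2*(2*1)) (((3*(1*4)))*(2*5)))%AC/=.
apply: lee_pmul; rewrite ?poweR_ge0 ?mule_ge0 ?lee_fin ?k_ge0//.
  apply: lee_pmul; rewrite ?lee_fin ?k_ge0//; first by apply: k_noninc => //; exact: dyadic_radius_gt0.
  by apply: mass_ball_le_cube; have := dyadic_radius_gt0 i; lra.
have AT0 : 0 <= (A * Th)%:E by rewrite lee_fin mulr_ge0.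
have kN0 : 0 <= kp i.+1 x * mu (N i.+1 x) by exact: mule_ge0 (kp0 _ _) (measure_ge0 mu _).
rewrite -poweR_EFin -(poweRM _ AT0 kN0).
apply: le_poweR => //; first by apply: integral_ge0.
have xs : eball x s x by rewrite /eball/= distxx.
have mB : measurable (eball x s : set X) by exact: measurable_eball.
have mN : measurable (N i.+1 x) by exact: measurable_cube_nbhd.
have BN : eball x s `<=` N i.+1 x.
  by apply: ball_sub_nbhd; rewrite -dyadic_radiusS; exact: ltW.
apply: (@le_trans _ _ (\int[mu]_(y in N i.+1 x) cst (A%:E * (Th%:E * kp i.+1 x)) y)); last first.
  by rewrite integral_cst// (EFinM A) -!muleA.
apply: ge0_le_int => [//|y|y|y By]; first exact: bk0.
  by apply: mule_ge0; [rewrite lee_fin|exact: mule_ge0 TE0 (kp0 _ _)].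
apply: (le_trans (lbo s0 By xs)); apply: lee_wpmul2l; first by rewrite lee_fin.
apply: (@kbar_le_kap i); [exact: ltW|apply: le_trans s1; exact: dyadic_radius_le|by []].
Qed.

Lemma ker_le_kernel_pos i (x y : X) : x <> y -> (euclid_dist x y < rho i)%R ->
  (dyadic_ker i <= kernel_pos k (euclid_dist x y))%R.
Proof.
move=> xy h; have d0 := dist_gt0 xy.
by rewrite /kernel_pos d0; apply: k_noninc => //; exact: ltW.
Qed.

Lemma kernel_pos_le_ker i r : (rho i <= r)%R -> (kernel_pos k r <= dyadic_ker i)%R.
Proof.
move=> h; rewrite /kernel_pos (lt_le_trans (dyadic_radius_gt0 i) h).
by apply: k_noninc => //; exact: dyadic_radius_gt0.
Qed.

(** The annulus of generation i lies within distance [rho i] of x and omits x itself, so there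
    k(r_i) <= k(|x-y|); the annuli are disjoint. *)
Lemma annop_le_offdiag (f : X -> R) x : measurable_fun setT f -> (forall y, (0 <= f y)%R) ->
  annop sigma Q dyadic_ker (EFin \o f) x <= \int[sigma]_y offdiag k f x y.
Proof.
move=> mf f0.
have o0 y : 0 <= offdiag k f x y by rewrite lee_fin mulr_ge0 ?kernel_pos_ge0.
have mo := measurable_offdiag_at k_noninc x mf.
pose ann i := Q i x `\` Q i.+1 x.
have mann i : measurable (ann i) by apply: measurableD; exact: measurable_cell.
apply: (@le_trans _ _ (\sum_(i <oo) \int[sigma]_(y in ann i) offdiag k f x y)).
  apply: lee_nneseries => [i _ _|i _].
    apply: mule_ge0; first by rewrite lee_fin dyadic_ker_ge0.
    by apply: integral_ge0 => y _; rewrite lee_fin.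
  rewrite -ge0_integralZl//; last 4 first.
  - exact: mann.
  - by apply/measurable_EFinP; exact: measurable_funTS.
  - by move=> y _; rewrite lee_fin.
  - by rewrite lee_fin dyadic_ker_ge0.
  apply: ge0_le_int => [//|y|//|y [Qy nQy]].
    by apply: mule_ge0; rewrite lee_fin ?dyadic_ker_ge0.
  rewrite /= lee_fin; apply: ler_wpM2r => //.
  apply: ker_le_kernel_pos; last exact: (cube_sub_ball (dyadic_radius_le (leqnSn i)) Qy).
  by move=> xy; apply: nQy; rewrite -xy; exact: (cube_refl CS).
have triv : trivIset setT ann.
  apply/trivIsetP => i j _ _; wlog : i j / (i < j)%N.
    move=> H; rewrite neq_lt => /orP[ij|ji]; first by apply: H => //; rewrite lt_eqF.
    by rewrite setIC; apply: H => //; rewrite lt_eqF.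
  move=> ij _; rewrite -subset0 => y [[_ h] [h' _]]; apply: h.
  exact: (cube_nestn CS ij).
rewrite -ge0_integral_bigcup//; first exact: int_set_le.
exact: measurable_funTS.
Qed.

Lemma offdiag_ball_le (f : X -> R) x : measurable_fun setT f -> (forall y, (0 <= f y)%R) ->
  \int[sigma]_(y in eball x (rho 0)) offdiag k f x y <=
  \sum_(i <oo) ((dyadic_ker i)%:E * \int[sigma]_(y in N i x) (f y)%:E).
Proof.
move=> mf f0.
have o0 y : 0 <= offdiag k f x y by rewrite lee_fin mulr_ge0 ?kernel_pos_ge0.
have mo := measurable_offdiag_at k_noninc x mf.
have md := measurable_dist x.
pose J i : set X := [set y | (rho i.+1 <= euclid_dist x y < rho i)%R].
have mJ i : measurable (J i).
  rewrite (_ : J i = [set y | (rho i.+1 <= euclid_dist x y)%R] `&` eball x (rho i)).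
    apply: measurableI; last exact: measurable_eball.
    rewrite -[X in measurable X]setTI.
    exact: (measurable_fun_ler (measurable_cst (rho i.+1 : R)) md measurableT (Y := [set true])).
  by apply/seteqP; split => y /=; [move=> /andP[]|move=> [? ?]; apply/andP].
have triv : trivIset setT J.
  apply/trivIsetP => l m _ _; wlog : l m / (l < m)%N.
    move=> H; rewrite neq_lt => /orP[lm|ml]; first by apply: H => //; rewrite lt_eqF.
    by rewrite setIC; apply: H => //; rewrite lt_eqF.
  move=> lm _; rewrite -subset0 => y [/andP[h1 _] /andP[_ h2]].
  by have := lt_le_trans h2 (dyadic_radius_le lm); rewrite ltNge h1.
have I0 i : 0 <= \int[sigma]_(y in N i x) (f y)%:E.
  by apply: integral_ge0 => y _; rewrite lee_fin.
apply: (@le_trans _ _ (\int[sigma]_(y in \bigcup_i J i) offdiag k f x y)).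
  rewrite integral_mkcond [leRHS]integral_mkcond; apply: le_int => y.
    by rewrite /patch; case: ifP.
  rewrite /patch; case: ifPn => [|_]; last by case: ifP.
  rewrite inE => yB; case: ifPn => //; rewrite notin_setE => nJ.
  (* Within the ball the shells [J i] miss only distance 0, where [kernel_pos] vanishes. *)
  rewrite /offdiag /kernel_pos; case: ifPn => [d0|_]; last by rewrite mul0r.
  exfalso; apply: nJ; have [l _ hl] := radii_itv dyadic_radiusS (introT andP (conj d0 yB)).
  by exists l.
rewrite ge0_integral_bigcup//; last exact: measurable_funTS.
apply: (@le_trans _ _ (\sum_(i <oo | (0 <= i)%N)
    ((dyadic_ker i.+1)%:E * \int[sigma]_(y in N i.+1 x) (f y)%:E))); last first.
  have t0 l : 0 <= (dyadic_ker l)%:E * \int[sigma]_(y in N l x) (f y)%:E.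
    by apply: mule_ge0 => //; rewrite lee_fin dyadic_ker_ge0.
  rewrite (nneseries_shift _ t0); exact: (nneseries_suffix_le t0 (leq0n 1)).
apply: lee_nneseries => [i _ _|i _]; first exact: integral_ge0.
have mN : measurable (N i.+1 x) by exact: measurable_cube_nbhd.
rewrite -ge0_integralZl//; last 3 first.
- by apply/measurable_EFinP; exact: measurable_funTS.
- by move=> y _; rewrite lee_fin.
- by rewrite lee_fin dyadic_ker_ge0.
have kf0 y : 0 <= (dyadic_ker i.+1)%:E * (f y)%:E by apply: mule_ge0; rewrite lee_fin ?dyadic_ker_ge0.
apply: ge0_le_int => //.
- move=> y /andP[_ h]; apply: (@ball_sub_nbhd _ _ (rho i)) => //.
  by rewrite -dyadic_radiusS.
- move=> y /andP[h _]; rewrite /offdiag -EFinM lee_fin; apply: ler_wpM2r => //.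
  exact: kernel_pos_le_ker.
Qed.

End dyadic_comparison.

(** * The trace inequality *)

Section trace_characterization.
Context {R : realType} {n : nat}.
Local Notation X := (borelRn R n).
Variables sigma mu : {sigma_finite_measure set X -> \bar R}.
Variables (k : R -> R) (C A : R).
Hypothesis n0 : (0 < n)%N.
Hypothesis k_ge0 : forall r : R, (0 < r)%R -> (0 <= k r)%R.
Hypothesis k_noninc : forall r s : R, (0 < r)%R -> (r <= s)%R -> (k s <= k r)%R.
Hypothesis C1 : (1 <= C)%R.
Hypothesis sigmaD : forall (x : 'rV[R]_n) (r : R), (0 < r)%R ->
  sigma (eball x (2 * r)%R) <= C%:E * sigma (eball x r).
Hypothesis ball_gt0 : forall (x : X) r, (0 < r)%R -> 0 < sigma (eball x r).
Hypothesis ball_lty : forall (x : X) r, sigma (eball x r) < +oo.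
Hypothesis mu_ball_lty : forall (x : X) r, mu (eball x r) < +oo.
Hypothesis A1 : (1 <= A)%R.
Hypothesis lbo : forall (x : X) r, (0 < r)%R -> forall y z : X,
  eball x r y -> eball x r z -> kbar k sigma r y <= A%:E * kbar k sigma r z.
Variables p q : R.
Hypothesis q1 : (1 <= q)%R.
Hypothesis qp : (q < p)%R.

Local Notation t := (conjexp p).
Local Notation s := (q * (p - 1) / (p - q))%R.
Local Notation Th := (@cube_doubling_cst R n C).
Local Notation Ak := (@kap_cmp_cst R n C A).
Let p1 : (1 < p)%R. Proof. exact: le_lt_trans qp. Qed.
Let p0 : (0 < p)%R. Proof. exact: lt_trans p1. Qed.
Let q0 : (0 < q)%R. Proof. exact: lt_le_trans q1. Qed.
Let pm1 : (0 < p - 1)%R. Proof. by rewrite subr_gt0. Qed.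
Let t1 : (1 < t)%R.
Proof. by rewrite /conjexp ltr_pdivlMr// mul1r ltrBlDr ltrDl. Qed.
Let pt : (p^-1 + t^-1 = 1)%R.
Proof. by rewrite /conjexp invf_div; have := p0; move=> /gt_eqF/negbT h; field. Qed.
Let s0 : (0 < s)%R. Proof. by rewrite divr_gt0 ?mulr_gt0// subr_gt0. Qed.

Let CS D (D0 : (0 < D)%R) := dyadic_cube_system C1 sigmaD ball_gt0 ball_lty n0 D0.
Let Ak0 : (0 <= Ak)%R. Proof. exact: kap_cmp_cst_ge0. Qed.
Let kcmp D (D0 : (0 < D)%R) i x y : dyadic_nbhd D i x y ->
  kap sigma (dyadic_cube D) (dyadic_ker (n := n) k D) i y <=
  Ak%:E * kap sigma (dyadic_cube D) (dyadic_ker (n := n) k D) i x.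
Proof. exact: dyadic_kap_cmp. Qed.

Let muN D (D0 : (0 < D)%R) i x : mu (dyadic_nbhd D i x) < +oo.
Proof.
have d0 := scale_gt0 i D0; set e := (n%:R * ((@nbhd_radius n).+1%:R * scale D i))%R.
apply: le_lt_trans (mu_ball_lty x (e + 1)%R).
apply: le_measure; rewrite ?inE; [exact: measurable_cube_nbhd|exact: measurable_eball|].
move=> y xy; apply: (le_lt_trans (cube_nbhd_dist d0 xy)); rewrite -/e; lra.
Qed.

Let no_atom (x : X) : sigma [set x] = 0.
Proof. exact: (doubling_no_atom C1 sigmaD ball_gt0 ball_lty n0). Qed.

Let point_measurable (x : X) : measurable ([set x] : set X).
Proof. exact: measurable_singleton. Qed.

Let big J : (0 < 2 ^+ J :> R)%R. Proof. by rewrite exprn_gt0. Qed.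
Local Notation rad J := (@dyadic_radius R n (2 ^+ J)%R 0).

Let radE J : rad J = (4 * n%:R * 2 ^+ J)%R.
Proof. by rewrite /dyadic_radius /scale expr0 divr1. Qed.

Let rad_nd J J' : (J <= J')%N -> (rad J <= rad J')%R.
Proof.
by move=> JJ; rewrite !radE ler_wpM2l// ler_eXn2l// ltr1n.
Qed.

Let rad_unbounded (M : R) : exists J, (M < rad J)%R.
Proof.
exists (Num.truncn `|M|).+1; rewrite radE; apply: (le_lt_trans (ler_norm M)).
apply: (lt_trans (truncnS_gt _)).
have h : ((Num.truncn `|M|).+1%:R < 2 ^+ (Num.truncn `|M|).+1 :> R)%R.
  by rewrite -natrX ltr_nat ltn_expl.
apply: (lt_le_trans h); rewrite ler_peMl ?exprn_ge0// -natrM ler1n muln_gt0.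
exact: n0.
Qed.

Lemma wolff_trunc_sup x (c : \bar R) :
  (forall J, wolff_trunc sigma mu k p (rad J) x <= c) -> wolff k sigma mu p x <= c.
Proof.
move=> H; rewrite wolffE integral_mkcond.
have d0 r : 0 <= wolff_density sigma mu k p x r by exact: wolff_density_ge0.
have md : measurable_fun setT (wolff_density sigma mu k p x).
  exact: measurable_wolff_density_at.
apply: (@integral_le_sup _ _ _ lebesgue_measure (fun J => wolff_density sigma mu k p x \_ `]0%R, rad J[%classic)).
- by move=> J; apply/(measurable_restrictT _ _).1 => //; exact: measurable_funTS.
- by move=> J r; rewrite /patch; case: ifP.
- by move=> r; rewrite /patch; case: ifP.
- move=> r J J' JJ; rewrite !patch_itv0; case: ifP => // _.
  by case: ifPn => [h|_]; [rewrite (lt_le_trans h (rad_nd JJ))|case: ifP].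
- move=> r; have [J hJ] := rad_unbounded r.
  apply: (@le_trans _ _ ((wolff_density sigma mu k p x \_ `]0%R, rad J[%classic) r)).
    rewrite patch_itv0 hJ {1}/patch; case: ifPn => //; last by case: ifP.
    by rewrite inE/= in_itv/= andbT => ->.
  by apply: ereal_sup_ubound; exists J.
- by move=> J; rewrite -integral_mkcond; exact: H.
Qed.

Lemma wolff_le_of_trace (C0 : R) : (0 < C0)%R -> trace_inequality k sigma mu p q C0 ->
  \int[mu]_x wolff k sigma mu p x `^ s < +oo.
Proof.
move=> C00 trace; set B := (C0 `^ q^-1)%R.
have B0 : (0 <= B)%R by exact: powR_ge0.
(* Here the trace inequality enters, through the pointwise lower bound of the operator by its
   annular model. *)
have bound (f : X -> R) D : (0 < D)%R -> measurable_fun setT f ->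
    (forall x, (0 <= f x)%R) -> (exists M, forall x, (f x <= M)%R) ->
    \int[sigma]_x ((f x)%:E `^ p) < +oo ->
    (\int[mu]_x annop sigma (dyadic_cube D) (dyadic_ker (n := n) k D) (EFin \o f) x `^ q) `^ q^-1 <=
    B%:E * (\int[sigma]_x ((f x)%:E `^ p)) `^ p^-1.
  move=> D0 mf f0 _ ffin.
  have NE : 'N[sigma]_(p%:E)[EFin \o f] = (\int[sigma]_x ((f x)%:E `^ p)) `^ p^-1.
    rewrite unlock; congr (_ `^ _); apply: eq_integral => x _ /=.
    by rewrite ger0_norm.
  have fL : f \in Lfun sigma p%:E.
    rewrite inE; apply/andP; split; first by rewrite inE.
    rewrite inE/= /finite_norm. rewrite NE; apply: poweR_lty => //.
  have [_ h] := trace f fL.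
  rewrite NE in h; set F := (\int[sigma]_x ((f x)%:E `^ p)) `^ p^-1 in h *.
  have F0 : 0 <= F by exact: poweR_ge0.
  have -> : B%:E * F = (C0%:E * F `^ q) `^ q^-1.
    rewrite poweRM ?poweR_ge0// ?lee_fin ?ltW// -poweRrM mulfV ?gt_eqF// poweRe1//.
  apply: le_poweR; first by rewrite invr_ge0 ltW.
    by apply: integral_ge0 => x _; exact: poweR_ge0.
  apply: le_trans h; apply: le_int => x; first exact: poweR_ge0.
  have o0 y : 0 <= offdiag k f x y by rewrite lee_fin mulr_ge0 ?kernel_pos_ge0.
  apply: le_poweR; first exact: ltW.
    apply: nneseries_ge0 => i _ _; apply: mule_ge0; first by rewrite lee_fin dyadic_ker_ge0.
    by apply: integral_ge0 => y _; rewrite lee_fin.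
  rewrite Tk_offdiag// gee0_abs; last exact: integral_ge0.
  exact: (annop_le_offdiag n0 k_ge0 k_noninc C1 sigmaD ball_gt0 ball_lty D0).
set W := ((@wolff_upper_cst R n C A p) `^ s * necessity_cst Th Ak t p q B)%R.
have U0 : (0 <= @wolff_upper_cst R n C A p)%R by exact: wolff_upper_cst_ge0.
have main J : \int[mu]_x wolff_trunc sigma mu k p (rad J) x `^ s <= W%:E.
  have D0 := big J.
  have Kge i : (0 <= dyadic_ker (n := n) k (2 ^+ J) i)%R by exact: dyadic_ker_ge0.
  have ann i x : sigma (dyadic_cube (2 ^+ J)%R i x) <=
      Th%:E * sigma (dyadic_cube (2 ^+ J)%R i x `\` dyadic_cube (2 ^+ J)%R i.+1 x).
    have := cube_annulus C1 sigmaD n0 x (scale_gt0 i D0).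
    by rewrite /dyadic_cube scaleS.
  have nec := dyadic_necessity (CS D0) Kge Ak0 t1 p1 pt (kcmp D0) ann (muN D0) B0
    (fun f mf f0 fb fin => bound f _ D0 mf f0 fb fin) erefl q1 qp.
  set V := pot _ _ _ _ _ _ in nec.
  have mal i : measurable_fun setT (wolff_coef sigma (dyadic_cube (2 ^+ J)%R) (dyadic_ker (n := n) k (2 ^+ J)) t i).
    exact: (measurable_wolff_coef (CS D0)).
  have al0 i x : 0 <= wolff_coef sigma (dyadic_cube (2 ^+ J)%R) (dyadic_ker (n := n) k (2 ^+ J)) t i x.
    exact: wolff_coef_ge0.
  have V0 x : 0 <= V x by exact: pot_ge0.
  have mV : measurable_fun setT V by exact: (measurable_pot_nbhd mu (CS D0) t mal al0).
  apply: (@le_trans _ _ (\int[mu]_x (((@wolff_upper_cst R n C A p) `^ s)%:E * V x `^ s))).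
    apply: le_int => x; first exact: poweR_ge0.
    rewrite -poweR_EFin -poweRM ?lee_fin//; apply: le_poweR; first exact: ltW.
      by apply: integral_ge0 => r _; exact: wolff_density_ge0.
    exact: wolff_trunc_le_pot.
  rewrite ge0_integralZl//; last 3 first.
  - exact: (measurableT_comp (measurable_poweR _)).
  - by move=> x _; exact: poweR_ge0.
  - by rewrite lee_fin powR_ge0.
  rewrite /W EFinM; apply: lee_wpmul2l => //.
  by rewrite lee_fin powR_ge0.
apply: (@le_lt_trans _ _ W%:E); last by rewrite ltry.
have tr0 r x : 0 <= wolff_trunc sigma mu k p r x.
  by apply: integral_ge0 => u _; exact: wolff_density_ge0.
have w0 x : 0 <= wolff k sigma mu p x.
  by rewrite wolffE; apply: integral_ge0 => u _; exact: wolff_density_ge0.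
apply: (@integral_le_sup _ _ _ mu (fun J x => wolff_trunc sigma mu k p (rad J) x `^ s)) => //.
- move=> J; apply: (measurableT_comp (measurable_poweR _)); exact: measurable_wolff_trunc.
- by move=> J x; exact: poweR_ge0.
- by move=> x; exact: poweR_ge0.
- move=> x J J' JJ; apply: le_poweR; [exact: ltW|exact: tr0|].
  apply: int_set_le => [r|r]; last exact: wolff_density_ge0.
  by rewrite /= !in_itv/= => /andP[-> h]; exact: lt_le_trans (rad_nd JJ).
- move=> x; apply: (@poweR_le_sup _ (fun J => wolff_trunc sigma mu k p (rad J) x)) => //.
  by move=> c; exact: wolff_trunc_sup.
Qed.

Let offT (g : X -> R) x := \int[sigma]_y offdiag k g x y.

Lemma offdiag_sup (g : X -> R) x (c : \bar R) : measurable_fun setT g -> (forall y, (0 <= g y)%R) ->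
  (forall J, \int[sigma]_(y in eball x (rad J)) offdiag k g x y <= c) -> offT g x <= c.
Proof.
move=> mg g0 H.
have o0 y : 0 <= offdiag k g x y by rewrite lee_fin mulr_ge0 ?kernel_pos_ge0.
have mo : measurable_fun setT (offdiag k g x) by exact: measurable_offdiag_at.
apply: (@integral_le_sup _ _ _ sigma (fun J => offdiag k g x \_ (eball x (rad J)))) => //.
- move=> J; apply/(measurable_restrictT _ _).1; first exact: measurable_eball.
  exact: measurable_funTS.
- by move=> J y; rewrite /patch; case: ifP.
- move=> y J J' JJ; rewrite /patch; case: ifPn => [|_]; last by case: ifP.
  rewrite inE => h; rewrite ifT// inE; exact: lt_le_trans h (rad_nd JJ).
- move=> y; have [J hJ] := rad_unbounded (euclid_dist x y).
  by apply: ereal_sup_ubound; exists J => //; rewrite /patch ifT// inE.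
- by move=> J; rewrite -integral_mkcond; exact: H.
Qed.

Lemma measurable_offT (g : X -> R) : measurable_fun setT g -> (forall y, (0 <= g y)%R) ->
  measurable_fun setT (offT g).
Proof.
move=> mg g0.
apply: (@measurable_fun_fubini_tonelli_F _ _ _ _ _ sigma (fun z : X * X => offdiag k g z.1 z.2)).
  exact: measurable_offdiag.
by move=> z; rewrite lee_fin mulr_ge0 ?kernel_pos_ge0.
Qed.

Lemma measurable_offdiag_ball (g : X -> R) r : measurable_fun setT g -> (forall y, (0 <= g y)%R) ->
  measurable_fun setT (fun x : X => \int[sigma]_(y in eball x r) offdiag k g x y).
Proof.
move=> mg g0; pose G (z : X * X) := offdiag k g z.1 z.2 * ((euclid_dist z.1 z.2 < r)%R : bool)%:R%:E.
apply: (eq_measurable_fun (fun x => \int[sigma]_y G (x, y))).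
  move=> x _; rewrite (integral_in_indic sigma (eball x r) (offdiag k g x)).
  by apply: eq_integral => y _; rewrite /G/= indic_eball.
apply: (@measurable_fun_fubini_tonelli_F _ _ _ _ _ sigma G).
  apply: emeasurable_funM; first exact: measurable_offdiag.
  by apply: measurable_fun_lt_EFin => //; exact: measurable_euclid_dist.
by move=> z; rewrite mule_ge0// lee_fin mulr_ge0 ?kernel_pos_ge0.
Qed.

Lemma trace_of_wolff : \int[mu]_x wolff k sigma mu p x `^ s < +oo ->
  exists2 C0 : R, (0 < C0)%R & trace_inequality k sigma mu p q C0.
Proof.
move=> wfin.
have w0 x : 0 <= wolff k sigma mu p x.
  by rewrite wolffE; apply: integral_ge0 => u _; exact: wolff_density_ge0.
set Iw := \int[mu]_x wolff k sigma mu p x `^ s in wfin.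
have I0 : 0 <= Iw by apply: integral_ge0 => x _; exact: poweR_ge0.
have If : Iw \is a fin_num by rewrite ge0_fin_numE.
set L := @wolff_lower_cst R n C A p.
have L0 : (0 <= L)%R by exact: wolff_lower_cst_ge0.
set B := (L `^ s * fine Iw)%R.
set S := sufficiency_cst Th Ak t p q B.
have potB D (D0 : (0 < D)%R) : \int[mu]_x pot sigma mu (dyadic_cube D)
    (wolff_coef sigma (dyadic_cube D) (dyadic_ker (n := n) k D) t) t (dyadic_cube D) x `^ s <= B%:E.
  have al0 i x : 0 <= wolff_coef sigma (dyadic_cube D) (dyadic_ker (n := n) k D) t i x.
    by apply: wolff_coef_ge0 => l; exact: dyadic_ker_ge0.
  apply: (@le_trans _ _ (\int[mu]_x ((L `^ s)%:E * wolff k sigma mu p x `^ s))).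
    apply: le_int => x; first exact: poweR_ge0.
    rewrite -poweR_EFin -poweRM ?lee_fin//; apply: le_poweR; first exact: ltW.
      exact: pot_ge0.
    exact: pot_le_wolff.
  rewrite ge0_integralZl//; last 3 first.
  - by apply: (measurableT_comp (measurable_poweR _)); exact: measurable_wolff.
  - by move=> x _; exact: poweR_ge0.
  - by rewrite lee_fin powR_ge0.
  by rewrite /B EFinM fineK.
have key (g : X -> R) : measurable_fun setT g -> (forall y, (0 <= g y)%R) ->
    \int[sigma]_x ((g x)%:E `^ p) < +oo ->
    \int[mu]_x offT g x `^ q <= S%:E * ((\int[sigma]_x (g x)%:E `^ p) `^ p^-1) `^ q.
  move=> mg g0 gfin.
  have o0 x y : 0 <= offdiag k g x y by rewrite lee_fin mulr_ge0 ?kernel_pos_ge0.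
  apply: (@integral_le_sup _ _ _ mu
    (fun J x => (\int[sigma]_(y in eball x (rad J)) offdiag k g x y) `^ q)).
  - by move=> J; apply: (measurableT_comp (measurable_poweR _)); exact: measurable_offdiag_ball.
  - by move=> J x; exact: poweR_ge0.
  - by move=> x; exact: poweR_ge0.
  - move=> x J J' JJ; apply: le_poweR; [exact: ltW|exact: integral_ge0|].
    apply: int_set_le => // y h; exact: lt_le_trans h (rad_nd JJ).
  - move=> x; apply: (@poweR_le_sup _ (fun J => \int[sigma]_(y in eball x (rad J)) offdiag k g x y)) => //.
    + by move=> J; exact: integral_ge0.
    + exact: integral_ge0.
    + by move=> c; exact: offdiag_sup.
  - move=> J; have D0 := big J.
    have Kge i : (0 <= dyadic_ker (n := n) k (2 ^+ J) i)%R by exact: dyadic_ker_ge0.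
    have mEg : measurable_fun setT (EFin \o g) by exact/measurable_EFinP.
    have suf := dyadic_sufficiency (CS D0) Kge Ak0 t1 p1 pt (kcmp D0) (muN D0)
      erefl q1 qp (potB _ D0) mEg g0 gfin.
    apply: le_trans suf; apply: le_int => x; first exact: poweR_ge0.
    apply: le_poweR; [exact: ltW|exact: integral_ge0|].
    exact: offdiag_ball_le.
(* The constant has to be positive, and [S] may vanish. *)
exists (Num.max S 1)%R; first by rewrite lt_max ltr01 orbT.
move=> f; rewrite inE => /andP[]; rewrite inE/= => mf; rewrite inE/= /finite_norm => Nfin.
pose g y := `|f y|%R.
have mg : measurable_fun setT g by exact: measurableT_comp.
have g0 y : (0 <= g y)%R by exact: normr_ge0.
have NE : 'N[sigma]_(p%:E)[EFin \o f] = (\int[sigma]_x ((g x)%:E `^ p)) `^ p^-1.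
  by rewrite unlock; congr (_ `^ _); apply: eq_integral.
have gfin : \int[sigma]_x ((g x)%:E `^ p) < +oo.
  have := @poweR_Lnorm _ _ _ sigma (EFin \o f) p; rewrite gt_eqF// => /(_ isT) h.
  rewrite (_ : \int[sigma]_x _ = \int[sigma]_x `|(EFin \o f) x| `^ p); last by apply: eq_integral.
  by rewrite -h; apply: poweR_lty.
have T0 x : 0 <= offT g x.
  by apply: integral_ge0 => y _; rewrite lee_fin mulr_ge0 ?kernel_pos_ge0.
have mT : measurable_fun setT (offT g) by exact: measurable_offT.
have mTq : measurable_fun setT (fun x => offT g x `^ q).
  exact: (measurableT_comp (measurable_poweR _)).
have bnd := key g mg g0 gfin; rewrite -NE in bnd.
have SN : S%:E * 'N[sigma]_(p%:E)[EFin \o f] `^ q <=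
    (Num.max S 1)%R%:E * 'N[sigma]_(p%:E)[EFin \o f] `^ q.
  by apply: lee_wpmul2r; [exact: poweR_ge0|rewrite lee_fin le_max lexx].
have absT x : \int[sigma]_y `|kernel0 k (euclid_dist x y) * (f y)%:E| = offT g x.
  exact: integral_abs_kernel0.
have mK (x : X) : measurable_fun setT (fun y : X => kernel0 k (euclid_dist x y) * (f y)%:E).
  exact: measurable_kernel0_at.
split.
  (* A function whose q-th power is integrable is finite almost everywhere; at such points the
     integral of |k f| is finite, which is the absolute convergence demanded. *)
  have iT : mu.-integrable setT (fun x : X => offT g x `^ q).
    apply/integrableP; split => //.
    under eq_integral do rewrite gee0_abs ?poweR_ge0//.
    apply: (le_lt_trans bnd); apply: (le_lt_trans SN).
    by apply: lte_mul_pinfty; rewrite ?lee_fin ?le_max ?ler01 ?orbT//; apply: poweR_lty.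
  have := integrable_ae measurableT iT; apply: filterS => x /(_ I) hx.
  apply/integrableP; split => //; rewrite absT ltNge leye_eq; apply/negP => /eqP h.
  by move: hx; rewrite h poweRyr// gt_eqF.
apply: le_trans (le_trans bnd SN); apply: le_int => x; first exact: poweR_ge0.
apply: le_poweR; [exact: ltW|exact: abse_ge0|].
by rewrite -absT; apply: le_abse_integral.
Qed.

End trace_characterization.

Local Close Scope ereal_scope.
Unset Implicit Arguments.

Theorem theoremC (R : realType) (n : nat) (hn : (0 < n)%N)
    (k : R -> R) (p q : R) (mu sigma : {measure set (borelRn R n) -> \bar R})
    (k_ge0 : forall r : R, 0 < r -> 0 <= k r)
    (k_noninc : forall r s : R, 0 < r -> r <= s -> k s <= k r)
    (k_lsc : lower_semicontinuous
       (fun r : subspace (`]0, +oo[%classic : set R) => (k r)%:E))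
    (hq : 1 <= q) (hqp : q < p)
    (mu_lf : locally_finite mu) (sigma_lf : locally_finite sigma)
    (sigma_doubling : doubling sigma) (k_LBO : LBO k sigma) :
  (exists2 C : R, 0 < C & trace_inequality k sigma mu p q C)
  <->
  memLp mu (q * (p - 1) / (p - q)) (wolff k sigma mu p).
Proof.
have [C C1 sigmaD] := doubling_ge1_cst sigma_doubling.
have ball_gt0 (x : borelRn R n) r : 0 < r -> (0 < sigma (eball x r))%E.
  exact: (doubling_ball_gt0 C1 sigmaD _ sigma_doubling.1).
have ball_lty := locally_finite_ball sigma_lf.
have mu_ball_lty := locally_finite_ball mu_lf.
have s0 : 0 < q * (p - 1) / (p - q).
  by rewrite divr_gt0 ?subr_gt0// mulr_gt0 ?(lt_le_trans ltr01 hq)// subr_gt0 (le_lt_trans hq).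
(* Tonelli's theorem is stated for sigma-finite measures, so both measures are replaced by
   sigma-finite structures equal to them. *)
have [m muE] := sigma_finite_measureP (locally_finite_sigma_finite mu_lf).
have [v sigmaE] := sigma_finite_measureP (locally_finite_sigma_finite sigma_lf).
subst mu sigma.
(* Pointwise form of LBO. Raising the constant to at least 1 is allowed because the infimum is
   nonnegative. *)
have [A A1 lbo] : exists2 A : R, 1 <= A & forall (x : borelRn R n) r, 0 < r ->
    forall y z : borelRn R n, eball x r y -> eball x r z ->
    (kbar k v r y <= A%:E * kbar k v r z)%E.
  have [A HA] := k_LBO; exists (Num.max A 1); first by rewrite le_max lexx orbT.
  move=> x r r0 y z xy xz.
  apply: (@le_trans _ _ (ereal_sup [set kbar k v r y | y in eball x r])).
    by apply: ereal_sup_ubound; exists y.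
  apply: (le_trans (HA x r r0)).
  have inf0 : (0 <= ereal_inf [set kbar k v r y | y in eball x r])%E.
    by apply: le_ereal_inf_tmp => _ [u _ <-]; exact: kbar_ge0.
  apply: (@le_trans _ _ ((Num.max A 1)%:E * ereal_inf [set kbar k v r y | y in eball x r])%E).
    by apply: lee_wpmul2r => //; rewrite lee_fin le_max lexx.
  apply: lee_wpmul2l; first by rewrite lee_fin le_max ler01 orbT.
  by apply: ereal_inf_lbound; exists z.
have w0 x : (0 <= wolff k v m p x)%E.
  by rewrite wolffE; apply: integral_ge0 => u _; exact: wolff_density_ge0.
have normE : 'N[m]_((q * (p - 1) / (p - q))%:E)[wolff k v m p]%E =
    ((\int[m]_x wolff k v m p x `^ (q * (p - 1) / (p - q))) `^ (q * (p - 1) / (p - q))^-1)%E.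
  by rewrite unlock; congr (_ `^ _)%E; apply: eq_integral => x _; rewrite gee0_abs.
rewrite /memLp normE; split.
- move=> [C0 C00 trace]; split; first exact: measurable_wolff.
  apply: poweR_lty.
  exact: (wolff_le_of_trace hn k_ge0 k_noninc C1 sigmaD ball_gt0 ball_lty mu_ball_lty A1 lbo
    hq hqp C00 trace).
- move=> [_ fin].
  apply: (trace_of_wolff hn k_ge0 k_noninc C1 sigmaD ball_gt0 ball_lty mu_ball_lty A1 lbo hq hqp).
  by apply: lty_poweRy fin; rewrite invr_eq0 gt_eqF.
Qed.
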